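(* Let $r>\frac92$, $\tau_0>0$, $s\ge 1$, and let $a\in\mathcal{G}^s_{r,\tau_0}(\mathbb{T}^3)$. Then there exist $\nu_0>0$, $T>0$ and a decreasing function $\tau:[0,T]\to(0,\infty)$ such that: (i) for every $0<\nu\le\nu_0$ the Navier-Stokes equations $$\partial_t u^\nu-\nu\Delta u^\nu+(u^\nu\cdot\nabla)u^\nu+\nabla p^\nu=0,\qquad \nabla\cdot u^\nu=0,\qquad u^\nu|_{t=0}=a$$ on $\mathbb{T}^3$ admit a solution with $$u^\nu\in L^\infty([0,T];\mathcal{G}^s_{r,\tau(\cdot)}(\mathbb{T}^3)),\qquad p^\nu\in L^\infty([0,T];\mathcal{G}^s_{r+1,\tau(\cdot)}(\mathbb{T}^3));$$ (ii) the Euler equations $$\partial_t u+(u\cdot\nabla)u+\nabla p=0,\qquad \nabla\cdot u=0,\qquad u|_{t=0}=a$$ on $\mathbb{T}^3$ admit a solution with $$u\in L^\infty([0,T];\mathcal{G}^s_{r,\tau(\cdot)}(\mathbb{T}^3)),\qquad p\in L^\infty([0,T];\mathcal{G}^s_{r+1,\tau(\cdot)}(\mathbb{T}^3));$$ (iii) there is a constant $C$ depending only on $r,s,a$ and $T$ (in particular not on $\nu$) such that for all $0<\nu\le\nu_0$ and all $0<t\le T$, $$\|u^\nu(t,\cdot)-u(t,\cdot)\|_{\mathcal{G}^s_{r-1,\tau(t)}}\le C\sqrt{\nu},\qquad \|p^\nu(t,\cdot)-p(t,\cdot)\|_{\mathcal{G}^s_{r,\tau(t)}}\le C\sqrt{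\nu}.$$
   Context: $\mathbb{T}^3=(-\pi,\pi)^3$ with periodic boundary conditions. Functions are expanded in Fourier series $u=\sum_{j\in\mathbb{Z}^3}\hat u_j e^{ij\cdot x}$. $\mathcal{H}^r(\mathbb{T}^3)$ is the space of $\mathbb{R}^3$-valued periodic $u$ (i.e. $\hat u_k=\overline{\hat u_{-k}}\in\mathbb{C}^3$) with $\hat u_0=0$, $j\cdot\hat u_j=0$ for all $j$ (divergence free), and $\|u\|_{H^r}^2=\sum_{k}(1+|k|^2)^r|\hat u_k|^2<\infty$. For $s\ge1$, $\tau>0$, $r\in\mathbb{R}$, the Gevrey space is $$\mathcal{G}^s_{r,\tau}(\mathbb{T}^3)=\Big\{u\in\mathcal{H}^r(\mathbb{T}^3):\ \|u\|_{\mathcal{G}^s_{r,\tau}}^2=\sum_{j\in\mathbb{Z}^3}|j|^{2r}e^{2\tau|j|^{1/s}}|\hat u_j|^2<\infty\Big\}.$$ For scalar functions such as the pressure (determined up to an additive constant, normalized to have zero mean) the same norm is used, without the divergence-free condition. $f\in L^\infty([0,T];\mathcal{G}^s_{r,\tau(\cdot)})$ means that $f(t,\cdot)\in\mathcal{G}^s_{r,\tau(t)}$ for (almost every) $t\in[0,T]$ and $\operatorname{ess\,sup}_{t\in[0,T]}\|f(t,\cdot)\|_{\mathcal{G}^s_{r,\tau(t)}}<\infty$. The equations are understood in the sense of distributions on $(0,T)\times\mathbb{T}^3$ with the initial value attained at $t=0$. *)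

(* Defs.v *)
From HB Require Import structures.
From mathcomp Require Import all_boot all_order all_algebra.
From mathcomp Require Import all_classical all_reals all_analysis.
From mathcomp Require Import ess_sup_inf complex.

Set Implicit Arguments.
Unset Strict Implicit.
Unset Printing Implicit Defensive.

Import Order.TTheory GRing.Theory Num.Theory.
Import numFieldNormedType.Exports.

Local Open Scope classical_set_scope.
Local Open Scope complex_scope.
Local Open Scope ring_scope.

(* Points of R^3 are triples, so that the product topology, the product
   sigma-algebra and the product Lebesgue measure of the library apply.
   Functions on the torus are functions on R^3 that are 2pi-periodic in each
   coordinate; integrals are taken over the cell (-pi, pi)^3. *)
Notation point3 R := (R * R * R)%type.
Notation scalar_field R := (point3 R -> R).
Notation vector_field R := (point3 R -> 'rV[R]_3).
Notation freq := 'rV[int]_3.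

(* The library proves that a product of sigma-finite measures is sigma-finite
   but the canonical instance is shadowed by the one for subprobabilities. *)
Lemma sigma_finite_product d1 d2 (T1 : measurableType d1)
    (T2 : measurableType d2) (R : realType)
    (m1 : {sigma_finite_measure set T1 -> \bar R})
    (m2 : {sigma_finite_measure set T2 -> \bar R}) :
  sigma_finite setT (m1 \x m2)%E.
Proof.
have /sigma_finiteP[F [TF ndF Foo]] := sigma_finiteT m1.
have /sigma_finiteP[G [TG ndG Goo]] := sigma_finiteT m2.
exists (fun n => F n `*` G n).
  rewrite -setXTT TF TG predeqE => -[x y]; split.
    move=> [/= [n _ Fnx] [k _ Gky]]; exists (maxn n k) => //; split.
    - by move: x Fnx; exact/subsetPset/ndF/leq_maxl.
    - by move: y Gky; exact/subsetPset/ndG/leq_maxr.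
  by move=> [n _ []/= ? ?]; split; exists n.
move=> k; have [? ?] := Foo k; have [? ?] := Goo k.
split; first exact: measurableX.
by rewrite product_measure1E// lte_mul_pinfty// ge0_fin_numE.
Qed.

Section Lebesgue.
Context (R : realType).

Definition leb1 := @lebesgue_measure R.
HB.instance Definition _ := SigmaFiniteMeasure.on leb1.

Definition leb2 := (leb1 \x leb1)%E.
HB.instance Definition _ := Measure.on leb2.
HB.instance Definition _ :=
  Measure_isSigmaFinite.Build _ _ _ leb2 (sigma_finite_product leb1 leb1).

Definition leb3 := (leb2 \x leb1)%E.
HB.instance Definition _ := Measure.on leb3.
HB.instance Definition _ :=
  Measure_isSigmaFinite.Build _ _ _ leb3 (sigma_finite_product leb2 leb1).

Definition leb4 := (leb1 \x leb3)%E.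
HB.instance Definition _ := Measure.on leb4.
HB.instance Definition _ :=
  Measure_isSigmaFinite.Build _ _ _ leb4 (sigma_finite_product leb1 leb3).

End Lebesgue.

Arguments leb1 {R}.
Arguments leb2 {R}.
Arguments leb3 {R}.
Arguments leb4 {R}.

Section Torus.
Context {R : realType}.
Implicit Types (f g : scalar_field R) (u v : vector_field R).
Implicit Types (k : freq) (x : point3 R) (r s tau : R).

Definition coordinate x (i : 'I_3) : R := [:: x.1.1; x.1.2; x.2]`_i.

Definition unit_vector (i : 'I_3) : point3 R :=
  ((i == 0 :> nat)%:R, (i == 1%N :> nat)%:R, (i == 2%N :> nat)%:R).

Definition component u (i : 'I_3) : scalar_field R := fun x => u x ord0 i.

Definition torus_periodic f :=
  forall x (i : 'I_3), f (x + (2 * pi) *: unit_vector i) = f x.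

Definition cell : set (point3 R) :=
  (`]- pi, pi[ `*` `]- pi, pi[) `*` `]- pi, pi[.

Definition freq_dot k x : R := \sum_(i < 3) (k ord0 i)%:~R * coordinate x i.

Definition freq_norm k : R := Num.sqrt (\sum_(i < 3) (k ord0 i)%:~R ^+ 2).

(* (2pi)^-3 times the integral of f(x) exp(-ik.x) over the cell. *)
Definition fourier f k : R[i] :=
  ((2 * pi) ^- 3 * \int[leb3]_(x in cell) (f x * cos (freq_dot k x)))%R +i*
  (- ((2 * pi) ^- 3 * \int[leb3]_(x in cell) (f x * sin (freq_dot k x))))%R.

Definition sqmod f k : R := Normc.normc (fourier f k) ^+ 2.

Definition vsqmod u k : R := \sum_(i < 3) sqmod (component u i) k.

Definition weighted_norm (w c : freq -> R) : \bar R :=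
  poweR (\esum_(k in [set: freq]) (w k * c k)%:E) 2^-1.

Definition sobolev_weight r k : R := (1 + freq_norm k ^+ 2) `^ r.

(* [0 `^ r = 0] for r != 0; the weight at k = 0 is irrelevant for the
   functions considered below, which have zero mean. *)
Definition gevrey_weight s r tau k : R :=
  freq_norm k `^ (2 * r) * expR (2 * tau * freq_norm k `^ s^-1).

Definition sobolev_norm r u := weighted_norm (sobolev_weight r) (vsqmod u).

Definition scalar_sobolev_norm r f := weighted_norm (sobolev_weight r) (sqmod f).

Definition gevrey_norm s r tau u :=
  weighted_norm (gevrey_weight s r tau) (vsqmod u).

Definition scalar_gevrey_norm s r tau f :=
  weighted_norm (gevrey_weight s r tau) (sqmod f).

Definition periodic_integrable f :=
  torus_periodic f /\ leb3.-integrable cell (EFin \o f).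

(* For r < 0 this only contains the elements of the Sobolev space that are
   functions. *)
Definition in_sobolev r u :=
  [/\ forall i, periodic_integrable (component u i),
      forall i, fourier (component u i) 0 = 0,
      forall k, \sum_(i < 3) (k ord0 i)%:~R * fourier (component u i) k = 0 &
      (sobolev_norm r u < +oo)%E].

Definition in_scalar_sobolev r f :=
  [/\ periodic_integrable f, fourier f 0 = 0 &
      (scalar_sobolev_norm r f < +oo)%E].

Definition in_gevrey s r tau u :=
  in_sobolev r u /\ (gevrey_norm s r tau u < +oo)%E.

Definition in_scalar_gevrey s r tau f :=
  in_scalar_sobolev r f /\ (scalar_gevrey_norm s r tau f < +oo)%E.

End Torus.

Section Evolution.
Context {R : realType}.
Implicit Types (u : R -> vector_field R) (p : R -> scalar_field R).
Implicit Types (phi : R * point3 R -> R) (tau : R -> R) (T nu : R).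

Definition Linfty_gevrey s r tau T u :=
  {ae leb1, forall t, t \in `[0, T] -> in_gevrey s r (tau t) (u t)} /\
  (ess_sup leb1
     ((fun t => gevrey_norm s r (tau t) (u t)) \_ `[0%R, T]) < +oo)%E.

Definition Linfty_scalar_gevrey s r tau T p :=
  {ae leb1, forall t, t \in `[0, T] -> in_scalar_gevrey s r (tau t) (p t)} /\
  (ess_sup leb1
     ((fun t => scalar_gevrey_norm s r (tau t) (p t)) \_ `[0%R, T]) < +oo)%E.

(* Continuity on [0, T] with values in H^0 (that is, in L^2). *)
Definition time_continuous T u :=
  forall t, t \in `[0, T] -> in_sobolev 0 (u t) /\
    sobolev_norm 0 (u t' \- u t) @[t' --> within `[0, T] (nbhs t)] --> 0%E.

Definition scalar_time_continuous T p :=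
  forall t, t \in `[0, T] -> in_scalar_sobolev 0 (p t) /\
    scalar_sobolev_norm 0 (p t' \- p t) @[t' --> within `[0, T] (nbhs t)]
      --> 0%E.

Definition cylinder T : set (R * point3 R) := `]0, T[ `*` cell.

Definition dt phi : R * point3 R -> R := 'D_((1, 0) : R * point3 R) phi.

Definition dx (i : 'I_3) phi : R * point3 R -> R :=
  'D_((0, unit_vector i) : R * point3 R) phi.

Definition laplacian phi : R * point3 R -> R :=
  fun z => \sum_(i < 3) dx i (dx i phi) z.

Definition smooth phi :=
  forall vs : seq (R * point3 R),
    let psi := foldr (fun v g => 'D_v g) phi vs in
    continuous psi /\ forall z v, derivable psi z v.

Definition test_function T phi :=
  [/\ smooth phi, forall t, torus_periodic (fun x => phi (t, x)) &
      exists a b, [/\ 0 < a, b < T &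
        forall t x, t \notin `[a, b] -> phi (t, x) = 0]].

Definition integrable_on_cylinder T (F : R * point3 R -> R) :=
  leb4.-integrable (cylinder T) (EFin \o F).

Definition uc u (i : 'I_3) (z : R * point3 R) : R := component (u z.1) i z.2.

Definition pc p (z : R * point3 R) : R := p z.1 z.2.

Definition weak_divergence_free T u := forall phi, test_function T phi ->
  \int[leb4]_(z in cylinder T) (- \sum_(i < 3) uc u i z * dx i phi z) = 0.

(* Since div u = 0, the i-th component of (u . grad) u is the distribution
   sum_j d_j (u_j u_i). *)
Definition weak_momentum nu T u p := forall (i : 'I_3) phi,
  test_function T phi ->
  \int[leb4]_(z in cylinder T)
    (- (uc u i z * dt phi z) - nu * (uc u i z * laplacian phi z)
     - \sum_(j < 3) uc u j z * uc u i z * dx j phi z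
     - pc p z * dx i phi z) = 0.

(* The integrability conditions make every term of the equations a
   distribution. Time continuity selects, among the representatives of u and
   p modulo null sets of times, the one that has a value at every t in [0, T];
   in particular it says in which sense the initial value is attained. *)
Definition navier_stokes_solution nu T (a : vector_field R) u p :=
  [/\ [/\ forall i, integrable_on_cylinder T (uc u i),
          forall i j, integrable_on_cylinder T
                        (fun z => uc u j z * uc u i z) &
          integrable_on_cylinder T (pc p)],
      weak_momentum nu T u p,
      weak_divergence_free T u &
      [/\ time_continuous T u, scalar_time_continuous T p & u 0 = a]].

Definition euler_solution := navier_stokes_solution 0.

End Evolution.

(* Main.v *)
(** In Fourier variables, a weight |k|^m exp(tau |k|^(1/s)) with a shrinking
    radius tau(t) = tau - lambda t turns the loss of half a derivative in the
    energy estimate of the transport term into dissipation: the antisymmetry of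
    the transport term reduces its contribution to the commutator w_k - w_l of
    the weight, which costs |k|^(1/(2s)) |l|^(1/(2s)) and is absorbed for lambda
    large. This bounds all the Galerkin truncations, uniformly in the viscosity,
    on a common time interval, with arbitrarily many derivatives, since the
    initial radius may be halved at the start. A Gronwall estimate in l^2 then
    compares two truncations: their Fourier coefficients differ by
    O(|nu - nu'| + n^(-1/2)). Together with the weighted l^1 bounds, this gives
    convergence of velocity and pressure to a solution, and the interpolation
    sum W |d|^2 <= sup |d| * sum W (|a| + |b|) for d = a - b turns the
    O(nu) bound on the coefficients into the rate sqrt(nu). *)

Require Import Defs.
From HB Require Import structures.
From mathcomp Require Import all_boot all_order all_algebra.
From mathcomp Require Import all_classical all_reals all_analysis.
From mathcomp Require Import ess_sup_inf complex.
From mathcomp Require Import ring lra zify.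

Set Implicit Arguments.
Unset Strict Implicit.
Unset Printing Implicit Defensive.

Import Order.TTheory GRing.Theory Num.Theory.
Import numFieldNormedType.Exports.

Local Open Scope classical_set_scope.
Local Open Scope ring_scope.

(** * Differential inequalities and Picard iteration *)

Section RealAnalysis.
Context {R : realType}.
Implicit Types (f g df dg : R -> R) (a b t : R).

(** The transport term costs one derivative, so the equations are not ordinary differential
    equations in a fixed Gevrey space. The truncations are, but their quadratic right-hand side is
    not globally Lipschitz. It is therefore clamped and solved globally by Picard iteration, and a
    barrier argument shows that the clamp is inactive on [0, T]. Passages to the limit rest on l^1
    bounds of the coefficients: they make the trigonometric polynomials converge uniformly, so that
    the limits are continuous, and they reduce convolution estimates to products of sums. Passing
    from l^2 to l^1 costs three powers of |k|, through sum |k|^-6 <= 1000 and the bound 40 for its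
    root; this is why spare powers m > J > 2r + 2 are carried along. The Gevrey norm is quadratic in
    the coefficients while the l^1 weight enters linearly; this doubles exponent and radius, and the
    radius is halved once more at the end. The pressure is an explicit quadratic expression of order
    zero in the coefficients of the velocity, so its bounds are those of a convolution rather than
    of an elliptic problem. *)

Lemma is_derive_continuous f (x d : R) : is_derive x 1 f d -> {for x, continuous f}.
Proof. by move=> [fx _]; apply: differentiable_continuous; exact/derivable1_diffP. Qed.

Lemma ge0_derive_le f df a b : a <= b ->
  (forall t, a <= t <= b -> is_derive t 1 f (df t)) ->
  (forall t, a <= t <= b -> 0 <= df t) -> f a <= f b.
Proof.
move=> ab fd d0.
have cf : {within `[a, b], continuous f}.
  apply: derivable_within_continuous => x; rewrite in_itv/= => xab.
  by case: (fd x xab).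
have fd' x : x \in `]a, b[ -> is_derive x 1 f (df x).
  by rewrite in_itv/= => /andP[/ltW ax /ltW xb]; apply: fd; rewrite ax xb.
have [c] := MVT_segment ab fd' cf.
by rewrite in_itv/= => cab e; rewrite -subr_ge0 e mulr_ge0 ?subr_ge0 ?d0.
Qed.

Lemma derive_le f df g dg a b : a <= b ->
  (forall t, a <= t <= b -> is_derive t 1 f (df t)) ->
  (forall t, a <= t <= b -> is_derive t 1 g (dg t)) ->
  (forall t, a <= t <= b -> df t <= dg t) -> f b - f a <= g b - g a.
Proof.
move=> ab fd gd d0.
have := @ge0_derive_le (fun t => g t - f t) (fun t => dg t - df t) a b ab.
have H t : a <= t <= b -> is_derive t 1 (fun t => g t - f t) (dg t - df t).
  by move=> tab; apply: is_deriveB; [exact: gd|exact: fd].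
move=> /(_ H) h; suff : g a - f a <= g b - f b by move=> ?; lra.
by apply: h => t tab; rewrite subr_ge0 d0.
Qed.

Lemma derive_norm_le f df g dg a b : a <= b ->
  (forall t, a <= t <= b -> is_derive t 1 f (df t)) ->
  (forall t, a <= t <= b -> is_derive t 1 g (dg t)) ->
  (forall t, a <= t <= b -> `|df t| <= dg t) -> `|f b - f a| <= g b - g a.
Proof.
move=> ab fd gd d0; rewrite ler_norml; apply/andP; split; last first.
  by apply: (derive_le ab fd gd) => t tab; exact: le_trans (ler_norm _) (d0 _ tab).
have H t : a <= t <= b -> is_derive t 1 (fun t => - f t) (- df t).
  by move=> tab; apply: is_deriveN; exact: fd.
have := derive_le ab H gd; rewrite lerNl opprB => h.
have : - f b - - f a <= g b - g a.
  by apply: h => t tab; rewrite (le_trans (ler_norm _))// normrN d0.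
by rewrite opprK addrC.
Qed.

Lemma derive0_eq f a b : a <= b ->
  (forall t, a <= t <= b -> is_derive t 1 f 0) -> f a = f b.
Proof.
move=> ab fd; apply/eqP; rewrite eq_sym -subr_eq0 -normr_le0.
have -> : 0 = (cst 0 : R -> R) b - (cst 0 : R -> R) a by rewrite /= subr0.
by apply: (@derive_norm_le f (cst 0) _ (cst 0)) => // t _; rewrite /= ?normr0//; exact: fd.
Qed.

Lemma is_derive_expM (c t : R) :
  is_derive t 1 (fun t => expR (c * t)) (c * expR (c * t)).
Proof.
have H : is_derive t 1 (fun t => c * t) c.
  have := @is_deriveZ _ _ _ id c t 1 1 (is_derive_id _ _).
  by rewrite /GRing.scale/= mulr1.
have := @is_derive1_comp _ expR (fun t => c * t) t _ _ (is_derive_expR _) H.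
by rewrite mulrC.
Qed.

(** The integrating factor [expR (- c * t)] is at most 1 because [0 <= c], so the source contributes
    at most [e * T] before the factor is undone. *)
Lemma gronwall f df (c e T : R) : 0 <= c -> 0 <= e -> 0 <= T ->
  (forall t, 0 <= t <= T -> is_derive t 1 f (df t)) ->
  (forall t, 0 <= t <= T -> df t <= c * f t + e) ->
  f T <= (f 0 + e * T) * expR (c * T).
Proof.
move=> c0 e0 T0 fd fle.
pose g t := f t * expR (- c * t).
pose dg t := f t * (- c * expR (- c * t)) + expR (- c * t) * df t.
have gd t : 0 <= t <= T -> is_derive t 1 g (dg t).
  move=> tT; apply: (@is_deriveM _ _ f (fun t => expR (- c * t))).
    exact: fd.
  exact: is_derive_expM.
have := @derive_le g dg (fun t => e * t) (cst e) 0 T T0 gd.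
have H t : 0 <= t <= T -> is_derive t 1 (fun t => e * t) (cst e t).
  move=> _; have := @is_deriveZ _ _ _ id e t 1 1 (is_derive_id _ _).
  by rewrite /GRing.scale/= mulr1.
move=> /(_ H) h.
have : g T - g 0 <= e * T - e * 0.
  apply: h => t tT; rewrite /dg /=.
  have -> : f t * (- c * expR (- c * t)) + expR (- c * t) * df t =
    expR (- c * t) * (df t - c * f t) by ring.
  apply: (@le_trans _ _ (expR (- c * t) * e)).
    by rewrite ler_wpM2l ?expR_ge0// lerBlDl fle.
  rewrite ler_piMl// -[leRHS]expR0 ler_expR mulNr oppr_le0 mulr_ge0//.
  by case/andP: tT.
rewrite /g mulr0 expR0 mulr1 mulr0 subr0 lerBlDl => {}h.
rewrite -ler_pdivrMr ?expR_gt0// -expRN -mulNr.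
by [].
Qed.

(** Integration starts at -1, so that the derivative at the initial time 0 is two-sided; the
    subtracted integral restores the value 0 at 0. *)
Definition antiderivative f t : R :=
  \int[lebesgue_measure]_(x in `[-1, t]) f x -
  \int[lebesgue_measure]_(x in `[-1, 0]) f x.

Lemma antiderivative0 f : antiderivative f 0 = 0.
Proof. exact: subrr. Qed.

Lemma is_derive_antiderivative f t : continuous f -> -1 < t ->
  is_derive t 1 (antiderivative f) (f t).
Proof.
move=> cf t1.
have fi : lebesgue_measure.-integrable `[-1, t + 1] (EFin \o f).
  apply: continuous_compact_integrable; first exact: segment_compact.
  exact: continuous_subspaceT.
have tt : t < t + 1 by rewrite ltrDl.
have [df dfE] := @continuous_FTC1_closed R f (-1) t (t + 1) tt fi t1 (cf t).
have H : is_derive t 1 (fun t => \int[lebesgue_measure]_(x in `[-1, t]) f x) (f t).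
  by rewrite derive1E in dfE; exact: (DeriveDef df dfE).
have := is_deriveB H (is_derive_cst
  (\int[lebesgue_measure]_(x in `[-1, 0]) f x : R) t (1 : R)).
by rewrite subr0.
Qed.

Lemma lipschitz_continuous f (L : R) :
  (forall x y, `|f x - f y| <= L * `|x - y|) -> continuous f.
Proof.
move=> fL x; apply/cvgrPdist_le => e e0.
have L1 : 0 < `|L| + 1 by rewrite ltr_wpDl.
near=> y; apply: (le_trans (fL x y)).
apply: (@le_trans _ _ ((`|L| + 1) * `|x - y|)).
  rewrite ler_wpM2r// (le_trans (ler_norm _))// lerDl//.
rewrite -ler_pdivlMl// mulrC.
near: y; apply: cvgr_dist_le; first exact: cvg_id.
by rewrite divr_gt0.
Unshelve. all: by end_near. Qed.

Lemma cvg_le_cst (u : nat -> R) (l c : R) : u @ \oo --> l ->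
  (\forall n \near \oo, u n <= c) -> l <= c.
Proof. by move=> ul uc; apply: (ler_cvg_to ul (cvg_cst c)). Qed.

(** The rate survives in the limit, which lets later error bounds be stated for the limit at every
    index. *)
Lemma cauchy_rate_cvg (u : nat -> R) (e : nat -> R) :
  (forall n m, (n <= m)%N -> `|u m - u n| <= e n) -> e @ \oo --> 0 ->
  exists2 l, u @ \oo --> l & forall n, `|l - u n| <= e n.
Proof.
move=> ue e0.
have cu : cvgn u.
  apply/cauchy_cvgP; apply: cauchy_exP => d d0.
  have /cvgrPdist_lt/(_ d d0)[N _ /(_ N (leqnn N))/= eN] := e0.
  exists (u N); exists N => // n /= Nn; rewrite /ball/= distrC.
  by rewrite (le_lt_trans (ue _ _ Nn))// (le_lt_trans (ler_norm _))// -normrN -sub0r.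
exists (limn u) => // n.
have h : `|u m - u n| @[m --> \oo] --> `|limn u - u n|.
  by apply: cvg_norm; apply: cvgB => //; exact: cvg_cst.
apply: (cvg_le_cst h); near=> m; apply: ue; near: m; exact: nbhs_infty_ge.
Unshelve. all: by end_near. Qed.

End RealAnalysis.

Section Picard.
Context {R : realType}.
Variables (I : Type).
Implicit Types (i j : I) (s t x : R).
Variables (F : (I -> R) -> I -> R) (L M : R) (x0 : I -> R).
Hypothesis L_gt0 : 0 < L.
Hypothesis F_le : forall (x : I -> R) i, `|F x i| <= M.
Hypothesis F_lip : forall (x y : I -> R) (d : R), (forall i, `|x i - y i| <= d) ->
  forall i, `|F x i - F y i| <= L * d.

(** The Picard map. Freezing the argument at time 0 for negative [s] keeps the integrand continuous
    on the whole line although [u] is controlled only at nonnegative times. *)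
Definition step (u : R -> I -> R) (t : R) (i : I) : R :=
  x0 i + antiderivative (fun s => F (u (Num.max s 0)) i) t.

Definition lip (u : R -> I -> R) :=
  forall i s t, (0 <= s :> R) -> 0 <= t -> `|u s i - u t i| <= M * `|s - t|.

Lemma M_ge0 (i : I) : 0 <= M.
Proof. exact: le_trans (normr_ge0 _) (F_le x0 i). Qed.

Lemma max_lip (s t : R) : `|Num.max s 0 - Num.max t 0| <= `|s - t|.
Proof.
have [s0|/ltW s0] := leP s 0; have [t0|/ltW t0] := leP t 0; rewrite ?subrr ?normr0//.
- by rewrite !ler0_norm; lra.
- by rewrite !ger0_norm; lra.
Qed.

Lemma Fu_cont u i : lip u -> continuous (fun s => F (u (Num.max s 0)) i).
Proof.
move=> lu; apply: (@lipschitz_continuous _ _ (L * M)) => s t.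
rewrite -mulrA; apply: F_lip => j.
apply: (le_trans (lu _ _ _ _ _)); rewrite ?le_max ?lexx ?orbT//.
by apply: ler_wpM2l; [exact: M_ge0 i|exact: max_lip].
Qed.

Lemma step_derive u i t : lip u -> -1 < t ->
  is_derive t 1 (fun t => step u t i) (F (u (Num.max t 0)) i).
Proof.
move=> lu t1.
have := is_deriveD (is_derive_cst (x0 i) t (1 : R))
  (is_derive_antiderivative (@Fu_cont u i lu) t1).
by rewrite add0r.
Qed.

Lemma step_lip u : lip u -> lip (step u).
Proof.
move=> lu i s t.
wlog st : s t / s <= t.
  move=> H s0 t0; have [|/ltW ts] := leP s t; first by move=> ?; exact: H.
  by rewrite distrC (distrC s); exact: H.
move=> s0 t0; rewrite distrC (distrC s).
have Md x : is_derive x 1 (fun t => M * t) M.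
  have := @is_deriveZ _ _ _ id M x 1 1 (is_derive_id _ _).
  by rewrite /GRing.scale/= mulr1.
have := @derive_norm_le R (fun t => step u t i) (fun t => F (u (Num.max t 0)) i)
   (fun t => M * t) (cst M) s t st.
rewrite (ger0_norm (_ : 0 <= t - s)) ?subr_ge0// mulrBr; apply => // x /andP[sx _].
by apply: step_derive => //; lra.
Qed.

Definition U n := iter n step (fun _ => x0).

Lemma U_lip n : lip (U n).
Proof.
elim: n => [|n ih]; last exact: step_lip.
by move=> i s t _ _; rewrite subrr normr0 mulr_ge0// (M_ge0 i).
Qed.

(** Weighting the sup norm by [expR (- 2 * L * t)] (Bielecki's norm) makes the Picard map contract
    by 1/2 on the whole half-line, so the solution is global at once, with no gluing of short
    intervals. *)
Lemma step_contr u v (D : R) : lip u -> lip v -> 0 <= D ->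
  (forall t i, 0 <= t -> `|u t i - v t i| <= D * expR (2 * L * t)) ->
  forall t i, 0 <= t -> `|step u t i - step v t i| <= D / 2 * expR (2 * L * t).
Proof.
move=> lu lv D0 uv t i t0.
have d0 : step u 0 i - step v 0 i = 0.
  by rewrite /step !antiderivative0 addr0 subrr.
have := @derive_norm_le R (fun t => step u t i - step v t i)
  (fun t => F (u (Num.max t 0)) i - F (v (Num.max t 0)) i)
  (fun t => D / 2 * expR (2 * L * t)) (fun t => D / 2 * (2 * L * expR (2 * L * t)))
  0 t t0.
rewrite d0 subr0 => H; apply: (le_trans (H _ _ _)).
- by move=> x /andP[x0' _]; apply: is_deriveB; apply: step_derive => //; lra.
- by move=> x _; apply: is_deriveZ; exact: is_derive_expM.
- move=> x /andP[x0' _]; rewrite (max_idPl x0').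
  have -> : D / 2 * (2 * L * expR (2 * L * x)) = L * (D * expR (2 * L * x)).
    by field.
  by apply: F_lip => j; exact: uv.
by rewrite lerBlDr lerDl mulr_ge0 ?divr_ge0 ?expR_ge0.
Qed.

(** The size of the first increment: [M * t] is at most [D * (2 * L * t)]. The absolute value is
    there because [0 <= M] can only be deduced from an element of [I]. *)
Definition D : R := `|M| / L.

Lemma D_ge0 : 0 <= D. Proof. by rewrite divr_ge0// ltW. Qed.

Lemma U_step n t i : 0 <= t ->
  `|U n.+1 t i - U n t i| <= D / 2 ^+ n * expR (2 * L * t).
Proof.
elim: n t i => [|n ih] t i t0; last first.
  have -> : D / 2 ^+ n.+1 = D / 2 ^+ n / 2 by rewrite exprSr invfM mulrA.
  apply: step_contr => //; [exact: (U_lip n.+1)|exact: U_lip|].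
  by rewrite divr_ge0 ?exprn_ge0// D_ge0.
rewrite expr0 divr1.
have /= := U_lip 1 i (lexx 0) t0.
rewrite /step antiderivative0 addr0 sub0r normrN (ger0_norm t0) distrC => h.
apply: (le_trans h); apply: (@le_trans _ _ (D * (2 * L * t))); last first.
  rewrite ler_wpM2l ?D_ge0//; apply: le_trans (expR_ge1Dx _); lra.
have -> : D * (2 * L * t) = 2 * (`|M| * t) by rewrite /D; field; exact: lt0r_neq0.
have := ler_norm M; have := normr_ge0 M; nra.
Qed.

Lemma U_cauchy n m t i : (n <= m)%N -> 0 <= t ->
  `|U m t i - U n t i| <= 2 * D / 2 ^+ n * expR (2 * L * t).
Proof.
move=> nm t0.
(* The difference of two tails of the geometric series is the form that is stable under induction on
   [m - n]. *)
suff : `|U m t i - U n t i| <= (2 * D / 2 ^+ n - 2 * D / 2 ^+ m) * expR (2 * L * t).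
  move/le_trans; apply; rewrite ler_wpM2r ?expR_ge0// gerDl oppr_le0.
  by rewrite divr_ge0 ?exprn_ge0// mulr_ge0// D_ge0.
rewrite -(subnKC nm); elim: (m - n)%N => [|d ih].
  by rewrite addn0 !subrr normr0 mul0r.
rewrite addnS.
have -> : U (n + d).+1 t i - U n t i =
  (U (n + d).+1 t i - U (n + d)%N t i) + (U (n + d)%N t i - U n t i) by ring.
apply: (le_trans (ler_normD _ _)).
apply: (le_trans (lerD (U_step _ _ t0) ih)).
rewrite -mulrDl ler_wpM2r ?expR_ge0//.
rewrite [2 ^+ (n + d).+1]exprS.
have : 2 ^+ (n + d) != 0 :> R by rewrite expf_neq0.
move: (2 ^+ (n + d)) (2 * D / 2 ^+ n) => y z y0.
by rewrite le_eqVlt; apply/orP; left; apply/eqP; field.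
Qed.

Lemma picard : exists u : R -> I -> R, (forall i, u 0 i = x0 i) /\
  forall i t, 0 <= t -> is_derive t 1 (fun t => u t i) (F (u t) i).
Proof.
have e0 t : (fun n => 2 * D / 2 ^+ n * expR (2 * L * t)) @ \oo --> 0.
  have -> : (fun n => 2 * D / 2 ^+ n * expR (2 * L * t)) =
      geometric (2 * D * expR (2 * L * t)) 2^-1.
    by apply/funext => n; rewrite /geometric/= exprVn; ring.
  by apply: cvg_geometric; rewrite ger0_norm ?invf_lt1 ?ltr1n.
have lim t i : exists l, 0 <= t -> (U ^~ t ^~ i @ \oo --> l) /\
    forall n, `|l - U n t i| <= 2 * D / 2 ^+ n * expR (2 * L * t).
  have [t0|t0] := ltP t 0; first by exists 0.
  have [] := @cauchy_rate_cvg R (U ^~ t ^~ i) _ _ (e0 t).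
    by move=> n m nm; exact: U_cauchy.
  by move=> l h1 h2; exists l.
pose V t i := projT1 (cid (lim t i)).
have VP t i : 0 <= t -> forall n, `|V t i - U n t i| <= 2 * D / 2 ^+ n * expR (2 * L * t).
  by move=> t0; rewrite /V; case: cid => l /= /(_ t0)[].
have cV t i : 0 <= t -> U ^~ t ^~ i @ \oo --> V t i.
  by move=> t0; rewrite /V; case: cid => l /= /(_ t0)[].
have lV : lip V.
  move=> i s t s0 t0.
  have : `|U n s i - U n t i| @[n --> \oo] --> `|V s i - V t i|.
    by apply: cvg_norm; apply: cvgB; exact: cV.
  by move=> h; apply: (cvg_le_cst h); near=> n; exact: U_lip.
have VE t i : 0 <= t -> V t i = step V t i.
  move=> t0.
  have h1 : U n.+1 t i @[n --> \oo] --> V t i.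
    by have := cV t i t0; rewrite -cvg_shiftS.
  apply: (cvg_unique _ h1) => //.
  apply/cvgrPdist_le => e e_gt0; near=> n.
  rewrite /=; have := @step_contr V (U n) (2 * D / 2 ^+ n) lV (@U_lip n).
  move=> /(_ _ _ t i t0) h; apply: (le_trans (h _ _)).
  - by rewrite divr_ge0 ?exprn_ge0// mulr_ge0// D_ge0.
  - by move=> s j s0; exact: VP.
  have -> : 2 * D / 2 ^+ n / 2 * expR (2 * L * t) = (2 * D / 2 ^+ n * expR (2 * L * t)) / 2.
    by ring.
  apply: (@le_trans _ _ (2 * D / 2 ^+ n * expR (2 * L * t))).
    rewrite ler_pdivrMr// ler_peMr// ?ler1n//.
    by rewrite mulr_ge0 ?expR_ge0// divr_ge0 ?exprn_ge0// mulr_ge0// D_ge0.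
  apply: (le_trans (ler_norm _)); rewrite -normrN -sub0r.
  by near: n; have /cvgrPdist_le := e0 t; exact.
(* [V] has arbitrary values at negative times, whereas [step V] agrees with it on the half-line and
   is differentiable from both sides at 0. *)
exists (step V); split=> [i|i t t0]; first by rewrite /step antiderivative0 addr0.
have := @step_derive V i t lV; rewrite (max_idPl t0).
have -> : V t = step V t by apply/funext => j; exact: VE.
by apply; lra.
Unshelve. all: by end_near. Qed.

End Picard.

(** * Sums over lattice frequencies *)

Section FiniteSums.
Context {R : realType}.

Lemma ler_sum_sub (T : eqType) (s1 s2 : seq T) (g : T -> R) : uniq s1 ->
  {subset s1 <= s2} -> (forall x, 0 <= g x) ->
  \sum_(x <- s1) g x <= \sum_(x <- s2) g x.
Proof.
move=> + + g0; elim: s1 s2 => [|x s1 ih] s2 /=.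
  by move=> _ _; rewrite big_nil sumr_ge0.
move=> /andP[xs1 us1] sub.
have xs2 : x \in s2 by apply: sub; rewrite mem_head.
rewrite big_cons (perm_big _ (perm_to_rem xs2)) big_cons lerD2l.
apply: ih => // y ys1.
have : y \in s2 by apply: sub; rewrite inE ys1 orbT.
rewrite (perm_mem (perm_to_rem xs2)) inE => /orP[/eqP yx|//].
by rewrite -yx ys1 in xs1.
Qed.

(** With [f] a translation or a reflection of the lattice, this replaces the reindexing of a
    convolution sum: the support of [g] kills the terms that leave [s2]. *)
Lemma ler_sum_inj (T : eqType) (s1 s2 : seq T) (f : T -> T) (g : T -> R) :
  uniq s1 -> injective f -> (forall x, 0 <= g x) ->
  (forall x, x \notin s2 -> g x = 0) ->
  \sum_(x <- s1) g (f x) <= \sum_(x <- s2) g x.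
Proof.
move=> us1 fi g0 gs.
rewrite -(big_map f predT g) (bigID (mem s2)) /= addrC big1 ?add0r; last first.
  by move=> x /gs.
rewrite -big_filter; apply: ler_sum_sub => //.
  by rewrite filter_uniq// map_inj_uniq.
by move=> x; rewrite mem_filter => /andP[].
Qed.

Lemma ler_term_sum (T : eqType) (s : seq T) (g : T -> R) x :
  x \in s -> (forall x, 0 <= g x) -> g x <= \sum_(x <- s) g x.
Proof.
move=> xs g0; have -> : g x = \sum_(y <- [:: x]) g y by rewrite big_seq1.
apply: ler_sum_sub => //.
by move=> y; rewrite inE => /eqP ->.
Qed.

Lemma cauchy_schwarz_sqr (T : Type) (s : seq T) (f g : T -> R) :
  (\sum_(x <- s) f x * g x) ^+ 2 <=
  (\sum_(x <- s) f x ^+ 2) * \sum_(x <- s) g x ^+ 2.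
Proof.
elim: s => [|x s ih]; first by rewrite !big_nil expr0n/= mul0r.
rewrite !big_cons.
have A0 : 0 <= \sum_(x <- s) f x ^+ 2 by apply: sumr_ge0 => *; exact: sqr_ge0.
have B0 : 0 <= \sum_(x <- s) g x ^+ 2 by apply: sumr_ge0 => *; exact: sqr_ge0.
move: A0 B0 ih.
move: (\sum_(x <- s) f x ^+ 2) (\sum_(x <- s) g x ^+ 2) (\sum_(x <- s) f x * g x).
move: (f x) (g x) => a b A B S A0 B0 SAB.
(* The induction hypothesis bounds [S ^+ 2] by [A * B], and the arithmetic-geometric inequality for
   A b^2 and B a^2 absorbs the cross term. *)
have h : 2 * (S * (a * b)) <= A * b ^+ 2 + B * a ^+ 2.
  apply: le_trans (ler_norm _) _; rewrite -ler_sqr ?nnegrE//; last first.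
    by rewrite addr_ge0// mulr_ge0// sqr_ge0.
  rewrite real_normK ?num_real//.
  have := sqr_ge0 (A * b ^+ 2 - B * a ^+ 2).
  have : S ^+ 2 * (a * b) ^+ 2 <= A * B * (a * b) ^+ 2 by rewrite ler_wpM2r ?sqr_ge0.
  nra.
nra.
Qed.

Lemma cauchy_schwarz (T : Type) (s : seq T) (f g : T -> R) :
  \sum_(x <- s) f x * g x <=
  Num.sqrt (\sum_(x <- s) f x ^+ 2) * Num.sqrt (\sum_(x <- s) g x ^+ 2).
Proof.
rewrite -sqrtrM; last by apply: sumr_ge0 => *; exact: sqr_ge0.
apply: le_trans (ler_norm _) _; rewrite -sqrtr_sqr ler_sqrt.
  exact: cauchy_schwarz_sqr.
by rewrite mulr_ge0//; apply: sumr_ge0 => *; exact: sqr_ge0.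
Qed.

(** [s'] may be larger than the translate of [s]; the excess terms vanish by the support condition.
    With [l = 0] this only enlarges the list of summation. *)
Lemma sum_shift (V : nmodType) (T : zmodType) (s s' : seq T) (f : T -> V) (l : T) :
  uniq s -> uniq s' -> (forall x, x \notin s -> f x = 0) ->
  (forall x, x \in s -> x + l \in s') ->
  \sum_(x <- s) f x = \sum_(y <- s') f (y - l).
Proof.
move=> us us' fs ss'.
rewrite -(big_map (fun y => y - l) predT f) [RHS](bigID (mem s)) /= addrC.
rewrite [X in X + _]big1 ?add0r; last by move=> x /fs.
rewrite -[RHS]big_filter; apply: perm_big; apply: uniq_perm => //.
  by rewrite filter_uniq// map_inj_uniq//; exact: addIr.
move=> x; rewrite mem_filter; apply/idP/andP => [xs|[]//]; split=> //.
by apply/mapP; exists (x + l); [exact: ss'|rewrite addrK].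
Qed.

End FiniteSums.

Section Frequencies.
Context {R : realType}.
Implicit Types (k l q : freq).
Local Notation fnorm := (@freq_norm R).

Definition sqnorm k : R := \sum_(i < 3) (k ord0 i)%:~R ^+ 2.

Lemma sqnorm_ge0 k : 0 <= sqnorm k.
Proof. by apply: sumr_ge0 => *; exact: sqr_ge0. Qed.

Lemma fnorm_ge0 k : 0 <= fnorm k. Proof. exact: sqrtr_ge0. Qed.

Lemma sqr_fnorm k : fnorm k ^+ 2 = sqnorm k.
Proof. by rewrite sqr_sqrtr// sqnorm_ge0. Qed.

Lemma fnormN k : fnorm (- k) = fnorm k.
Proof. by congr Num.sqrt; apply: eq_bigr => i _; rewrite mxE rmorphN sqrrN. Qed.

Lemma fnorm_ge1 k : k != 0 -> 1 <= fnorm k.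
Proof.
move=> k0; rewrite -sqrtr1 ler_sqrt ?sqnorm_ge0//.
have [i ki] : exists i, k ord0 i != 0.
  apply/existsP; apply: contraNT k0; rewrite negb_exists => /forallP h.
  apply/eqP/rowP => i; rewrite mxE; apply/eqP; have := h i.
  by rewrite negbK.
rewrite (bigD1 i)//= (@le_trans _ _ ((k ord0 i)%:~R ^+ 2))//.
  rewrite -[leLHS](expr1n _ 2) -[leRHS]real_normK ?num_real// ler_sqr ?nnegrE//.
  by rewrite -intr_norm ler1z -gtz0_ge1 normr_gt0.
by rewrite lerDl; apply: sumr_ge0 => *; exact: sqr_ge0.
Qed.

Lemma fnorm_gt0 k : k != 0 -> 0 < fnorm k.
Proof. by move=> /fnorm_ge1; exact: lt_le_trans. Qed.

Lemma coord_le_fnorm k i : `|(k ord0 i)%:~R| <= fnorm k.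
Proof.
rewrite -sqrtr_sqr ler_sqrt ?sqnorm_ge0// (bigD1 i)//= lerDl.
by apply: sumr_ge0 => *; exact: sqr_ge0.
Qed.

Lemma fnormD k l : fnorm (k + l) <= fnorm k + fnorm l.
Proof.
rewrite -ler_sqr ?nnegrE ?fnorm_ge0 ?addr_ge0 ?fnorm_ge0//.
rewrite sqrrD !sqr_fnorm /sqnorm.
have -> : \sum_(i < 3) ((k + l) ord0 i)%:~R ^+ 2 =
  \sum_(i < 3) (k ord0 i)%:~R ^+ 2 +
  (\sum_(i < 3) (k ord0 i)%:~R * (l ord0 i)%:~R) *+ 2 +
  \sum_(i < 3) (l ord0 i)%:~R ^+ 2 :> R.
  rewrite -sumrMnl -!big_split/=; apply: eq_bigr => i _.
  by rewrite mxE rmorphD/= sqrrD.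
rewrite lerD2r lerD2l lerMn2r/=; exact: cauchy_schwarz.
Qed.

Lemma fnormB k l : fnorm (k - l) <= fnorm k + fnorm l.
Proof. by rewrite (le_trans (fnormD _ _))// fnormN. Qed.

Definition cube (N : nat) : seq freq :=
  [seq \row_i ((f i)%:Z - N%:Z) | f : {ffun 'I_3 -> 'I_(N + N).+1}].

Lemma mem_cube N k : (k \in cube N) = [forall i, (`|k ord0 i| <= N)%N].
Proof.
apply/mapP/forallP => [[f _ ->] i|h].
  by rewrite mxE; have := ltn_ord (f i); move: (nat_of_ord (f i)) => n; lia.
have h' i : (absz (k ord0 i + N%:Z)%R < (N + N).+1)%N by have := h i; lia.
exists [ffun i => Ordinal (h' i)]; first by rewrite mem_enum.
apply/rowP => i; rewrite !mxE ffunE /= (_ : 0 = ord0); last exact: val_inj.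
by have := h i; lia.
Qed.

Lemma uniq_cube N : uniq (cube N).
Proof.
rewrite map_inj_uniq ?enum_uniq// => f g /rowP fg.
apply/ffunP => i; have := fg i; rewrite !mxE => /addIr[].
exact: val_inj.
Qed.

(** The index set of the Galerkin space. The zero frequency is left out since all fields have zero
    mean; a cube is used rather than a ball because sums over it factor into coordinates. *)
Definition box (N : nat) : seq freq := [seq k <- cube N | k != 0].

Lemma mem_box N k : (k \in box N) = (k != 0) && [forall i, (`|k ord0 i| <= N)%N].
Proof. by rewrite mem_filter mem_cube. Qed.

Lemma uniq_box N : uniq (box N). Proof. by rewrite filter_uniq// uniq_cube. Qed.

Lemma zero_notin_box N : 0 \notin box N. Proof. by rewrite mem_box eqxx. Qed.

Lemma box_neq0 N k : k \in box N -> k != 0. Proof. by rewrite mem_box => /andP[]. Qed.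

Lemma box_opp N k : (- k \in box N) = (k \in box N).
Proof.
rewrite !mem_box oppr_eq0; congr (_ && _); apply: eq_forallb => i.
by rewrite mxE abszN.
Qed.

Lemma box_sub N N' : (N <= N')%N -> {subset box N <= box N'}.
Proof.
move=> NN' k; rewrite !mem_box => /andP[-> /forallP h]/=.
by apply/forallP => i; exact: leq_trans (h i) NN'.
Qed.

Lemma box_large (s : seq freq) : (forall k, k \in s -> k != 0) ->
  exists N0, forall N, (N0 <= N)%N -> {subset s <= box N}.
Proof.
elim: s => [|k s ih] s0; first by exists 0%N.
have [|N0 sub] := ih; first by move=> l ls; apply: s0; rewrite inE ls orbT.
exists (maxn N0 (\max_i `|k ord0 i|)%N) => N; rewrite geq_max => /andP[N0N kN] l.
rewrite inE => /orP[/eqP->|]; last exact: sub.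
rewrite mem_box s0 ?mem_head//; apply/forallP => i.
by apply: leq_trans kN; exact: (@leq_bigmax _ (fun i => `|k ord0 i|%N)).
Qed.

Lemma fnorm_notin_box N k : k != 0 -> k \notin box N -> N%:R < fnorm k.
Proof.
move=> k0; rewrite mem_box k0 negb_forall => /existsP[j]; rewrite -ltnNge => h.
apply: lt_le_trans (coord_le_fnorm k j).
by rewrite -intr_norm -abszE /= -pmulrn ltr_nat.
Qed.

(** The defect 4/(N+1) makes the induction telescope: each of the two new end terms is at most
    2/(N+1) - 2/(N+2). *)
Lemma sum_inv_sqr_le N :
  \sum_(j < (N + N).+1) (1 + (j%:Z - N%:Z)%:~R ^+ 2)^-1 <=
  5 - 4 / N.+1%:R :> R.
Proof.
elim: N => [|N ih].
  by rewrite big_ord1 subrr expr0n/= addr0 invr1; lra.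
rewrite addnS addSn big_ord_recl big_ord_recr/=.
have -> : \sum_(i < (N + N).+1) (1 + ((bump 0 i)%:Z - N.+1%:Z)%:~R ^+ 2)^-1 =
    \sum_(j < (N + N).+1) (1 + (j%:Z - N%:Z)%:~R ^+ 2)^-1 :> R.
  apply: eq_bigr => i _; congr (1 + _%:~R ^+ 2)^-1; rewrite /bump/=; lia.
have -> : ((0%N)%:Z - N.+1%:Z)%:~R ^+ 2 = (N%:R + 1) ^+ 2 :> R.
  by rewrite sub0r rmorphN/= sqrrN -pmulrn natr1.
have -> : ((bump 0 (N + N).+1)%:Z - N.+1%:Z)%:~R ^+ 2 = (N%:R + 1) ^+ 2 :> R.
  have -> : (bump 0 (N + N).+1)%:Z - N.+1%:Z = N.+1%:Z by rewrite /bump/=; lia.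
  by rewrite -pmulrn natr1.
move: ih; rewrite -[N.+2%:R]natr1 -[N.+1%:R]natr1.
have : 0 <= N%:R :> R by [].
move: (N%:R : R) (\sum_(_ < _) _) => x S x0 h.
have e1 : (1 + (x + 1) ^+ 2)^-1 <= 2 / (x + 1) - 2 / (x + 1 + 1).
  have -> : 2 / (x + 1) - 2 / (x + 1 + 1) = 2 / ((x + 1) * (x + 1 + 1)).
    by field; apply/andP; split; apply: lt0r_neq0; lra.
  have -> : 2 / ((x + 1) * (x + 1 + 1)) = ((x + 1) * (x + 1 + 1) / 2)^-1.
    by field; apply/andP; split; apply: lt0r_neq0; lra.
  by rewrite lef_pV2 ?posrE; nra.
have -> : 4 / (x + 1 + 1) = 2 * (2 / (x + 1 + 1)) by ring.
have e2 : 4 / (x + 1) = 2 * (2 / (x + 1)) by ring.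
by rewrite e2 in h; lra.
Qed.

(** For [k != 0] every 1 + k_i^2 is at most 2 |k|^2, so |k|^-6 is at most 8 times a product over the
    coordinates. The sum over a cube then factors into the third power of a one-dimensional sum
    bounded by 5, and 8 * 125 = 1000. *)
Lemma sum_fnorm_inv6 (s : seq freq) : uniq s -> 0 \notin s ->
  \sum_(k <- s) fnorm k ^- 6 <= 1000.
Proof.
move=> us s0.
have [N0 /(_ N0 (leqnn _)) sub] : exists N0, forall N, (N0 <= N)%N -> {subset s <= box N}.
  by apply: box_large => k ks; apply: contraNN s0 => /eqP <-.
apply: le_trans (ler_sum_sub us sub _) _.
  by move=> k; rewrite invr_ge0 exprn_ge0// fnorm_ge0.
apply: (@le_trans _ _ (\sum_(k <- box N0) 8 * \prod_(i < 3) (1 + (k ord0 i)%:~R ^+ 2)^-1)).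
  rewrite big_seq [leRHS]big_seq; apply: ler_sum => k /box_neq0 k0.
  have x1 := fnorm_ge1 k0.
  have h i : 1 + (k ord0 i)%:~R ^+ 2 <= 2 * fnorm k ^+ 2 :> R.
    have := coord_le_fnorm k i; rewrite -ler_sqr ?nnegrE ?fnorm_ge0//.
    by rewrite real_normK ?num_real//; nra.
  have p0 i : 0 < 1 + (k ord0 i)%:~R ^+ 2 :> R by rewrite ltr_wpDr ?sqr_ge0.
  rewrite prodfV ler_pdivlMr ?prodr_gt0//.
  rewrite mulrC ler_pdivrMr ?exprn_gt0 ?fnorm_gt0//.
  have -> : 8 * fnorm k ^+ 6 = \prod_(i < 3) (2 * fnorm k ^+ 2).
    by rewrite prodr_const card_ord; ring.
  by apply: ler_prod => i _; rewrite (ltW (p0 _)) h.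
rewrite -mulr_sumr big_filter.
apply: (@le_trans _ _ (8 * \sum_(k <- cube N0) \prod_(i < 3) (1 + (k ord0 i)%:~R ^+ 2)^-1)).
  rewrite ler_wpM2l// big_mkcond; apply: ler_sum => k _; case: ifP => // _.
  by apply: prodr_ge0 => i _; rewrite invr_ge0 addr_ge0 ?sqr_ge0.
rewrite /cube big_map.
under eq_bigr do under eq_bigr do rewrite mxE.
rewrite big_enum /= -(bigA_distr_bigA (fun _ j => (1 + ((j : 'I_(N0+N0).+1)%:Z - N0%:Z)%:~R ^+ 2)^-1 : R)).
rewrite prodr_const card_ord.
have h := sum_inv_sqr_le N0.
have : 0 <= 4 / N0.+1%:R :> R by [].
have S0 : 0 <= \sum_(j < (N0 + N0).+1) (1 + (j%:Z - N0%:Z)%:~R ^+ 2)^-1 :> R.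
  by apply: sumr_ge0 => i _; rewrite invr_ge0 addr_ge0 ?sqr_ge0.
move: (4 / N0.+1%:R) h S0 => e; move: (\sum_(j < _) _) => S h S0 h'.
have S5 : S <= 5 by lra.
have : S ^+ 3 <= 5 ^+ 3 by rewrite lerXn2r ?nnegrE//.
lra.
Qed.

(** Cauchy-Schwarz against |k|^-3. Three powers of |k| are the price of passing from l^2 to l^1, and
    40 exceeds the root of 1000. *)
Lemma sum_le_sqrt6 (s : seq freq) (f : freq -> R) : uniq s -> 0 \notin s ->
  (forall k, 0 <= f k) ->
  \sum_(k <- s) f k <= 40 * Num.sqrt (\sum_(k <- s) (fnorm k ^+ 3 * f k) ^+ 2).
Proof.
move=> us s0 f0.
have -> : \sum_(k <- s) f k = \sum_(k <- s) fnorm k ^- 3 * (fnorm k ^+ 3 * f k).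
  rewrite big_seq [RHS]big_seq; apply: eq_bigr => k ks.
  have k0 : k != 0 by apply: contraNN s0 => /eqP <-.
  by rewrite mulKf// expf_neq0// gt_eqF// fnorm_gt0.
apply: (le_trans (cauchy_schwarz _ _ _)); rewrite ler_wpM2r ?sqrtr_ge0//.
rewrite -[leRHS](@ger0_norm _ 40)// -sqrtr_sqr ler_sqrt ?sqr_ge0//.
apply: (@le_trans _ _ 1000); last lra.
rewrite (eq_bigr (fun k => fnorm k ^- 6)); first exact: sum_fnorm_inv6.
by move=> k _; rewrite exprVn -exprM.
Qed.

End Frequencies.

(** * Integrals over the cell and the cylinder *)

Section BoundedIntegrable.
Context d (T : measurableType d) (R : realType) (mu : {measure set T -> \bar R}).

Lemma integrable_le_cst (A : set T) (f : T -> R) (M : R) :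
  measurable A -> (mu A < +oo)%E -> measurable_fun A f ->
  (forall x, A x -> `|f x| <= M) -> mu.-integrable A (EFin \o f).
Proof.
move=> mA Aoo mf fM; apply: measurable_bounded_integrable => //.
exists M; split; first exact: num_real.
by move=> x Mx y Ay /=; apply: (le_trans (fM _ Ay)); exact: ltW.
Qed.

Lemma normr_Rintegral_le_cst (A : set T) (f : T -> R) (M : R) :
  measurable A -> (mu A < +oo)%E -> measurable_fun A f -> 
  (forall x, A x -> `|f x| <= M) ->
  `|\int[mu]_(x in A) f x| <= M * fine (mu A).
Proof.
move=> mA Aoo mf fM.
have fi := integrable_le_cst mA Aoo mf fM.
apply: (le_trans (le_normr_Rintegral mA fi)).
rewrite -Rintegral_cst//; apply: le_Rintegral => //.
- exact: (integrable_abse fi).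
- have [[x Ax]|A0] := pselect (exists x, A x); last first.
    have -> : A = set0 by apply/seteqP; split => // x Ax; apply: A0; exists x.
    exact: integrable_set0.
  by apply: (@integrable_le_cst A _ `|M|).
Qed.

End BoundedIntegrable.

Section FubiniZero.
Context d1 d2 (T1 : measurableType d1) (T2 : measurableType d2) (R : realType).
Variables (m1 : {sigma_finite_measure set T1 -> \bar R}).
Variables (m2 : {sigma_finite_measure set T2 -> \bar R}).
Variables (A : set T1) (B : set T2) (f : T1 * T2 -> R).
Hypotheses (mA : measurable A) (mB : measurable B).
Hypothesis fi : (m1 \x m2)%E.-integrable (A `*` B) (EFin \o f).

Let fi' : (m1 \x m2)%E.-integrable setT ((EFin \o f) \_ (A `*` B)).
Proof.
by apply/integrable_restrict => //; [exact: measurableX|rewrite setTI].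
Qed.

(** Extension by zero outside the rectangle reduces to Fubini on the whole product. All integrations
    by parts below are brought to the case of a vanishing inner integral. *)
Lemma fubini_zero1 : (forall x, A x -> \int[m2]_(y in B) f (x, y) = 0) ->
  (forall x, A x -> m2.-integrable B (fun y => (f (x, y))%:E)) ->
  \int[(m1 \x m2)%E]_(z in A `*` B) f z = 0.
Proof.
move=> f0 fxi; rewrite /Rintegral integral_mkcond -(integral12_prod_meas1 fi').
rewrite integral0_eq// => x _; rewrite /fubini_F.
have [Ax|Ax] := pselect (A x); last first.
  rewrite integral0_eq// => y _; rewrite patchE; case: ifP => //.
  by rewrite inE => -[].
rewrite (_ : (fun y => _) = ((fun y => (f (x, y))%:E) \_ B)); last first.
  apply/funext => y; rewrite !patchE; case: ifPn => [|/negP h].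
    by rewrite inE => -[/= _ By]; rewrite mem_set.
  by rewrite memNset// => By; apply: h; rewrite inE.
rewrite -integral_mkcond -(fineK (integral_fune_fin_num mB (fxi x Ax))).
by rewrite -[X in _ = X%:E](f0 x Ax).
Qed.

Lemma fubini_zero2 : (forall y, B y -> \int[m1]_(x in A) f (x, y) = 0) ->
  (forall y, B y -> m1.-integrable A (fun x => (f (x, y))%:E)) ->
  \int[(m1 \x m2)%E]_(z in A `*` B) f z = 0.
Proof.
move=> f0 fxi; rewrite /Rintegral integral_mkcond -(integral21_prod_meas1 fi').
rewrite integral0_eq// => y _; rewrite /fubini_G.
have [By|By] := pselect (B y); last first.
  rewrite integral0_eq// => x _; rewrite patchE; case: ifP => //.
  by rewrite inE => -[].
rewrite (_ : (fun x => _) = ((fun x => (f (x, y))%:E) \_ A)); last first.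
  apply/funext => x; rewrite !patchE; case: ifPn => [|/negP h].
    by rewrite inE => -[/= Ax _]; rewrite mem_set.
  by rewrite memNset// => Ax; apply: h; rewrite inE.
rewrite -integral_mkcond -(fineK (integral_fune_fin_num mA (fxi y By))).
by rewrite -[X in _ = X%:E](f0 y By).
Qed.

End FubiniZero.

Section Continuous.
Context {R : realType}.
Local Notation point4 := (R * point3 R)%type.

Lemma continuous_pair (T U V : topologicalType) (f : T -> U) (g : T -> V) :
  continuous f -> continuous g -> continuous (fun x => (f x, g x)).
Proof. by move=> cf cg x; apply: (@cvg_pair T U V (nbhs x)); [exact: cf|exact: cg]. Qed.

Lemma cvg_pairT (T : Type) (U V : topologicalType) (F : set_system T) {FF : Filter F}
  (f : T -> U) (g : T -> V) (a : U) (b : V) :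
  f x @[x --> F] --> a -> g x @[x --> F] --> b -> (f x, g x) @[x --> F] --> (a, b).
Proof. exact: cvg_pair. Qed.

Lemma scale_pair (V W : normedModType R) (h : R) (v : V) (w : W) :
  h *: (v, w) = (h *: v, h *: w).
Proof. by []. Qed.

Lemma add_pair (V W : normedModType R) (v v' : V) (w w' : W) :
  (v, w) + (v', w') = (v + v', w + w').
Proof. by []. Qed.

Lemma grid_cvg (x : R) : (Num.floor (x * n.+1%:R))%:~R / n.+1%:R @[n --> \oo] --> x.
Proof.
apply/cvgrPdist_le => e e0; near=> n.
have n0 : 0 < n.+1%:R :> R by [].
have -> : x - (Num.floor (x * n.+1%:R))%:~R / n.+1%:R =
    (x * n.+1%:R - (Num.floor (x * n.+1%:R))%:~R) / n.+1%:R.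
  by field; rewrite addrC natr1 lt0r_neq0.
rewrite normrM normfV (gtr0_norm n0) ler_pdivrMr//.
have /andP[h1 h2] := floor_itv (x * n.+1%:R); rewrite rmorphD/= in h2.
apply: (@le_trans _ _ 1); first by rewrite ger0_norm; lra.
rewrite -ler_pdivrMl// mulr1; apply: ltW; near: n.
have := @near_infty_natSinv_lt R (PosNum e0).
apply: filterS => n /= h; by rewrite -(invrK e) ltf_pV2 ?posrE ?invr_gt0// in h; rewrite ?invrK.
Unshelve. all: by end_near. Qed.

Lemma measurable_grid n (k : int) :
  measurable [set x : R | Num.floor (x * n.+1%:R) = k].
Proof.
rewrite (_ : [set _ | _] = (fun x : R => x * n.+1%:R) @^-1` `[k%:~R, (k + 1)%:~R[).
  by rewrite -[X in measurable X]setTI; apply: measurable_realfun.mulrr_measurable => //; exact: measurable_itv.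
apply/seteqP; split => x /=; rewrite in_itv/=.
  by move=> <-; exact: floor_itv.
by move=> h; apply/floor_def.
Qed.

(** The sigma-algebra is generated by measurable rectangles, so measurability is obtained by
    approximation: rounding every coordinate down to the grid of mesh 1/(n+1) leaves countably many
    values, each taken on a rectangle, and continuity gives pointwise convergence. *)
Lemma continuous_measurable4 (f : point4 -> R) : continuous f ->
  measurable_fun setT f.
Proof.
move=> cf.
pose g n (x : R) : R := (Num.floor (x * n.+1%:R))%:~R / n.+1%:R.
pose G n (z : point4) : point4 := (g n z.1, (g n z.2.1.1, g n z.2.1.2, g n z.2.2)).
apply: (@measurable_realfun.measurable_fun_cvg _ _ _ _ (fun n => f \o G n)) => //; last first.
  move=> z _; apply: continuous_cvg; first exact: cf.
  case: z => t [[x y] w].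
  rewrite /G /g /=.
  by apply: cvg_pairT; [|apply: cvg_pairT; [apply: cvg_pairT|]]; exact: grid_cvg.
move=> n _ Y mY; rewrite setTI.
pose E (z : point4) : int * (int * int * int) :=
  (Num.floor (z.1 * n.+1%:R), (Num.floor (z.2.1.1 * n.+1%:R),
    Num.floor (z.2.1.2 * n.+1%:R), Num.floor (z.2.2 * n.+1%:R))).
pose h (k : int * (int * int * int)) : R :=
 f (k.1%:~R / n.+1%:R, (k.2.1.1%:~R / n.+1%:R, k.2.1.2%:~R / n.+1%:R, k.2.2%:~R / n.+1%:R)).
rewrite (_ : _ @^-1` Y = \bigcup_k ([set z | E z = k] `&` [set _ | Y (h k)])); last first.
  apply/seteqP; split => [z Yz|z [k _] [/= <-]//].
  by exists (E z).
apply: countable_bigcupT_measurable => [|k]; first exact: countableP.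
have [Yk|Yk] := pselect (Y (h k)); last first.
  rewrite (_ : _ `&` _ = set0)//; by apply/seteqP; split => // z [].
rewrite (_ : _ `&` _ = [set z | E z = k]); last by apply/seteqP; split => // z [].
rewrite (_ : [set z | E z = k] =
  (fst @^-1` [set x | Num.floor (x * n.+1%:R) = k.1]) `&`
  (((fun z => z.2.1.1) @^-1` [set x | Num.floor (x * n.+1%:R) = k.2.1.1]) `&`
  (((fun z => z.2.1.2) @^-1` [set x | Num.floor (x * n.+1%:R) = k.2.1.2]) `&`
  ((fun z => z.2.2) @^-1` [set x | Num.floor (x * n.+1%:R) = k.2.2])))); last first.
  apply/seteqP; split => [z <-//|z]; case: k {Yk} => k1 [[k2 k3] k4] /=.
  by rewrite /E => -[-> [-> [-> ->]]].
have m2 : measurable_fun setT (fun z : point4 => z.2) by exact: measurable_snd.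
have m21 : measurable_fun setT (fun z : point4 => z.2.1).
  exact: measurableT_comp measurable_fst m2.
apply: measurableI; [|apply: measurableI; [|apply: measurableI]];
  rewrite -[X in measurable X]setTI.
- by apply: measurable_fst => //; exact: measurable_grid.
- by apply: (measurableT_comp measurable_fst m21) => //; exact: measurable_grid.
- by apply: (measurableT_comp measurable_snd m21) => //; exact: measurable_grid.
- by apply: (measurableT_comp measurable_snd m2) => //; exact: measurable_grid.
Qed.

Lemma continuous_measurable3 (f : point3 R -> R) : continuous f ->
  measurable_fun setT f.
Proof.
move=> cf.
have := @continuous_measurable4 (f \o snd).
have h : continuous (f \o (snd : point4 -> point3 R)).
  by move=> z; apply: continuous_comp; [exact: cvg_snd|exact: cf].
move=> /(_ h) m.
have := measurableT_comp m (@measurable_pair1 _ _ _ _ (0 : R)).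
exact.
Qed.

Lemma is_derive_line (V : normedModType R) (G : V -> R) (z v : V) (h d : R) :
  is_derive (h *: v + z) v G d -> is_derive h 1 (fun s => G (s *: v + z)) d.
Proof.
have e : (fun t : R => t^-1 *: (((fun s => G (s *: v + z)) \o shift h) (t *: (1 : R)) - G (h *: v + z)))
  = (fun t : R => t^-1 *: ((G \o shift (h *: v + z)) (t *: v) - G (h *: v + z))).
  apply/funext => t /=; congr (_ *: (G _ - _)).
  have -> : t *: (1 : R) = t by exact: mulr1.
  by rewrite scalerDl addrA.
move=> [dG DG]; apply: DeriveDef.
  by rewrite /derivable e.
by rewrite /derive e -DG.
Qed.

Lemma integral_derive0 (F f : R -> R) (a b : R) : a < b -> continuous f ->
  (forall x : R, is_derive x 1 F (f x)) -> F a = F b ->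
  \int[@leb1 R]_(x in `]a, b[) f x = 0.
Proof.
move=> ab cf Ff Fab.
rewrite /leb1.
have fi : lebesgue_measure.-integrable `[a, b] (EFin \o f).
  by apply: continuous_compact_integrable; [exact: segment_compact|exact: continuous_subspaceT].
rewrite Rintegral_itv_bndo_bndc; last first.
  by apply: integrableS fi => //; exact: subset_itv_oo_cc.
rewrite Rintegral_itv_obnd_cbnd; last first.
  by apply: integrableS fi => //; exact: subset_itv_oc_cc.
rewrite /Rintegral (@continuous_FTC2 _ f F a b ab) ?Fab -?EFinB ?subrr//.
- exact: continuous_subspaceT.
- split.
  + by move=> x _; case: (Ff x).
  + by apply: cvg_at_right_filter; exact: (is_derive_continuous (Ff a)).
  + by apply: cvg_at_left_filter; exact: (is_derive_continuous (Ff b)).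
- by move=> x _; rewrite derive1E; case: (Ff x).
Qed.

Lemma leb1_itv (a b : R) : a <= b -> leb1 `]a, b[ = (b - a)%:E.
Proof.
move=> ab; rewrite /leb1 lebesgue_measure_itv/= lte_fin.
case: ltP => // ba; have -> : a = b by lra.
by rewrite subrr.
Qed.

Lemma leb3_cell : leb3 (@cell R) = ((2 * pi) ^+ 3)%:E.
Proof.
have p : leb1 `]- pi, (pi : R)[ = (2 * pi)%:E.
  by rewrite leb1_itv; [congr EFin; ring|have := @pi_gt0 R; lra].
have -> : leb3 (@cell R) = (leb2 (`](- pi)%R, pi%R[ `*` `](- pi)%R, pi%R[) * leb1 `](- pi)%R, pi%R[)%E.
  by apply: product_measure1E => //; exact: measurableX.
have -> : leb2 (`]- pi, (pi : R)[ `*` `]- pi, (pi : R)[) = (leb1 `](- pi)%R, pi%R[ * leb1 `](- pi)%R, pi%R[)%E.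
  exact: product_measure1E.
by rewrite p -!EFinM; congr EFin; ring.
Qed.

Lemma measurable_cell : measurable (@cell R).
Proof. by apply: measurableX; [exact: measurableX|]. Qed.

Lemma measurable_cylinder (T : R) : measurable (cylinder T).
Proof. by apply: measurableX; [|exact: measurable_cell]. Qed.

Lemma leb4_cylinder (T : R) : 0 <= T -> leb4 (cylinder T) = (T * (2 * pi) ^+ 3)%:E.
Proof.
move=> T0; have -> : leb4 (cylinder T) = (leb1 `]0%R, T[ * leb3 (@cell R))%E.
  by apply: product_measure1E => //; exact: measurable_cell.
by rewrite leb1_itv// leb3_cell -EFinM subr0.
Qed.

Lemma leb4_cylinder_fin (T : R) : 0 <= T -> (leb4 (cylinder T) < +oo)%E.
Proof. by move=> T0; rewrite leb4_cylinder// ltry. Qed.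

Lemma continuous_bounded4 (f : point4 -> R) (T : R) : continuous f ->
  exists M, forall z, cylinder T z -> `|f z| <= M.
Proof.
move=> cf.
pose K : set point4 := `[0, T] `*` ((`[- pi, pi] `*` `[- pi, pi]) `*` `[- pi, pi]).
have cK : compact K.
  by do !apply: compact_setX; exact: segment_compact.
have : compact (f @` K).
  by apply: continuous_compact => //; exact: continuous_subspaceT.
move=> /compact_bounded[M [_ hM]]; exists (`|M| + 1) => z [zt [[z1 z2] z3]].
apply: (hM (`|M| + 1)); first by have := ler_norm M; lra.
by exists z => //; split; [|split; [split|]]; apply: subset_itv_oo_cc.
Qed.

Lemma continuous_bounded3 (f : point3 R -> R) : continuous f ->
  exists M, forall x, cell x -> `|f x| <= M.
Proof.
move=> cf.
have [|M hM] := @continuous_bounded4 (f \o snd) 1.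
  by move=> z; apply: continuous_comp; [exact: cvg_snd|exact: cf].
exists M => x cx; apply: (hM (1 / 2, x)); split => //=.
by rewrite in_itv/=; apply/andP; split; lra.
Qed.


Implicit Types (i : 'I_3) (x : point3 R) (z : point4).

Definition set_coord i (h : R) x : point3 R :=
  (if i == 0 :> nat then h else x.1.1, if i == 1%N :> nat then h else x.1.2,
   if i == 2%N :> nat then h else x.2).

Lemma set_coordE i h x : set_coord i h x = h *: unit_vector i + set_coord i 0 x.
Proof.
case: x => [[x y] w]; case: i => -[|[|[|//]]] hi; rewrite /set_coord/unit_vector/=;
  congr (_, _, _); rewrite /= ?/GRing.scale/= ?mulr1 ?mulr0 ?addr0 ?add0r//.
Qed.

Lemma continuous_set_coord i x : continuous (fun h => set_coord i h x).
Proof.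
by case: i => -[|[|[|//]]] hi; rewrite /set_coord/=;
  apply: continuous_pair; try apply: continuous_pair;
  move=> h; do ?[exact: cvg_cst|exact: cvg_id].
Qed.

Lemma leb3_cell_fin : (leb3 (@cell R) < +oo)%E.
Proof. by rewrite leb3_cell ltry. Qed.

Lemma continuous_integrable3 (f : point3 R -> R) : continuous f ->
  leb3.-integrable cell (EFin \o f).
Proof.
move=> cf; have [M fM] := continuous_bounded3 cf.
apply: (@integrable_le_cst _ _ _ leb3 _ f M) => //.
- exact: measurable_cell.
- exact: leb3_cell_fin.
- by apply: measurable_funTS; exact: continuous_measurable3.
Qed.

Lemma continuous_integrable4 (f : point4 -> R) (T : R) : 0 <= T -> continuous f ->
  leb4.-integrable (cylinder T) (EFin \o f).
Proof.
move=> T0 cf; have [M fM] := continuous_bounded4 T cf.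
apply: (@integrable_le_cst _ _ _ leb4 _ f M) => //.
- exact: measurable_cylinder.
- exact: leb4_cylinder_fin.
- by apply: measurable_funTS; exact: continuous_measurable4.
Qed.

Lemma measurable_itv1 : measurable (`]- pi, (pi : R)[ : set R).
Proof. exact: measurable_itv. Qed.

Lemma leb1_fin : (leb1 (`](- pi)%R, (pi : R)%R[ : set R) < +oo)%E.
Proof. by rewrite leb1_itv ?ltry//; have := @pi_gt0 R; lra. Qed.

Lemma leb2_fin : (leb2 (`](- pi)%R, (pi : R)%R[ `*` `](- pi)%R, (pi : R)%R[) < +oo)%E.
Proof.
have -> : leb2 (`]- pi, (pi : R)[ `*` `]- pi, (pi : R)[) = (leb1 `](- pi)%R, pi%R[ * leb1 `](- pi)%R, pi%R[)%E.
  exact: product_measure1E.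
by rewrite leb1_itv -?EFinM ?ltry//; have := @pi_gt0 R; lra.
Qed.

(** Fubini is applied in the order that makes the i-th coordinate the innermost variable, hence
    three cases. *)
Lemma integral_cell0 i (f : point3 R -> R) : continuous f ->
  (forall x, \int[leb1]_(h in `]- pi, pi[) f (set_coord i h x) = 0) ->
  \int[leb3]_(x in cell) f x = 0.
Proof.
move=> cf f0.
have [M fM] := continuous_bounded3 cf.
have mf := continuous_measurable3 cf.
have mI := measurable_itv1.
have mf2 w : measurable_fun setT (fun y : R * R => f (y, w)).
  exact: (measurableT_comp mf (@measurable_pair2 _ _ _ _ w)).
have fi := continuous_integrable3 cf.
have fi2 w : w \in `]- pi, pi[ -> leb2.-integrable (`]- pi, pi[ `*` `]- pi, pi[) (fun y => (f (y, w))%:E).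
  move=> hw; apply: (@integrable_le_cst _ _ _ leb2 _ (fun y => f (y, w)) M).
  - exact: measurableX.
  - exact: leb2_fin.
  - by apply: measurable_funTS; exact: mf2.
  - by move=> y [y1 y2]; apply: fM.
have fi1 (g : R -> point3 R) : continuous g -> (forall h, h \in `]- pi, pi[ -> cell (g h)) ->
    leb1.-integrable `]- pi, pi[ (fun h => (f (g h))%:E).
  move=> cg gM; apply: (@integrable_le_cst _ _ _ leb1 _ (f \o g) M) => //.
  - exact: leb1_fin.
  - apply: measurable_funTS; apply: measurable_realfun.continuous_measurable_fun => h.
    by apply: continuous_comp; [exact: cg|exact: cf].
  - by move=> h hh; apply: fM; exact: gM.
case: i f0 => -[|[|[|//]]] hi f0.
- apply: (@fubini_zero2 _ _ _ _ _ leb2 leb1 _ _ f _ _ fi) => //.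
  + exact: measurableX.
  + move=> w hw; apply: (@fubini_zero2 _ _ _ _ _ leb1 leb1 _ _ (fun y => f (y, w)) _ _ (fi2 _ hw)) => //.
      by move=> y hy; exact: (f0 (0, y, w)).
    move=> y hy; apply: (fi1 (fun h => (h, y, w))) => //.
    by apply: continuous_pair; try apply: continuous_pair; move=> h; do ?[exact: cvg_cst|exact: cvg_id].
- apply: (@fubini_zero2 _ _ _ _ _ leb2 leb1 _ _ f _ _ fi) => //.
  + exact: measurableX.
  + move=> w hw; apply: (@fubini_zero1 _ _ _ _ _ leb1 leb1 _ _ (fun y => f (y, w)) _ _ (fi2 _ hw)) => //.
      by move=> y hy; exact: (f0 (y, 0, w)).
    move=> y hy; apply: (fi1 (fun h => (y, h, w))) => //.
    by apply: continuous_pair; try apply: continuous_pair; move=> h; do ?[exact: cvg_cst|exact: cvg_id].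
- apply: (@fubini_zero1 _ _ _ _ _ leb2 leb1 _ _ f _ _ fi) => //.
  + exact: measurableX.
  + by move=> [y1 y2] hy; exact: (f0 (y1, y2, 0)).
  + move=> y [hy1 hy2]; apply: (fi1 (fun h => (y, h))) => //.
    by apply: continuous_pair; move=> h; do ?[exact: cvg_cst|exact: cvg_id].
Qed.

(** On each line parallel to the i-th axis the integral is a difference of two values of [G] one
    period apart. *)
Lemma integral_cell_derive i (G g : point3 R -> R) : continuous g ->
  (forall x, is_derive x (unit_vector i : point3 R) G (g x)) -> torus_periodic G ->
  \int[leb3]_(x in cell) g x = 0.
Proof.
move=> cg dG pG; apply: (@integral_cell0 i) => // x.
have h0 : - pi < pi :> R by have := @pi_gt0 R; lra.
apply: (@integral_derive0 (fun h => G (set_coord i h x))) => //.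
- move=> h; apply: continuous_comp; [exact: continuous_set_coord|exact: cg].
- move=> h; rewrite set_coordE.
  rewrite (_ : (fun h => _) = fun h => G (h *: unit_vector i + set_coord i 0 x)).
    by apply: (is_derive_line (V := (point3 R : normedModType R))); exact: dG.
  by apply/funext => h'; rewrite set_coordE.
- rewrite -(pG (set_coord i (- pi) x) i); congr G.
  case: x => [[x1 x2] x3]; case: i {dG} => -[|[|[|//]]] hi;
    rewrite /set_coord/unit_vector/= scale_pair scale_pair !add_pair;
    congr (_, _, _); rewrite /GRing.scale/=; ring.
Qed.

Lemma integral_cylinder_space i (G g : point4 -> R) (T : R) : 0 <= T -> continuous g ->
  (forall z, is_derive z ((0, unit_vector i) : point4) G (g z)) ->
  (forall t, torus_periodic (fun x => G (t, x))) ->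
  \int[leb4]_(z in cylinder T) g z = 0.
Proof.
move=> T0 cg dG pG.
have cgt t : continuous (fun x => g (t, x)).
  move=> x; apply: continuous_comp; last exact: cg.
  by apply: continuous_pair => y; [exact: cvg_cst|exact: cvg_id].
apply: (@fubini_zero1 _ _ _ _ _ leb1 leb3).
- exact: measurable_itv.
- exact: measurable_cell.
- exact: continuous_integrable4.
- move=> t _; apply: (@integral_cell_derive i (fun x => G (t, x))) => // x.
  have := dG (t, x).
  have e : (fun h : R => h^-1 *: ((G \o shift (t, x)) (h *: ((0, unit_vector i) : point4)) - G (t, x)))
    = (fun h : R => h^-1 *: (((fun x => G (t, x)) \o shift x) (h *: unit_vector i) - G (t, x))).
    by apply/funext => h /=; rewrite scale_pair add_pair scaler0 add0r.
  by move=> [d D]; apply: DeriveDef; [move: d; rewrite /derivable e|move: D; rewrite /derive e].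
- by move=> t _; exact: continuous_integrable3.
Qed.

Lemma integral_cylinder_time (G g : point4 -> R) (T : R) : 0 < T -> continuous g ->
  (forall z, is_derive z ((1, 0) : point4) G (g z)) ->
  (forall x, G (0, x) = G (T, x)) ->
  \int[leb4]_(z in cylinder T) g z = 0.
Proof.
move=> T0 cg dG pG.
have cgx x : continuous (fun t => g (t, x)).
  move=> t; apply: continuous_comp; last exact: cg.
  by apply: continuous_pair => y; [exact: cvg_id|exact: cvg_cst].
apply: (@fubini_zero2 _ _ _ _ _ leb1 leb3).
- exact: measurable_itv.
- exact: measurable_cell.
- by apply: continuous_integrable4 => //; exact: ltW.
- move=> x _; apply: (@integral_derive0 (fun t => G (t, x))) => // t.
  have := @is_derive_line point4 G (0, x) (1, 0) t (g (t, x)).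
  have e h : h *: ((1, 0) : point4) + (0, x) = (h, x).
    rewrite scale_pair add_pair scaler0 add0r addr0; congr (_, _).
    exact: mulr1.
  by rewrite e => /(_ (dG _)); under eq_fun do rewrite e.
- move=> x cx; have [M gM] := continuous_bounded4 T cg.
  apply: (@integrable_le_cst _ _ _ leb1 _ (fun t => g (t, x)) M) => //.
  + apply: (@le_lt_trans _ _ (T - 0)%:E); last by rewrite ltry.
    by have <- := leb1_itv (ltW T0).
  + by apply: measurable_funTS; exact: measurable_realfun.continuous_measurable_fun.
  + by move=> t tT; exact: gM.
Qed.

End Continuous.

(** * The Gevrey weight commutator *)

Section Commutator.
Context {R : realType}.
Variables (m : nat) (th tau : R).
Implicit Types x y z : R.

Let E x := expR (tau * x `^ th).
Let wgt x := x ^+ m * E x.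

Lemma powR_ge1 x (p : R) : 1 <= x -> 0 <= p -> 1 <= x `^ p.
Proof. move=> x1 p0; have <- : 1 `^ p = 1 :> R by rewrite powR1.
rewrite ge0_ler_powR ?nnegrE//; lra. Qed.

(** For 0 < a <= y + z the ratio a / (y + z) is at most its own power [th <= 1]; the cases a = y and
    a = z add up to the claim. This is where [1 <= s] enters, through [th = s^-1]. *)
Lemma powR_subadd x y z : 0 < th -> th <= 1 -> 0 < y -> 0 < z -> 0 <= x -> x <= y + z ->
  x `^ th <= y `^ th + z `^ th.
Proof.
move=> th_gt0 th_le1.
move=> y0 z0 x0 xyz; have yz0 : 0 < y + z by lra.
apply: (@le_trans _ _ ((y + z) `^ th)).
  by rewrite ge0_ler_powR ?nnegrE//; lra.
have h (a : R) : 0 < a -> a <= y + z -> (y + z) `^ th * (a / (y + z)) <= a `^ th.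
  move=> a0 ayz; have p0 : 0 < a / (y + z) by rewrite divr_gt0.
  have p1 : a / (y + z) <= 1 by rewrite ler_pdivrMr// mul1r.
  rewrite -[in leRHS](divfK (lt0r_neq0 yz0) a) powRM; [|exact: ltW|exact: ltW].
  rewrite mulrC ler_wpM2r ?powR_ge0//.
  have p01 : 0 < a / (y + z) <= 1 by rewrite p0 p1.
  by have := ger_powR p01 th_le1; rewrite powRr1// ltW.
apply: (@le_trans _ _ ((y + z) `^ th * (y / (y + z)) + (y + z) `^ th * (z / (y + z)))).
  rewrite -mulrDr -mulrDl divff ?mulr1// lt0r_neq0//.
by apply: lerD; apply: h => //; lra.
Qed.

(** The monotonicity of x^(th - 1), cleared of denominators. *)
Lemma powR_cross x y : 0 < th -> th <= 1 -> 0 < y -> y <= x -> x `^ th * y <= y `^ th * x.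
Proof.
move=> th_gt0 th_le1.
move=> y0 yx; have x0 : 0 < x by lra.
have d (a : R) : 0 < a -> a = a `^ th * a `^ (1 - th).
  move=> a0; rewrite -powRD; last by rewrite lt0r_neq0 ?implybT.
  by rewrite addrC subrK powRr1// ltW.
rewrite [in leLHS](d y y0) [in leRHS](d x x0).
have : y `^ (1 - th) <= x `^ (1 - th).
  by rewrite ge0_ler_powR ?nnegrE//; lra.
have := powR_ge0 x th; have := powR_ge0 y th.
move: (x `^ th) (y `^ th) (x `^ (1 - th)) (y `^ (1 - th)) => a b c e a0 b0 ce.
rewrite mulrCA ler_wpM2l// ler_wpM2l//.
Qed.

(** The gain in the commutator: a full factor [y] is traded for the power [th / 2] of each of [x]
    and [y]. By [powR_cross] the left side is at most z max(x, y)^th, and x <= 2 z y or y <= 2 z x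
    moves half of that power to the smaller variable. *)
Lemma powR_diff x y z : 0 < th -> th <= 1 -> 1 <= x -> 1 <= y -> 1 <= z -> x <= y + z -> y <= x + z ->
  `|x `^ th - y `^ th| * y <=
  2 * z ^+ 2 * (x `^ (th / 2) * y `^ (th / 2)).
Proof.
move=> th_gt0 th_le1.
move=> x1 y1 z1 xyz yxz.
have half (a : R) : 1 <= a -> a `^ th = a `^ (th / 2) * a `^ (th / 2).
  move=> a1; rewrite -powRD; last by rewrite lt0r_neq0 ?implybT//; lra.
  by congr powR; field.
have key (a b : R) : 1 <= a -> 1 <= b -> a <= b + z -> b <= a -> 
    a `^ th <= 2 * z * (a `^ (th / 2) * b `^ (th / 2)).
  move=> a1 b1 abz ba; rewrite half// mulrCA ler_wpM2l ?powR_ge0//.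
  apply: (@le_trans _ _ ((2 * z * b) `^ (th / 2))).
    by rewrite ge0_ler_powR ?nnegrE//; nra.
  rewrite powRM; [|lra|lra]; rewrite ler_wpM2r ?powR_ge0//.
  apply: (@le_trans _ _ ((2 * z) `^ 1)); last by rewrite powRr1//; lra.
  by apply: ler_powR; lra.
have [yx|/ltW xy] := leP y x.
  have h : y `^ th <= x `^ th by rewrite ge0_ler_powR ?nnegrE//; lra.
  rewrite ger0_norm ?subr_ge0//.
  have c := powR_cross th_gt0 th_le1 (lt_le_trans ltr01 y1) yx.
  have k := key x y x1 y1 xyz yx.
  have x0 := powR_ge0 x th.
  apply: (@le_trans _ _ (z * x `^ th)); last first.
    have -> : 2 * z ^+ 2 * (x `^ (th / 2) * y `^ (th / 2)) =
      z * (2 * z * (x `^ (th / 2) * y `^ (th / 2))) by ring.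
    by rewrite ler_wpM2l//; lra.
  nra.
have h : x `^ th <= y `^ th by rewrite ge0_ler_powR ?nnegrE//; lra.
rewrite ler0_norm ?subr_le0// opprB.
have c : y `^ th * x <= x `^ th * y by apply: powR_cross => //; lra.
have k := key y x y1 x1 yxz xy.
have y0 := powR_ge0 y th.
apply: (@le_trans _ _ (z * y `^ th)); last first.
  have -> : 2 * z ^+ 2 * (x `^ (th / 2) * y `^ (th / 2)) =
    z * (2 * z * (y `^ (th / 2) * x `^ (th / 2))) by ring.
  by rewrite ler_wpM2l//; lra.
nra.
Qed.

Lemma expR_diff (a b c : R) : a <= c -> b <= c ->
  `|expR a - expR b| <= `|a - b| * expR c.
Proof.
wlog ab : a b / b <= a.
  move=> H ac bc; have [|/ltW] := leP b a => h; first exact: H.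
  by rewrite distrC (distrC a); exact: H.
move=> ac bc; rewrite !ger0_norm ?subr_ge0 ?ler_expR//.
have h : 1 + (b - a) <= expR (b - a) by exact: expR_ge1Dx.
apply: (@le_trans _ _ ((a - b) * expR a)); last first.
  by rewrite ler_wpM2l ?subr_ge0// ler_expR.
have e : expR b = expR (b - a) * expR a by rewrite -expRD subrK.
rewrite e; have := expR_gt0 a; move: (expR a) (expR (b - a)) h => u v h u0; nra.
Qed.

Lemma exp_diff x y z n : 0 <= x -> 0 <= y -> x <= y + z -> `|x - y| <= z ->
  `|x ^+ n.+1 - y ^+ n.+1| <= n.+1%:R * 2 ^+ n * z * (y ^+ n + z ^+ n).
Proof.
move=> x0 y0 xyz xy; have z0 : 0 <= z by exact: le_trans xy.
rewrite subrXX normrM.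
have S : `|\sum_(i < n.+1) x ^+ (n.+1.-1 - i) * y ^+ i| <= n.+1%:R * (y + z) ^+ n.
  apply: (le_trans (ler_norm_sum _ _ _)).
  have -> : n.+1%:R * (y + z) ^+ n = \sum_(i < n.+1) (y + z) ^+ n.
    by rewrite sumr_const card_ord mulr_natl.
  apply: ler_sum => i _; rewrite ger0_norm ?mulr_ge0 ?exprn_ge0//.
  have -> : (y + z) ^+ n = (y + z) ^+ (n - i) * (y + z) ^+ i.
    by rewrite -exprD subnK// -ltnS.
  by apply: ler_pM; rewrite ?exprn_ge0 ?lerXn2r ?nnegrE//; lra.
have D : (y + z) ^+ n <= 2 ^+ n * (y ^+ n + z ^+ n).
  have [yz|/ltW zy] := leP y z.
    apply: (@le_trans _ _ ((2 * z) ^+ n)); first by rewrite lerXn2r ?nnegrE//; lra.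
    by rewrite exprMn ler_wpM2l ?exprn_ge0// lerDr exprn_ge0.
  apply: (@le_trans _ _ ((2 * y) ^+ n)); first by rewrite lerXn2r ?nnegrE//; lra.
  by rewrite exprMn ler_wpM2l ?exprn_ge0// lerDl exprn_ge0.
apply: (le_trans (ler_pM _ _ xy S)) => //.
have -> : n.+1%:R * 2 ^+ n * z * (y ^+ n + z ^+ n) =
  z * (n.+1%:R * (2 ^+ n * (y ^+ n + z ^+ n))) by ring.
by rewrite ler_wpM2l// ler_wpM2l.
Qed.

(** Here x = |k|, y = |l|, z = |k - l|. The difference is split as (x^m - y^m) E x + y^m (E x - E
    y): the first part loses a power by factorisation, the second is handled by [powR_diff], and E x
    <= E y * E z. In each product the power [m] falls on one of y and z while the other carries only
    the power 4. The bound [tau <= 1] keeps the constant free of [tau]. *)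
Lemma weight_diff x y z : 0 < th -> th <= 1 -> 0 <= tau -> tau <= 1 -> 1 <= x -> 1 <= y -> 1 <= z ->
  x <= y + z -> y <= x + z -> (0 < m)%N ->
  `|wgt x - wgt y| * y <= (m%:R * 2 ^+ m + 2) *
    (x `^ (th / 2) * y `^ (th / 2)) * (z ^+ 4 * y ^+ m + z ^+ m * y ^+ 4) *
    (E y * E z).
Proof.
move=> th_gt0 th_le1 tau_ge0 tau_le1.
move=> x1 y1 z1 xyz yxz m0.
have xy : `|x - y| <= z by rewrite ler_norml; apply/andP; split; lra.
have x0 : 0 <= x by lra. have y0 : 0 <= y by lra. have z0 : 0 <= z by lra.
have th2 : 0 <= th / 2 by lra.
have X1 := powR_ge1 x1 th2; have Y1 := powR_ge1 y1 th2.
have P1 : 1 <= x `^ (th / 2) * y `^ (th / 2) by rewrite mulr_ege1.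
have Ez1 : 1 <= E z by rewrite -expR0 ler_expR mulr_ge0// powR_ge0.
have yzE : tau * y `^ th <= tau * y `^ th + tau * z `^ th.
  by rewrite lerDl mulr_ge0// powR_ge0.
have xzE : tau * x `^ th <= tau * y `^ th + tau * z `^ th.
  rewrite -mulrDr ler_wpM2l//; apply: powR_subadd => //; exact: lt_le_trans ltr01 _.
have Ex : E x <= E y * E z by rewrite /E -expRD ler_expR.
have dE : `|E x - E y| * y <= 2 * z ^+ 2 * (x `^ (th / 2) * y `^ (th / 2)) * (E y * E z).
  have := expR_diff xzE yzE; rewrite expRD -/(E y) -/(E z) -/(E x) => h.
  have pd := powR_diff th_gt0 th_le1 x1 y1 z1 xyz yxz.
  have EE : 0 <= E y * E z by rewrite mulr_ge0 ?expR_ge0.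
  apply: (@le_trans _ _ (`|tau * x `^ th - tau * y `^ th| * (E y * E z) * y)).
    by rewrite ler_wpM2r//.
  rewrite mulrAC ler_wpM2r// -mulrBr normrM (ger0_norm tau_ge0) -[leLHS]mulrA.
  apply: le_trans pd; rewrite ler_piMl// mulr_ge0//.
rewrite /wgt; case: m m0 => // n _.
have pz k : 1 <= z ^+ k by rewrite exprn_ege1.
have py k : 1 <= y ^+ k by rewrite exprn_ege1.
have dX : `|x ^+ n.+1 - y ^+ n.+1| * y <=
    n.+1%:R * 2 ^+ n.+1 * (z ^+ 4 * y ^+ n.+1 + z ^+ n.+1 * y ^+ 4).
  have h := @exp_diff x y z n x0 y0 xyz xy.
  apply: (@le_trans _ _ (n.+1%:R * 2 ^+ n * z * (y ^+ n + z ^+ n) * y)).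
    by rewrite ler_wpM2r//.
  have -> : n.+1%:R * 2 ^+ n * z * (y ^+ n + z ^+ n) * y =
    n.+1%:R * 2 ^+ n * (z * y ^+ n.+1 + z ^+ n.+1 * y) by rewrite !exprS; ring.
  apply: ler_pM.
  - by rewrite mulr_ge0// exprn_ge0.
  - by rewrite addr_ge0// mulr_ge0 ?exprn_ge0//.
  - by rewrite ler_wpM2l// ler_weXn2l// ler1n.
  apply: lerD; [rewrite ler_wpM2r|rewrite ler_wpM2l]; rewrite ?exprn_ge0//.
  + by rewrite exprS ler_peMr//.
  + by rewrite exprS ler_peMr//.
have -> : x ^+ n.+1 * E x - y ^+ n.+1 * E y = (x ^+ n.+1 - y ^+ n.+1) * E x + y ^+ n.+1 * (E x - E y).
  by ring.
apply: (@le_trans _ _ (`|x ^+ n.+1 - y ^+ n.+1| * y * E x + y ^+ n.+1 * (`|E x - E y| * y))).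
  have := ler_normD ((x ^+ n.+1 - y ^+ n.+1) * E x) (y ^+ n.+1 * (E x - E y)).
  rewrite !normrM (ger0_norm (expR_ge0 _ : 0 <= E x)).
  rewrite (ger0_norm (_ : 0 <= y ^+ n.+1)) ?exprn_ge0//.
  move: (`|_ + _|) (`|x ^+ n.+1 - y ^+ n.+1|) (`|E x - E y|) => a b c h.
  have -> : b * y * E x + y ^+ n.+1 * (c * y) = (b * E x + y ^+ n.+1 * c) * y by ring.
  by rewrite ler_wpM2r//.
pose Q := z ^+ 4 * y ^+ n.+1 + z ^+ n.+1 * y ^+ 4; rewrite -/Q in dX *.
pose P := x `^ (th / 2) * y `^ (th / 2); rewrite -/P in P1 dE *.
have Q0 : 0 <= Q by rewrite addr_ge0// mulr_ge0 ?exprn_ge0//.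
have EE : 0 <= E y * E z by rewrite mulr_ge0 ?expR_ge0.
have t1 : `|x ^+ n.+1 - y ^+ n.+1| * y * E x <= n.+1%:R * 2 ^+ n.+1 * P * Q * (E y * E z).
  apply: ler_pM => //; [by rewrite mulr_ge0|exact: expR_ge0|].
  apply: (le_trans dX); rewrite ler_wpM2r// ler_peMr// mulr_ge0// exprn_ge0.
have P0 : 0 <= 2 * P by rewrite mulr_ge0// (le_trans ler01 P1).
have t2 : y ^+ n.+1 * (`|E x - E y| * y) <= 2 * P * Q * (E y * E z).
  apply: (le_trans (ler_wpM2l _ dE)); first by rewrite exprn_ge0//.
  have -> : y ^+ n.+1 * (2 * z ^+ 2 * P * (E y * E z)) = 2 * P * (z ^+ 2 * y ^+ n.+1) * (E y * E z) by ring.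
  rewrite ler_wpM2r// ler_wpM2l//.
  apply: (@le_trans _ _ (z ^+ 4 * y ^+ n.+1)).
    rewrite ler_wpM2r ?exprn_ge0//.
    by rewrite ler_weXn2l.
  by rewrite lerDl mulr_ge0 ?exprn_ge0//.
rewrite (mulrDl _ _ P) (mulrDl _ _ Q) (mulrDl _ _ (E y * E z)).
exact: lerD t1 t2.
Qed.

End Commutator.

Local Open Scope complex_scope.

(** * Convolutions and the transport term *)

Section Convolution.
Context {R : realType}.
Implicit Types (k l q : freq).

(** Young's inequality for a trilinear form: the arithmetic-geometric inequality on [h k * h l]
    leaves two sums in which the shifted [g] is summed alone. *)
Lemma young_diff (s : seq freq) (h g : freq -> R) : uniq s ->
  (forall k, 0 <= g k) -> (forall k, k \notin s -> g k = 0) ->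
  \sum_(k <- s) \sum_(l <- s) h k * h l * g (k - l) <=
  (\sum_(k <- s) g k) * \sum_(k <- s) h k ^+ 2.
Proof.
move=> us g0 gs.
pose G := \sum_(k <- s) g k.
have Gk k : \sum_(l <- s) g (k - l) <= G.
  apply: (@ler_sum_inj R _ s s (fun l => k - l)) => //.
  by move=> a b /addrI/oppr_inj.
have Gl l : \sum_(k <- s) g (k - l) <= G.
  by apply: (@ler_sum_inj R _ s s (fun k => k - l)) => // a b /addIr.
apply: (@le_trans _ _ (\sum_(k <- s) \sum_(l <- s)
    (h k ^+ 2 / 2 * g (k - l) + h l ^+ 2 / 2 * g (k - l)))).
  apply: ler_sum => k _; apply: ler_sum => l _; rewrite -mulrDl ler_wpM2r//.
  have := sqr_ge0 (h k - h l); lra.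
have -> : \sum_(k <- s) \sum_(l <- s)
    (h k ^+ 2 / 2 * g (k - l) + h l ^+ 2 / 2 * g (k - l)) =
  \sum_(k <- s) h k ^+ 2 / 2 * (\sum_(l <- s) g (k - l)) +
  \sum_(l <- s) h l ^+ 2 / 2 * (\sum_(k <- s) g (k - l)).
  under eq_bigr do rewrite big_split/=.
  rewrite big_split/=; congr (_ + _).
    by apply: eq_bigr => k _; rewrite mulr_sumr.
  by rewrite exchange_big/=; apply: eq_bigr => k _; rewrite mulr_sumr.
rewrite -/G (_ : G * _ = \sum_(k <- s) h k ^+ 2 / 2 * G + \sum_(k <- s) h k ^+ 2 / 2 * G).
  by apply: lerD; apply: ler_sum => k _; rewrite ler_wpM2l// divr_ge0 ?sqr_ge0.
by rewrite -mulr_suml -mulr_suml; field.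
Qed.

Lemma young_conv (s : seq freq) (h g : freq -> R) : uniq s ->
  (forall k, 0 <= g k) -> (forall k, 0 <= h k) -> (forall k, k \notin s -> h k = 0) ->
  \sum_(k <- s) \sum_(l <- s) h k * h (k - l) * g l <=
  (\sum_(k <- s) g k) * \sum_(k <- s) h k ^+ 2.
Proof.
move=> us g0 h0 hs; rewrite exchange_big/= mulr_suml; apply: ler_sum => l _.
rewrite -mulr_suml mulrC ler_wpM2l//.
apply: (@le_trans _ _ (\sum_(k <- s) (h k ^+ 2 / 2 + h (k - l) ^+ 2 / 2))).
  by apply: ler_sum => k _; have := sqr_ge0 (h k - h (k - l)); lra.
rewrite big_split/=.
have : \sum_(k <- s) h (k - l) ^+ 2 / 2 <= \sum_(k <- s) h k ^+ 2 / 2.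
  apply: (@ler_sum_inj R _ s s (fun k => k - l) (fun k => h k ^+ 2 / 2)) => //.
  - by move=> a b /addIr.
  - by move=> x; rewrite divr_ge0 ?sqr_ge0.
  - by move=> x /hs ->; rewrite expr0n/= mul0r.
rewrite -[\sum_(k <- s) h k ^+ 2 / 2]mulr_suml; lra.
Qed.

Lemma conv_sum_le (s s' : seq freq) (f g : freq -> R) : uniq s -> uniq s' ->
  (forall k, 0 <= f k) -> (forall k, 0 <= g k) -> (forall k, k \notin s -> f k = 0) ->
  \sum_(k <- s') \sum_(l <- s) f (k - l) * g l <=
  (\sum_(k <- s) f k) * \sum_(k <- s) g k.
Proof.
move=> us us' f0 g0 fs; rewrite exchange_big/= mulr_sumr; apply: ler_sum => l _.
rewrite -mulr_suml ler_wpM2r//.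
by apply: (@ler_sum_inj R _ s' s (fun k => k - l)) => // a b /addIr.
Qed.

End Convolution.

Section ComplexVectors.
Context {R : realType}.
Local Notation C := (complex R).
Implicit Types (k l q : freq) (z : C) (v w : 'I_3 -> C).
Local Notation nm := (@Normc.normc R).
Local Notation fnorm := (@freq_norm R).

(* The conjugation of [complex.v], with a fixed ring structure on [R]. *)
Definition cj z : C := conjc z.

Lemma cjD z z' : cj (z + z') = cj z + cj z'. Proof. exact: rmorphD. Qed.
Lemma cjN z : cj (- z) = - cj z. Proof. exact: rmorphN. Qed.
Lemma cjB z z' : cj (z - z') = cj z - cj z'. Proof. exact: rmorphB. Qed.
Lemma cjM z z' : cj (z * z') = cj z * cj z'. Proof. exact: rmorphM. Qed.
Lemma cj0 : cj 0 = 0. Proof. exact: rmorph0. Qed.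
Lemma cjK z : cj (cj z) = z. Proof. exact: conjcK. Qed.
Lemma cjR (a : R) : cj a%:C = a%:C. Proof. exact: conjc_real. Qed.
Lemma cj_int (n : int) : cj n%:~R = n%:~R. Proof. exact: rmorph_int. Qed.
Lemma cj_i : cj 'i = - 'i.
Proof. by apply/eqP; rewrite eq_complex/= oppr0 !eqxx. Qed.
Lemma cj_sum (T : Type) (r : seq T) (P : pred T) (f : T -> C) :
  cj (\sum_(x <- r | P x) f x) = \sum_(x <- r | P x) cj (f x).
Proof. exact: rmorph_sum. Qed.

Lemma nm_ge0 z : 0 <= nm z. Proof. by case: z => a b; exact: sqrtr_ge0. Qed.

Lemma nm_sqr z : nm z ^+ 2 = complex.Re z ^+ 2 + complex.Im z ^+ 2.
Proof. by case: z => a b; rewrite /= sqr_sqrtr// addr_ge0 ?sqr_ge0. Qed.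

Lemma nm_int (n : int) : nm (n%:~R) = `|n%:~R|.
Proof.
rewrite -(rmorph_int (real_complex R)) /= expr0n/= addr0 sqrtr_sqr//.
Qed.

Lemma nm_i : nm 'i = 1.
Proof. by rewrite /= expr0n/= add0r expr1n sqrtr1. Qed.

Lemma nm_real (a : R) : nm a%:C = `|a|.
Proof. by rewrite /= expr0n/= addr0 sqrtr_sqr. Qed.

Lemma nm_cj z : nm (cj z) = nm z.
Proof. by case: z => a b; rewrite /= sqrrN. Qed.

Lemma nm_sum (T : Type) (s : seq T) (P : pred T) (f : T -> C) :
  nm (\sum_(x <- s | P x) f x) <= \sum_(x <- s | P x) nm (f x).
Proof.
elim/big_ind2 : _ => [|a b c d h1 h2|//]; first by rewrite Normc.normc0.
by apply: (le_trans (le_normcD _ _)); exact: lerD.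
Qed.

Lemma Re_le_nm z : `|complex.Re z| <= nm z.
Proof.
case: z => a b /=; rewrite -sqrtr_sqr ler_sqrt ?addr_ge0 ?sqr_ge0//.
by rewrite lerDl sqr_ge0.
Qed.

Lemma Im_le_nm z : `|complex.Im z| <= nm z.
Proof.
case: z => a b /=; rewrite -sqrtr_sqr ler_sqrt ?addr_ge0 ?sqr_ge0//.
by rewrite lerDr sqr_ge0.
Qed.

Lemma nm_le_ReIm z : nm z <= `|complex.Re z| + `|complex.Im z|.
Proof.
rewrite -ler_sqr ?nnegrE ?nm_ge0 ?addr_ge0// nm_sqr sqrrD !real_normK ?num_real//.
by rewrite lerD2r lerDl mulrn_wge0// mulr_ge0.
Qed.

Definition vnorm2 v : R := \sum_i nm (v i) ^+ 2.
Definition vnorm v : R := Num.sqrt (vnorm2 v).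
Definition rdot v w : R := \sum_i complex.Re ((cj (v i)) * w i).
Definition fdot k v : C := \sum_(i < 3) (k ord0 i)%:~R * v i.

Lemma vnorm2_ge0 v : 0 <= vnorm2 v.
Proof. by apply: sumr_ge0 => i _; exact: sqr_ge0. Qed.

Lemma vnorm_ge0 v : 0 <= vnorm v. Proof. exact: sqrtr_ge0. Qed.

Lemma sqr_vnorm v : vnorm v ^+ 2 = vnorm2 v.
Proof. by rewrite sqr_sqrtr// vnorm2_ge0. Qed.

Lemma vnorm0 v : (forall i, v i = 0) -> vnorm v = 0.
Proof.
move=> v0; rewrite /vnorm /vnorm2 big1 ?sqrtr0// => i _.
by rewrite v0 Normc.normc0 expr0n.
Qed.

Lemma nm_le_vnorm v i : nm (v i) <= vnorm v.
Proof.
rewrite -ler_sqr ?nnegrE ?nm_ge0 ?vnorm_ge0// sqr_vnorm /vnorm2 (bigD1 i)//= lerDl.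
by apply: sumr_ge0 => j _; exact: sqr_ge0.
Qed.

Lemma vnorm_le_sum v : vnorm v <= \sum_i nm (v i).
Proof.
have S0 : 0 <= \sum_i nm (v i) by apply: sumr_ge0 => i _; exact: nm_ge0.
rewrite -ler_sqr ?nnegrE ?vnorm_ge0// sqr_vnorm expr2 mulr_suml; apply: ler_sum => i _.
rewrite expr2 ler_wpM2l ?nm_ge0// (bigD1 i)//= lerDl.
by apply: sumr_ge0 => j _; exact: nm_ge0.
Qed.

Lemma vnorm_le v (c : R) : (forall i, nm (v i) <= c) -> vnorm v <= 3 * c.
Proof.
move=> vc; apply: (le_trans (vnorm_le_sum _)).
by apply: (le_trans (ler_sum _ (fun i _ => vc i))); rewrite sumr_const card_ord mulr_natl.
Qed.

Lemma nm_fdot k v : nm (fdot k v) <= 3 * fnorm k * vnorm v.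
Proof.
apply: (le_trans (nm_sum _ _ _)).
apply: (@le_trans _ _ (\sum_(i < 3) fnorm k * vnorm v)).
  apply: ler_sum => i _; rewrite Normc.normcM nm_int.
  by apply: ler_pM; [exact: normr_ge0|exact: nm_ge0|exact: coord_le_fnorm|exact: nm_le_vnorm].
by rewrite sumr_const card_ord -[leLHS]mulr_natl mulrA.
Qed.

Lemma rdot_le v w : `|rdot v w| <= 3 * vnorm v * vnorm w.
Proof.
apply: (le_trans (ler_norm_sum _ _ _)).
apply: (@le_trans _ _ (\sum_(i < 3) vnorm v * vnorm w)).
  apply: ler_sum => i _; apply: (le_trans (Re_le_nm _)).
  by rewrite Normc.normcM nm_cj; apply: ler_pM; rewrite ?nm_ge0 ?nm_le_vnorm.
by rewrite sumr_const card_ord -[leLHS]mulr_natl mulrA.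
Qed.

Lemma rdotZ v (a : C) w : rdot v (fun i => a * w i) = complex.Re (a * \sum_i (cj (v i)) * w i).
Proof.
rewrite mulr_sumr raddf_sum; apply: eq_bigr => i _.
by congr complex.Re; ring.
Qed.

Lemma rdotD v w w' : rdot v (fun i => w i + w' i) = rdot v w + rdot v w'.
Proof.
rewrite /rdot -big_split; apply: eq_bigr => i _ /=.
by rewrite mulrDr raddfD.
Qed.

Lemma rdotN v w : rdot v (fun i => - w i) = - rdot v w.
Proof.
rewrite /rdot -sumrN; apply: eq_bigr => i _ /=.
by rewrite mulrN raddfN.
Qed.

Lemma rdotr v (a : R) w : rdot v (fun i => a%:C * w i) = a * rdot v w.
Proof.
rewrite /rdot mulr_sumr; apply: eq_bigr => i _ /=.
by case: (v i) (w i) => [x y] [x' y'] /=; ring.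
Qed.

Lemma rdot_sum (T : Type) (s : seq T) v (w : T -> 'I_3 -> C) :
  rdot v (fun i => \sum_(x <- s) w x i) = \sum_(x <- s) rdot v (w x).
Proof.
rewrite /rdot exchange_big/=; apply: eq_bigr => i _.
by rewrite mulr_sumr raddf_sum.
Qed.

Lemma rdotvv v : rdot v v = vnorm2 v.
Proof.
apply: eq_bigr => i _; rewrite nm_sqr; case: (v i) => a b /=; ring.
Qed.

Lemma fdotD k l v : fdot (k + l) v = fdot k v + fdot l v.
Proof.
rewrite /fdot -big_split; apply: eq_bigr => i _ /=.
by rewrite mxE rmorphD mulrDl.
Qed.

Lemma fdotN k v : fdot (- k) v = - fdot k v.
Proof. by rewrite /fdot -sumrN; apply: eq_bigr => i _; rewrite mxE rmorphN mulNr. Qed.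

Lemma fdot_cj k v : (cj (fdot k v)) = fdot k (fun i => (cj (v i))).
Proof. by rewrite /fdot cj_sum; apply: eq_bigr => i _; rewrite cjM cj_int. Qed.

(** The Leray projector on the k-th mode. At [k = 0] it is the identity. *)
Definition leray k v : 'I_3 -> C :=
  fun i => v i - (k ord0 i)%:~R * ((@sqnorm R k)^-1%:C * fdot k v).

Lemma sqnormC k : \sum_(i < 3) (k ord0 i)%:~R * (k ord0 i)%:~R = (@sqnorm R k)%:C.
Proof.
rewrite /sqnorm rmorph_sum; apply: eq_bigr => i _.
by rewrite rmorphXn/= rmorph_int expr2.
Qed.

Lemma sqnorm_gt0 k : k != 0 -> 0 < @sqnorm R k.
Proof. by move=> k0; rewrite -sqr_fnorm exprn_gt0// fnorm_gt0. Qed.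

Lemma fdot_leray k v : k != 0 -> fdot k (leray k v) = 0.
Proof.
move=> k0; rewrite /leray /fdot.
under eq_bigr do rewrite mulrBr mulrA.
rewrite sumrB -mulr_suml sqnormC mulrA -rmorphM/= divff ?mul1r ?subrr//.
by rewrite lt0r_neq0// sqnorm_gt0.
Qed.

Lemma rdot_leray k v w : fdot k v = 0 -> rdot v (leray k w) = rdot v w.
Proof.
move=> kv; rewrite /leray rdotD rdotN.
rewrite (_ : rdot v (fun i => _ * _) = 0) ?subr0//.
have -> : (fun i => (k ord0 i)%:~R * ((@sqnorm R k)^-1%:C * fdot k w)) =
  (fun i => ((@sqnorm R k)^-1%:C * fdot k w) * (k ord0 i)%:~R).
  by apply/funext => i; rewrite mulrC.
rewrite rdotZ; have -> : \sum_i (cj (v i)) * (k ord0 i)%:~R = (cj (fdot k v)).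
  by rewrite fdot_cj; apply: eq_bigr => i _; rewrite mulrC.
by rewrite kv cj0 mulr0.
Qed.

Lemma vnorm_leray k v : k != 0 -> vnorm (leray k v) <= 12 * vnorm v.
Proof.
move=> k0; have x0 := @fnorm_gt0 R k k0.
(* Each component is at most 4 times the norm of [v], 1 from [v] itself and 3 from [nm_fdot]; the
   other factor 3 is that of [vnorm_le]. *)
rewrite (_ : 12 = 3 * 4); last by ring.
rewrite -mulrA; apply: vnorm_le => i.
apply: (le_trans (le_normcD _ _)); rewrite normcN !Normc.normcM nm_real nm_int.
have h : `|(k ord0 i)%:~R| * (`|(@sqnorm R k)^-1| * nm (fdot k v)) <= 3 * vnorm v.
  rewrite -sqr_fnorm (ger0_norm (_ : 0 <= fnorm k ^- 2)) ?invr_ge0 ?sqr_ge0//.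
  apply: (@le_trans _ _ (fnorm k * (fnorm k ^- 2 * (3 * fnorm k * vnorm v)))).
    apply: ler_pM => //; first by rewrite mulr_ge0 ?invr_ge0 ?sqr_ge0 ?nm_ge0.
      exact: coord_le_fnorm.
    by rewrite ler_wpM2l ?invr_ge0 ?sqr_ge0// nm_fdot.
  rewrite le_eqVlt; apply/orP; left; apply/eqP; field; exact: lt0r_neq0.
have := nm_le_vnorm v i; lra.
Qed.

End ComplexVectors.

Section Transport.
Context {R : realType}.
Local Notation C := (complex R).
Local Notation fnorm := (@freq_norm R).
Implicit Types (k l q : freq) (U V : freq -> 'I_3 -> C) (s : seq freq).

Lemma addrr_eq0 (x : R) : x + x = 0 -> x = 0. Proof. lra. Qed.

Definition real_field U := forall k i, U (- k) i = (cj (U k i)).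
Definition div_free U := forall k, fdot k (U k) = 0.
Definition supported s U := forall k, k \notin s -> forall i, U k i = 0.

(* The contribution of the pair of frequencies (k - l, l) to the k-th Fourier
   coefficient of (U . grad) V. *)
Definition transport_term U V k l : 'I_3 -> C :=
  fun i => 'i * fdot l (U (k - l)) * V l i.

Definition transport s U V k : 'I_3 -> C :=
  fun i => \sum_(l <- s) transport_term U V k l i.

Lemma vnorm_transport_term U V k l :
  vnorm (transport_term U V k l) <= 9 * (fnorm l * vnorm (U (k - l)) * vnorm (V l)).
Proof.
rewrite (_ : 9 = 3 * 3); last by ring.
rewrite -mulrA; apply: vnorm_le => i; rewrite !Normc.normcM nm_i mul1r.
rewrite !mulrA; apply: ler_pM; rewrite ?nm_ge0 ?nm_le_vnorm//.
exact: nm_fdot.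
Qed.

Lemma rdot_transport_le U V W k l :
  `|rdot (W k) (transport_term U V k l)| <=
  27 * (fnorm l * vnorm (U (k - l)) * vnorm (V l) * vnorm (W k)).
Proof.
apply: (le_trans (rdot_le _ _)).
have -> : 27 * (fnorm l * vnorm (U (k - l)) * vnorm (V l) * vnorm (W k)) =
  3 * vnorm (W k) * (9 * (fnorm l * vnorm (U (k - l)) * vnorm (V l))) by ring.
by rewrite ler_wpM2l ?vnorm_transport_term// mulr_ge0 ?vnorm_ge0.
Qed.

(** Since (k - l) . U_(k-l) = 0, the derivative in the transport term may be charged to [k] instead
    of [l]. *)
Lemma fdot_sub U k l : div_free U -> fdot l (U (k - l)) = fdot k (U (k - l)).
Proof.
by move=> dU; have := dU (k - l); rewrite fdotD fdotN => /eqP; rewrite subr_eq0 => /eqP.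
Qed.

(** The skew-adjointness of U . grad, mode by mode: exchanging [k] and [l] conjugates both scalar
    factors, and because of the factor i the real part changes sign. *)
Lemma transport_antisym U V k l : real_field U -> div_free U ->
  rdot (V l) (transport_term U V l k) = - rdot (V k) (transport_term U V k l).
Proof.
move=> rU dU; rewrite !rdotZ.
have -> : fdot k (U (l - k)) = (cj (fdot l (U (k - l)))).
  rewrite fdot_cj (fdot_sub l k dU) /fdot; apply: eq_bigr => i _.
  by rewrite -rU opprB.
rewrite (_ : \sum_i (cj (V l i)) * V k i = (cj (\sum_i (V k i)^* * V l i))); last first.
  rewrite cj_sum; apply: eq_bigr => i _.
  by rewrite cjM cjK mulrC.
move: (fdot l (U (k - l))) (\sum_i (cj (V k i)) * V l i) => [a b] [c d] /=; ring.
Qed.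

Lemma transport_orthogonal s U V : real_field U -> div_free U ->
  \sum_(k <- s) rdot (V k) (transport s U V k) = 0.
Proof.
move=> rU dU; under eq_bigr do rewrite rdot_sum.
apply: addrr_eq0.
rewrite {2}exchange_big/= -big_split/= big1// => k _.
rewrite -big_split/= big1// => l _.
by rewrite (@transport_antisym U V k l)// subrr.
Qed.

(* Antisymmetry of [q] kills the form with weight [w k * w l]. *)
Lemma sum_commutator (T : Type) (r : seq T) (w : T -> R) (q : T -> T -> R) :
  (forall i j, q j i = - q i j) ->
  \sum_(i <- r) \sum_(j <- r) w i ^+ 2 * q i j =
  \sum_(i <- r) \sum_(j <- r) w i * (w i - w j) * q i j.
Proof.
move=> qa.
have z : \sum_(i <- r) \sum_(j <- r) w i * w j * q i j = 0.
  apply: addrr_eq0; rewrite {2}exchange_big/= -big_split/= big1// => i _.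
  by rewrite -big_split/= big1// => j _; rewrite (qa i j); ring.
rewrite -[LHS]subr0 -[X in _ - X]z -sumrB; apply: eq_bigr => i _.
by rewrite -sumrB; apply: eq_bigr => j _; ring.
Qed.

(** One triad k, l, k - l: the factors are regrouped so that the two products have the shapes
    handled by [young_diff] and [young_conv], a factor [Xz] of size at least 1 being inserted where
    it completes the shape. *)
Lemma commutator_term (K wk dw y ak al az Xk Xl Xz Ez El zm ym z4 y4 : R) :
  0 <= K -> 0 <= wk -> 0 <= ak -> 0 <= al -> 0 <= az -> 0 <= Xk -> 0 <= Xl -> 1 <= Xz ->
  0 <= Ez -> 0 <= El -> 0 <= zm -> 0 <= ym -> 0 <= z4 -> 0 <= y4 ->
  dw * y <= K * (Xk * Xl) * (z4 * ym + zm * y4) * (El * Ez) ->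
  27 * wk * ak * al * az * (dw * y) <=
  27 * K * (Xk * wk * ak * (Xl * (ym * El) * al) * (z4 * Ez * az * Xz) +
            Xk * wk * ak * (Xz * (zm * Ez) * az) * (y4 * El * al * Xl)).
Proof.
move=> K0 wk0 ak0 al0 az0 Xk0 Xl0 Xz1 Ez0 El0 zm0 ym0 z40 y40 wd.
apply: (le_trans (ler_wpM2l _ wd)); first by rewrite !mulr_ge0.
have -> : 27 * wk * ak * al * az * (K * (Xk * Xl) * (z4 * ym + zm * y4) * (El * Ez)) =
  27 * K * (Xk * wk * ak * (Xl * (ym * El) * al) * (z4 * Ez * az) +
            Xk * wk * ak * (zm * Ez * az) * (y4 * El * al * Xl)) by ring.
rewrite ler_wpM2l ?mulr_ge0//; apply: lerD.
  by rewrite ler_wpM2l ?mulr_ge0// ler_peMr// !mulr_ge0.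
rewrite ler_wpM2r ?mulr_ge0// ler_wpM2l ?mulr_ge0// ler_wpM2r//.
by rewrite ler_peMl// mulr_ge0.
Qed.

Definition gweight (m : nat) (th tau : R) k : R :=
  fnorm k ^+ m * expR (tau * fnorm k `^ th).

Lemma gweight_ge0 m th tau k : 0 <= gweight m th tau k.
Proof. by rewrite mulr_ge0 ?expR_ge0// exprn_ge0// fnorm_ge0. Qed.

(** 27 comes from [rdot_transport_le], the parenthesis from [weight_diff], 2 from the two Young sums
    and 40 from [sum_le_sqrt6]. *)
Definition transport_const m : R := 27 * (m%:R * 2 ^+ m + 2) * 2 * 40.

(* Subtracting the antisymmetric form with weight [w k * w l] replaces
   [w k ^+ 2] by the commutator [w k * (w k - w l)]. *)
Lemma transport_weighted s U m th tau : uniq s -> 0 \notin s -> (8 <= m)%N ->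
  0 < th -> th <= 1 -> 0 <= tau -> tau <= 1 ->
  real_field U -> div_free U -> supported s U ->
  `|\sum_(k <- s) gweight m th tau k ^+ 2 * rdot (U k) (transport s U U k)| <=
  transport_const m * Num.sqrt (\sum_(k <- s) gweight m th tau k ^+ 2 * vnorm2 (U k)) *
  \sum_(k <- s) fnorm k `^ th * gweight m th tau k ^+ 2 * vnorm2 (U k).
Proof.
move=> us s0 m8 th0 th1 t0 t1 rU dU sU.
pose w := gweight m th tau; rewrite -/w.
have w0 k : 0 <= w k by exact: gweight_ge0.
pose q k l := rdot (U k) (transport_term U U k l).
have qa k l : q l k = - q k l by exact: transport_antisym.
have nz k : k \in s -> k != 0 by move=> ks; apply: contraNN s0 => /eqP <-.
have -> : \sum_(k <- s) w k ^+ 2 * rdot (U k) (transport s U U k) =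
    \sum_(k <- s) \sum_(l <- s) w k * (w k - w l) * q k l.
  rewrite -(sum_commutator s w qa); apply: eq_bigr => k _.
  by rewrite rdot_sum mulr_sumr.
pose E k : R := expR (tau * fnorm k `^ th).
pose X k : R := fnorm k `^ (th / 2).
pose al k := vnorm (U k).
have al0 k : 0 <= al k by exact: vnorm_ge0.
have als k : k \notin s -> al k = 0 by move=> ks; apply: vnorm0 => i; exact: sU.
have E0 k : 0 <= E k by exact: expR_ge0.
have X0 k : 0 <= X k by exact: powR_ge0.
pose h k := X k * w k * al k.
pose g k := fnorm k ^+ 4 * E k * al k * X k.
have x0 k : 0 <= fnorm k by exact: fnorm_ge0.
have h0 k : 0 <= h k by exact: mulr_ge0 (mulr_ge0 (X0 k) (w0 k)) (al0 k).
have g0 k : 0 <= g k.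
  exact: mulr_ge0 (mulr_ge0 (mulr_ge0 (exprn_ge0 4 (x0 k)) (E0 k)) (al0 k)) (X0 k).
have hs k : k \notin s -> h k = 0 by move=> /als; rewrite /h => ->; rewrite mulr0.
have gs k : k \notin s -> g k = 0 by move=> /als; rewrite /g => ->; rewrite mulr0 mul0r.
pose K : R := 27 * (m%:R * 2 ^+ m + 2).
have K0 : 0 <= K by rewrite mulr_ge0// addr_ge0// mulr_ge0// exprn_ge0.
have term k l : k \in s -> l \in s ->
    `|w k * (w k - w l) * q k l| <= K * (h k * h l * g (k - l) + h k * h (k - l) * g l).
  move=> ks ls; have [kl|kl] := boolP (k - l \in s); last first.
    rewrite /q /transport_term (_ : rdot _ _ = 0) ?mulr0 ?normr0.
      exact: mulr_ge0 K0 (addr_ge0 (mulr_ge0 (mulr_ge0 (h0 k) (h0 l)) (g0 (k - l)))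
        (mulr_ge0 (mulr_ge0 (h0 k) (h0 (k - l))) (g0 l))).
    rewrite rdotZ (_ : fdot l (U (k - l)) = 0) ?mulr0 ?mul0r//.
    by rewrite /fdot big1// => i _; rewrite sU// mulr0.
  have k1 := @fnorm_ge1 R k (nz _ ks). have l1 := @fnorm_ge1 R l (nz _ ls).
  have kl1 := @fnorm_ge1 R _ (nz _ kl).
  have c1 : fnorm k <= fnorm l + fnorm (k - l).
    by have := @fnormD R l (k - l); rewrite addrC subrK.
  have c2 : fnorm l <= fnorm k + fnorm (k - l).
    by have := @fnormB R k (k - l); rewrite opprB addrC subrK.
  have := @weight_diff R m th tau _ _ _ th0 th1 t0 t1 k1 l1 kl1 c1 c2 (leq_trans (isT : 0 < 8)%N m8).
  have Xk1 : 1 <= X (k - l) by rewrite powR_ge1//; lra.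
  have xm j n : 0 <= fnorm j ^+ n by rewrite exprn_ge0.
  move=> wd.
  have := @commutator_term (m%:R * 2 ^+ m + 2) (w k) `|w k - w l| (fnorm l) (al k) (al l) (al (k - l))
    (X k) (X l) (X (k - l)) (E (k - l)) (E l) _ _ _ _ _ (w0 k) (al0 _) (al0 _) (al0 _)
    (X0 _) (X0 _) Xk1 (E0 _) (E0 _) (xm _ _) (xm _ _) (xm _ _) (xm _ _) wd.
  have K1 : 0 <= m%:R * 2 ^+ m + 2 :> R by rewrite addr_ge0// mulr_ge0// exprn_ge0.
  move=> /(_ K1); apply: le_trans.
  have qb : `|q k l| <= 27 * (fnorm l * al (k - l) * al l * al k) by exact: rdot_transport_le.
  rewrite (normrM (w k * (w k - w l))) (normrM (w k)) (ger0_norm (w0 k)).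
  apply: (le_trans (ler_wpM2l _ qb)); first exact: mulr_ge0 (w0 k) (normr_ge0 _).
  move: (`|w k - w l|) (w k) (fnorm l) (al l) (al k) (al (k - l)) => a b c d e f.
  by rewrite le_eqVlt; apply/orP; left; apply/eqP; ring.
pose H := \sum_(k <- s) h k ^+ 2.
pose G := \sum_(k <- s) g k.
have HE : \sum_(k <- s) fnorm k `^ th * w k ^+ 2 * vnorm2 (U k) = H.
  rewrite big_seq [RHS]big_seq; apply: eq_bigr => k ks.
  rewrite /h -sqr_vnorm -/(al k) !exprMn; congr (_ * _ * _).
  rewrite expr2 -powRD; first by congr powR; field.
  by rewrite (gt_eqF (@fnorm_gt0 R k (nz _ ks))) implybT.
rewrite HE.
apply: (@le_trans _ _ (K * (G * H + G * H))).
  apply: (le_trans (ler_norm_sum _ _ _)).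
  apply: (@le_trans _ _ (\sum_(k <- s) \sum_(l <- s)
      K * (h k * h l * g (k - l) + h k * h (k - l) * g l))).
    rewrite big_seq [leRHS]big_seq; apply: ler_sum => k ks.
    apply: (le_trans (ler_norm_sum _ _ _)).
    by rewrite big_seq [leRHS]big_seq; apply: ler_sum => l ls; exact: term.
  under eq_bigr do rewrite -mulr_sumr.
  rewrite -mulr_sumr ler_wpM2l//.
  under eq_bigr do rewrite big_split/=.
  by rewrite big_split/=; apply: lerD; [exact: young_diff|exact: young_conv].
(* The four powers in [g], at most one more from [X], and the three spent in [sum_le_sqrt6] add up
   to 8: this is the condition [8 <= m]. *)
have GW : G <= 40 * Num.sqrt (\sum_(k <- s) w k ^+ 2 * vnorm2 (U k)).
  apply: (le_trans (@sum_le_sqrt6 R s g us s0 g0)).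
  rewrite ler_wpM2l// ler_sqrt; last first.
    by apply: sumr_ge0 => k _; rewrite mulr_ge0 ?sqr_ge0// vnorm2_ge0.
  rewrite big_seq [leRHS]big_seq; apply: ler_sum => k ks.
  rewrite -sqr_vnorm -/(al k) -exprMn ler_sqr ?nnegrE ?mulr_ge0 ?exprn_ge0//.
  have k1 := @fnorm_ge1 R k (nz _ ks).
  have Xk : X k <= fnorm k.
    have e : fnorm k `^ (th / 2) <= fnorm k `^ 1 by apply: ler_powR => //; lra.
    by rewrite powRr1 in e.
  rewrite /g /w /gweight -/(E k).
  have -> : fnorm k ^+ 3 * (fnorm k ^+ 4 * E k * al k * X k) =
    fnorm k ^+ 7 * X k * (E k * al k) by ring.
  rewrite -[leRHS]mulrA ler_wpM2r ?mulr_ge0//.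
  apply: (@le_trans _ _ (fnorm k ^+ 8)).
    by rewrite [leRHS]exprSr ler_wpM2l// exprn_ge0.
  by rewrite ler_weXn2l.
have H0 : 0 <= H by apply: sumr_ge0 => k _; exact: sqr_ge0.
apply: (@le_trans _ _ (K * (2 * (40 * Num.sqrt (\sum_(k <- s) w k ^+ 2 * vnorm2 (U k))) * H))).
  by rewrite ler_wpM2l// -mulrDl ler_wpM2r//; lra.
rewrite /transport_const -/K; move: (Num.sqrt _) => Z.
by rewrite le_eqVlt; apply/orP; left; apply/eqP; ring.
Qed.

End Transport.

(** * Barriers and bounded Lipschitz maps *)

Section Barrier.
Context {R : realType}.

(** A continuity argument: let S be the supremum of the times up to [t1] at which f <= a. Just after
    S the function is still below [b], hence nonincreasing and still at most [a], against the choice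
    of S. The gap [a < b] allows the sign of the derivative to be known only while [f] is below
    [b]. *)
Lemma derive_barrier (f df : R -> R) (a b T : R) : f 0 <= a -> a < b ->
  (forall t, 0 <= t <= T -> is_derive t 1 f (df t)) ->
  (forall t, 0 <= t <= T -> f t <= b -> df t <= 0) ->
  forall t, 0 <= t <= T -> f t <= a.
Proof.
move=> f0a ab fd dneg t1 /andP[t10 t1T]; rewrite leNgt; apply/negP => ft1.
pose E : set R := [set t | 0 <= t <= t1 /\ f t <= a].
have E0 : E 0 by rewrite /E/= lexx.
have Eub : ubound E t1 by move=> x [/andP[]].
have supE : has_sup E by split; [exists 0|exists t1].
pose S := sup E.
have S0 : 0 <= S by apply: ub_le_sup => //; exists t1.
have St1 : S <= t1 by apply: ge_sup => //; exists 0.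
have ST : 0 <= S <= T by rewrite S0 (le_trans St1).
have cS : {for S, continuous f} by exact: is_derive_continuous (fd _ ST).
have fS : f S <= a.
  rewrite leNgt; apply/negP => aS.
  move: (cS) => /cvgrPdist_lt /(_ (f S - a)); rewrite subr_gt0 => /(_ aS)[e /= e0 eS].
  have [x Ex Sx] := sup_adherent e0 supE.
  have xS : x <= S by apply: ub_le_sup => //; exists t1.
  have := eS x; rewrite /ball_/= ger0_norm ?subr_ge0// => /(_ _).
  have -> : S - x < e by move: Sx; rewrite -/S; lra.
  by move=> /(_ isT); have := ler_norm (f S - f x); case: Ex => _; lra.
have Slt : S < t1.
  by rewrite lt_neqAle St1 andbT; apply/eqP => e; move: fS; rewrite e leNgt ft1.
have fSb : 0 < b - f S by lra.
move: (cS) => /cvgrPdist_lt /(_ _ fSb)[e /= e0 eS'].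
have eS x : `|S - x| < e -> f x < b.
  by move=> /eS' /=; have := ler_norm (f x - f S); rewrite distrC; lra.
pose t2 := Num.min (S + e / 2) t1.
have St2 : S < t2 by rewrite lt_min Slt andbT; lra.
have t2t1 : t2 <= t1 by rewrite ge_min lexx orbT.
have t2e : t2 <= S + e / 2 by rewrite ge_min lexx.
have fb x : S <= x <= t2 -> f x <= b.
  move=> /andP[Sx xt2]; apply/ltW/eS; rewrite distrC ger0_norm ?subr_ge0//; lra.
have xT x : S <= x <= t2 -> 0 <= x <= T by move=> /andP[? ?]; apply/andP; split; lra.
have : f t2 <= f S.
  rewrite -lerN2; apply: (@ge0_derive_le _ (fun x => - f x) (fun x => - df x)).
  - exact: ltW.
  - by move=> x /xT xx; apply: is_deriveN; exact: fd.
  - by move=> x xx; rewrite oppr_ge0; apply: dneg; [exact: xT|exact: fb].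
move=> ft2; have : E t2 by split; [apply/andP; split; lra|exact: le_trans fS].
have : ~ (t2 <= S) by apply/negP; rewrite -ltNge.
by move=> h Et2; apply: h; apply: ub_le_sup => //; exists t1.
Qed.

End Barrier.

Section ComplexDerivative.
Context {R : realType}.
Local Notation C := (complex R).
Implicit Types (f g : R -> C) (t : R) (z w c : C).

Definition cderiv f t z :=
  is_derive t 1 (fun t => complex.Re (f t)) (complex.Re z) /\
  is_derive t 1 (fun t => complex.Im (f t)) (complex.Im z).

Lemma is_derive_ext (h h' : R -> R) (t d d' : R) : is_derive t 1 h d ->
  h =1 h' -> d = d' -> is_derive t 1 h' d'.
Proof. by move=> hd /funext <- <-. Qed.

Lemma cderivD f g t z w : cderiv f t z -> cderiv g t w ->
  cderiv (fun t => f t + g t) t (z + w).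
Proof.
move=> [f1 f2] [g1 g2]; split.
  by apply: (is_derive_ext (is_deriveD f1 g1)) => [x|]; rewrite ?fctE raddfD.
by apply: (is_derive_ext (is_deriveD f2 g2)) => [x|]; rewrite ?fctE raddfD.
Qed.

Lemma is_deriveZr (h : R -> R) (a t d : R) : is_derive t 1 h d ->
  is_derive t 1 (fun t => a * h t) (a * d).
Proof. exact: is_deriveZ. Qed.

Lemma cderivZ c f t z : cderiv f t z -> cderiv (fun t => c * f t) t (c * z).
Proof.
move=> [f1 f2]; case: c => a b; split.
  apply: (@is_derive_ext (fun x => a * complex.Re (f x) - b * complex.Im (f x)) _ _ _ _
    (is_deriveB (is_deriveZr a f1) (is_deriveZr b f2))) => [x|].
    by case: (f x) => c d /=.
  by case: z {f1 f2} => c d /=.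
apply: (@is_derive_ext (fun x => a * complex.Im (f x) + b * complex.Re (f x)) _ _ _ _
  (is_deriveD (is_deriveZr a f2) (is_deriveZr b f1))) => [x|].
  by case: (f x) => c d /=.
by case: z {f1 f2} => c d /=.
Qed.

Lemma cderiv_cj f t z : cderiv f t z -> cderiv (fun t => (cj (f t))) t (cj z).
Proof.
move=> [f1 f2]; split.
  by apply: (is_derive_ext f1) => [x|]; [case: (f x)|case: z {f1 f2}].
by apply: (is_derive_ext (is_deriveN f2)) => [x|]; [rewrite fctE; case: (f x)|case: z {f1 f2}].
Qed.

Lemma cderiv_cst c t : cderiv (fun _ => c) t 0.
Proof. by split; exact: is_derive_cst. Qed.

Lemma cderiv_sum (T : Type) (s : seq T) (f : T -> R -> C) t (z : T -> C) :
  (forall x, cderiv (f x) t (z x)) ->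
  cderiv (fun t => \sum_(x <- s) f x t) t (\sum_(x <- s) z x).
Proof.
move=> fz; elim: s => [|x s ih].
  by rewrite big_nil; under eq_fun do rewrite big_nil; exact: cderiv_cst.
by rewrite big_cons; under eq_fun do rewrite big_cons; exact: cderivD.
Qed.

Lemma cderivN f t z : cderiv f t z -> cderiv (fun t => - f t) t (- z).
Proof. by move=> /(cderivZ (-1)); rewrite mulN1r; under eq_fun do rewrite mulN1r. Qed.

Lemma cderivB f g t z w : cderiv f t z -> cderiv g t w ->
  cderiv (fun t => f t - g t) t (z - w).
Proof. by move=> fz gw; apply: cderivD => //; exact: cderivN. Qed.

Lemma cderiv0_eq f t : 0 <= t -> (forall x, 0 <= x -> cderiv f x 0) -> f t = f 0.
Proof.
move=> t0 fd.
have := @derive0_eq _ (fun t => complex.Re (f t)) 0 t t0 (fun x xt => (fd x (proj1 (andP xt))).1).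
have := @derive0_eq _ (fun t => complex.Im (f t)) 0 t t0 (fun x xt => (fd x (proj1 (andP xt))).2).
by case: (f t) => a b; case: (f 0) => c d /= -> ->.
Qed.

(** The mean value bound is applied to the real and the imaginary part separately, hence the factor
    2. *)
Lemma cderiv_lip f (df : R -> C) (K a b : R) : a <= b -> 
  (forall t, a <= t <= b -> cderiv f t (df t)) ->
  (forall t, a <= t <= b -> Normc.normc (df t) <= K) ->
  Normc.normc (f b - f a) <= 2 * K * (b - a).
Proof.
move=> ab fd dK.
have Kd (x : R) : is_derive x 1 (fun t : R => K * t) K.
  by have := is_deriveZr K (is_derive_id x (1 : R)); rewrite mulr1.
apply: (le_trans (nm_le_ReIm _)); rewrite !raddfB.
have h1 := @derive_norm_le _ (fun t => complex.Re (f t)) _ (fun t => K * t) (fun _ => K) a b ab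
  (fun x xt => (fd x xt).1) (fun x _ => Kd x) (fun x xt => le_trans (Re_le_nm _) (dK x xt)).
have h2 := @derive_norm_le _ (fun t => complex.Im (f t)) _ (fun t => K * t) (fun _ => K) a b ab
  (fun x xt => (fd x xt).2) (fun x _ => Kd x) (fun x xt => le_trans (Im_le_nm _) (dK x xt)).
by apply: (le_trans (lerD h1 h2)); rewrite -mulrBr; lra.
Qed.

Lemma derive_vnorm2 (v : R -> 'I_3 -> C) (dv : 'I_3 -> C) t :
  (forall i, cderiv (fun t => v t i) t (dv i)) ->
  is_derive t 1 (fun t => vnorm2 (v t)) (2 * rdot (v t) dv).
Proof.
move=> vd; rewrite /vnorm2 /rdot mulr_sumr.
have h i : is_derive t 1 (fun t => Normc.normc (v t i) ^+ 2)
    (2 * complex.Re ((cj (v t i)) * dv i)).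
  have [d1 d2] := vd i.
  apply: (is_derive_ext (is_deriveD (is_deriveM d1 d1) (is_deriveM d2 d2))) => [x|].
    by rewrite nm_sqr !expr2 !fctE.
  by rewrite /GRing.scale/=; case: (v t i) (dv i) => a b [c d] /=; ring.
apply: (is_derive_ext (@is_derive_sum R R^o R^o 3 (fun i t => Normc.normc (v t i) ^+ 2) t 1
  (fun i => 2 * complex.Re ((cj (v t i)) * dv i)) h)) => // x.
by rewrite fct_sumE.
Qed.

End ComplexDerivative.


Section LipschitzBounded.
Context {R : realType} (I : Type).
Local Notation C := (complex R).
Implicit Types (f g : (I -> R) -> R) (F G : (I -> R) -> C) (x y : I -> R).

(* Distances are non-negative by hypothesis so that [I] may be empty. *)
Definition lip_bounded f := exists K : R, [/\ 0 <= K, forall x, `|f x| <= K &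
  forall x y (d : R), 0 <= d -> (forall i, `|x i - y i| <= d) ->
    `|f x - f y| <= K * d].

Definition clip_bounded F := lip_bounded (fun x => complex.Re (F x)) /\
  lip_bounded (fun x => complex.Im (F x)).

Lemma lip_bounded_ext f g : f =1 g -> lip_bounded f -> lip_bounded g.
Proof. by move=> /funext ->. Qed.

Lemma lip_bounded_cst (c : R) : lip_bounded (fun _ => c).
Proof.
exists `|c|; split => // x y d d0 xy; rewrite subrr normr0.
by rewrite mulr_ge0.
Qed.

Lemma lip_boundedD f g : lip_bounded f -> lip_bounded g ->
  lip_bounded (fun x => f x + g x).
Proof.
move=> [K [K0 fK fL]] [K' [K'0 gK gL]]; exists (K + K'); split => [|x|x y d d0 xy].
- exact: addr_ge0.
- by apply: (le_trans (ler_normD _ _)); exact: lerD.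
- rewrite mulrDl opprD addrACA; apply: (le_trans (ler_normD _ _)).
  by apply: lerD; [exact: fL|exact: gL].
Qed.

Lemma lip_boundedM f g : lip_bounded f -> lip_bounded g ->
  lip_bounded (fun x => f x * g x).
Proof.
move=> [K [K0 fK fL]] [K' [K'0 gK gL]]; exists (K * K' + (K * K' + K * K')).
have KK : 0 <= K * K' by exact: mulr_ge0.
split => [|x|x y d d0 xy].
- by rewrite !addr_ge0.
- rewrite normrM (@le_trans _ _ (K * K'))//; first exact: ler_pM.
  by rewrite lerDl addr_ge0.
- have -> : f x * g x - f y * g y = f x * (g x - g y) + (f x - f y) * g y by ring.
  apply: (le_trans (ler_normD _ _)); rewrite !normrM.
  apply: (@le_trans _ _ (K * (K' * d) + K * d * K')).
    by apply: lerD; apply: ler_pM => //; [exact: gL|exact: fL].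
  by have := mulr_ge0 KK d0; lra.
Qed.

Lemma lip_boundedN f : lip_bounded f -> lip_bounded (fun x => - f x).
Proof.
move=> /(lip_boundedM (lip_bounded_cst (-1))); apply: lip_bounded_ext => x.
by rewrite mulN1r.
Qed.

Lemma clip_boundedD F G : clip_bounded F -> clip_bounded G ->
  clip_bounded (fun x => F x + G x).
Proof.
move=> [F1 F2] [G1 G2]; split.
  by apply: lip_bounded_ext (lip_boundedD F1 G1) => x; rewrite raddfD.
by apply: lip_bounded_ext (lip_boundedD F2 G2) => x; rewrite raddfD.
Qed.

Lemma clip_boundedM F G : clip_bounded F -> clip_bounded G ->
  clip_bounded (fun x => F x * G x).
Proof.
move=> [F1 F2] [G1 G2]; split.
  apply: lip_bounded_ext (lip_boundedD (lip_boundedM F1 G1)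
    (lip_boundedN (lip_boundedM F2 G2))) => x.
  by case: (F x) (G x) => a b [c d].
apply: lip_bounded_ext (lip_boundedD (lip_boundedM F1 G2) (lip_boundedM F2 G1)) => x.
by case: (F x) (G x) => a b [c d] /=; ring.
Qed.

Lemma clip_bounded_cst (c : C) : clip_bounded (fun _ => c).
Proof. by split; exact: lip_bounded_cst. Qed.

Lemma clip_boundedN F : clip_bounded F -> clip_bounded (fun x => - F x).
Proof.
move=> [F1 F2]; split.
  by apply: lip_bounded_ext (lip_boundedN F1) => x; rewrite raddfN.
by apply: lip_bounded_ext (lip_boundedN F2) => x; rewrite raddfN.
Qed.

Lemma clip_bounded_cj F : clip_bounded F -> clip_bounded (fun x => (cj (F x))).
Proof.
move=> [F1 F2]; split.
  by apply: lip_bounded_ext F1 => x; case: (F x).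
by apply: lip_bounded_ext (lip_boundedN F2) => x; case: (F x).
Qed.

Lemma clip_bounded_sum (T : Type) (s : seq T) (F : T -> (I -> R) -> C) :
  (forall a, clip_bounded (F a)) -> clip_bounded (fun x => \sum_(a <- s) F a x).
Proof.
move=> hF; elim: s => [|a s ih].
  by under eq_fun do rewrite big_nil; exact: clip_bounded_cst.
by under eq_fun do rewrite big_cons; exact: clip_boundedD.
Qed.

Lemma lip_bounded_uniform (T : eqType) (s : seq T) (f : T -> (I -> R) -> R) :
  (forall a, lip_bounded (f a)) -> exists K : R, [/\ 0 <= K,
    forall a, a \in s -> forall x, `|f a x| <= K &
    forall a, a \in s -> forall x y (d : R), 0 <= d ->
      (forall i, `|x i - y i| <= d) -> `|f a x - f a y| <= K * d].
Proof.
move=> hf; elim: s => [|a s [K [K0 sK sL]]]; first by exists 0.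
have [K' [K'0 aK aL]] := hf a; exists (K + K'); split.
- exact: addr_ge0.
- move=> b; rewrite inE => /orP[/eqP->|bs] x.
    by rewrite (le_trans (aK x))// lerDr.
  by rewrite (le_trans (sK b bs x))// lerDl.
- move=> b; rewrite inE => /orP[/eqP->|bs] x y d d0 xy.
    by rewrite (le_trans (aL x y d d0 xy))// ler_wpM2r// lerDr.
  by rewrite (le_trans (sL b bs x y d d0 xy))// ler_wpM2r// lerDl.
Qed.

Definition clamp (M r : R) : R := Num.max (- M) (Num.min M r).

Lemma clamp_id M (r : R) : `|r| <= M -> clamp M r = r.
Proof.
by rewrite ler_norml => /andP[h1 h2]; rewrite /clamp (min_idPr h2) (max_idPr h1).
Qed.

Lemma lip_bounded_clamp M i : 0 <= M -> lip_bounded (fun x => clamp M (x i)).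
Proof.
move=> M0; exists (M + 1); split => [|x|x y d d0 xy].
- by rewrite addr_ge0.
- rewrite ler_norml /clamp; apply/andP; split.
    by rewrite le_max; apply/orP; left; lra.
  rewrite ge_max ge_min; apply/andP; split; first lra.
  by apply/orP; left; lra.
- apply: (@le_trans _ _ d); last by rewrite ler_peMl//; lra.
  apply: le_trans (xy i); rewrite /clamp; move: (x i) (y i) => a b.
  have [h1|/ltW h1] := leP M a; have [h2|/ltW h2] := leP M b;
  [have [h3|/ltW h3] := leP (- M) M; have [h4|/ltW h4] := leP (- M) M
  |have [h3|/ltW h3] := leP (- M) M; have [h4|/ltW h4] := leP (- M) b
  |have [h3|/ltW h3] := leP (- M) a; have [h4|/ltW h4] := leP (- M) M
  |have [h3|/ltW h3] := leP (- M) a; have [h4|/ltW h4] := leP (- M) b];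
  rewrite ?subrr ?normr0//; try (by rewrite ler_norml; apply/andP; split;
  have := ler_norm (a - b); have := ler_normr (a - b) (a - b); have := ler_norm (b - a); rewrite (distrC b a); lra).
Qed.

End LipschitzBounded.

(** * Galerkin truncations *)

Section Galerkin.
Context {R : realType}.
Local Notation C := (complex R).
Local Notation fnorm := (@freq_norm R).
Implicit Types (k l q : freq) (U V : freq -> 'I_3 -> C) (s : seq freq) (nu t : R).

Definition rhs nu s U k : 'I_3 -> C := fun i =>
  if k \in s then - (nu * sqnorm k)%:C * U k i - leray k (transport s U U k) i else 0.

(** A projection onto real divergence-free fields supported in [s]. Inserted before the right-hand
    side, it makes these constraints invariant under the flow with no appeal to uniqueness. *)
Definition symproj s U k : 'I_3 -> C := fun i =>
  if k \in s then leray k (fun j => (2^-1)%:C * (U k j + (cj (U (- k) j)))) i else 0.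

Definition clampU (M : R) U k : 'I_3 -> C := fun i =>
  clamp M (complex.Re (U k i)) +i* clamp M (complex.Im (U k i)).

Definition sym_seq s := forall k, (- k \in s) = (k \in s).

Lemma leray_cj k (v : 'I_3 -> C) i :
  leray (- k) (fun j => (cj (v j))) i = (cj (leray k v i)).
Proof.
rewrite /leray cjB !cjM cj_int cjR fdot_cj fdotN mxE rmorphN.
have -> : @sqnorm R (- k) = sqnorm k by rewrite -!sqr_fnorm fnormN.
by rewrite mulrN mulrNN.
Qed.

Lemma leray_ext k (v w : 'I_3 -> C) i : (forall j, v j = w j) -> leray k v i = leray k w i.
Proof. by move=> vw; rewrite (_ : v = w)//; apply/funext. Qed.

Lemma symproj_real s U : sym_seq s -> real_field (symproj s U).
Proof.
move=> ss k i; rewrite /symproj ss; case: ifP => _; last by rewrite cj0.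
rewrite -leray_cj; apply: leray_ext => j.
by rewrite opprK cjM cjD cjK cjR addrC.
Qed.

Lemma symproj_div s U : 0 \notin s -> div_free (symproj s U).
Proof.
move=> s0 k; have [ks|ks] := boolP (k \in s); rewrite /symproj; last first.
  by rewrite (negbTE ks) /fdot big1// => i _; rewrite mulr0.
rewrite ks; by apply: fdot_leray; apply: contraNN s0 => /eqP <-.
Qed.

Lemma leray_id k (v : 'I_3 -> C) i : fdot k v = 0 -> leray k v i = v i.
Proof. by move=> kv; rewrite /leray kv !mulr0 subr0. Qed.

Lemma symproj_id s U : real_field U -> div_free U -> supported s U ->
  symproj s U = U.
Proof.
move=> rU dU sU; apply/funext => k; apply/funext => i; rewrite /symproj.
case: ifPn => [ks|/sU ->//].
have e j : (2^-1)%:C * (U k j + (cj (U (- k) j))) = U k j.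
  rewrite rU cjK; case: (U k j) => a b; apply/eqP; rewrite eq_complex /=.
  by apply/andP; split; apply/eqP; field.
rewrite (leray_ext k i e); apply: leray_id; exact: dU.
Qed.

Lemma fdot_rhs nu s U k : 0 \notin s -> div_free U -> fdot k (rhs nu s U k) = 0.
Proof.
move=> s0 dU; have [ks|ks] := boolP (k \in s); rewrite /rhs; last first.
  by rewrite (negbTE ks) /fdot big1// => i _; rewrite mulr0.
rewrite ks; have k0 : k != 0 by apply: contraNN s0 => /eqP <-.
rewrite /fdot; under eq_bigr do rewrite mulrBr mulrCA.
by rewrite sumrB -mulr_sumr -/(fdot k (U k)) -/(fdot k (leray k _)) fdot_leray// dU mulr0 subr0.
Qed.

Lemma sum_opp (V : nmodType) s (f : freq -> V) : uniq s -> sym_seq s ->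
  \sum_(k <- s) f (- k) = \sum_(k <- s) f k.
Proof.
move=> us ss; rewrite -(big_map -%R predT f); apply: perm_big; apply: uniq_perm => //.
  by rewrite map_inj_uniq//; exact: oppr_inj.
move=> k; apply/mapP/idP => [[l ls ->]|ks]; first by rewrite ss.
by exists (- k); rewrite ?ss ?opprK.
Qed.

Lemma transport_real s U V k i : uniq s -> sym_seq s -> real_field U -> real_field V ->
  transport s U V (- k) i = (cj (transport s U V k i)).
Proof.
move=> us ss rU rV; rewrite /transport cj_sum -(sum_opp _ us ss); apply: eq_bigr => l _.
rewrite /transport_term !cjM cj_i fdotN rV mulrN mulNr; rewrite !mulNr; congr (- (_ * _ * _)).
rewrite fdot_cj; congr (fdot l _); apply/funext => j.
by rewrite -rU opprB opprK addrC.
Qed.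

Lemma rhs_real nu s U : uniq s -> sym_seq s -> real_field U -> real_field (rhs nu s U).
Proof.
move=> us ss rU k i; rewrite /rhs ss; case: ifP => _; last by rewrite cj0.
rewrite cjB cjM cjN cjR rU.
have -> : @sqnorm R (- k) = sqnorm k by rewrite -!sqr_fnorm fnormN.
by rewrite -leray_cj; congr (_ - _); apply: leray_ext => j; rewrite transport_real.
Qed.

Local Notation I := (freq * 'I_3 * bool)%type.

Definition state_field (x : I -> R) k : 'I_3 -> C := fun i => x (k, i, false) +i* x (k, i, true).

Definition field_state U : I -> R := fun a =>
  if a.2 then complex.Im (U a.1.1 a.1.2) else complex.Re (U a.1.1 a.1.2).

Definition vector_rhs M nu s (x : I -> R) : I -> R :=
  field_state (rhs nu s (symproj s (clampU M (state_field x)))).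

Lemma clip_bounded_leray k (F : (I -> R) -> 'I_3 -> C) i :
  (forall j, clip_bounded (fun x => F x j)) ->
  clip_bounded (fun x => leray k (F x) i).
Proof.
move=> hF; apply: clip_boundedD => //; apply: clip_boundedN.
apply: clip_boundedM; first exact: clip_bounded_cst.
apply: clip_boundedM; first exact: clip_bounded_cst.
by apply: clip_bounded_sum => j; apply: clip_boundedM; [exact: clip_bounded_cst|].
Qed.

Lemma clip_bounded_symproj M s k i : 0 <= M ->
  clip_bounded (fun x => symproj s (clampU M (state_field x)) k i).
Proof.
move=> M0; rewrite /symproj.
have [ks|ks] := boolP (k \in s); last exact: clip_bounded_cst.
have c l j : clip_bounded (fun x => clampU M (state_field x) l j).
  by split; exact: lip_bounded_clamp.
apply: clip_bounded_leray => j; apply: clip_boundedM; first exact: clip_bounded_cst.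
by apply: clip_boundedD => //; exact: clip_bounded_cj.
Qed.

(** After the clamp every coordinate is a polynomial in bounded Lipschitz functions, and these form
    an algebra. *)
Lemma lip_bounded_rhs M nu s a : 0 <= M -> lip_bounded (fun x => vector_rhs M nu s x a).
Proof.
move=> M0; case: a => [[k i] b].
have : clip_bounded (fun x => rhs nu s (symproj s (clampU M (state_field x))) k i).
  rewrite /rhs; have [ks|ks] := boolP (k \in s); last exact: clip_bounded_cst.
  have p l j := @clip_bounded_symproj M s l j M0.
  apply: clip_boundedD.
    by apply: clip_boundedM; [exact: clip_bounded_cst|].
  apply: clip_boundedN; apply: clip_bounded_leray => j.
  apply: clip_bounded_sum => l; apply: clip_boundedM => //.
  apply: clip_boundedM; first exact: clip_bounded_cst.
  by apply: clip_bounded_sum => j'; apply: clip_boundedM; [exact: clip_bounded_cst|].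
by move=> [h1 h2]; case: b.
Qed.

Lemma galerkin_clamped M nu s (A : freq -> 'I_3 -> C) : 0 <= M ->
  uniq s -> sym_seq s -> 0 \notin s -> real_field A -> div_free A ->
  exists U : R -> freq -> 'I_3 -> C,
  [/\ forall k i, U 0 k i = if k \in s then A k i else 0,
      forall t, 0 <= t -> [/\ real_field (U t), div_free (U t) & supported s (U t)] &
      forall t k i, 0 <= t ->
        cderiv (fun t => U t k i) t (rhs nu s (symproj s (clampU M (U t))) k i)].
Proof.
move=> M0 us ss s0 rA dA.
pose idx : seq I := [seq (a, b) | a <- [seq (k, i) | k <- s, i <- enum 'I_3], b <- [:: false; true]].
have [K [K0 hK hL]] := lip_bounded_uniform idx (fun a => lip_bounded_rhs nu s a M0).
pose x0 : I -> R := field_state (fun k i => if k \in s then A k i else 0).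
have idxP a : a \notin idx -> forall x, vector_rhs M nu s x a = 0.
  case: a => [[k i] b] ai x; suff ks : k \in s = false.
    by rewrite /vector_rhs /field_state /rhs/= ks; case: b {ai}.
  apply: contraNF ai => ks; apply/allpairsP; exists ((k, i), b); split => //; last by case: b.
  by apply/allpairsP; exists (k, i); split => //; rewrite mem_enum.
(* All but finitely many coordinates of the field vanish identically, so one constant serves for all
   of them. *)
have Fb x a : `|vector_rhs M nu s x a| <= K.
  have [ai|/idxP ->] := boolP (a \in idx); first exact: hK.
  by rewrite normr0.
have Fl (x y : I -> R) (d : R) : (forall a, `|x a - y a| <= d) ->
    forall a, `|vector_rhs M nu s x a - vector_rhs M nu s y a| <= (K + 1) * d.
  move=> xy a; have d0 : 0 <= d by exact: le_trans (normr_ge0 _) (xy a).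
  have [ai|ai] := boolP (a \in idx); last first.
    by rewrite !idxP// subrr normr0 mulr_ge0// addr_ge0.
  by apply: (le_trans (hL a ai x y d d0 xy)); rewrite ler_wpM2r// lerDl.
have [|u [u0 uP]] := @picard R I (vector_rhs M nu s) (K + 1) K x0 _ Fb Fl.
  by rewrite ltr_wpDl.
pose U t := state_field (u t).
have UP t k i : 0 <= t ->
    cderiv (fun t => U t k i) t (rhs nu s (symproj s (clampU M (U t))) k i).
  by move=> t0; split; [exact: (uP (k, i, false))|exact: (uP (k, i, true))].
have U0 k i : U 0 k i = if k \in s then A k i else 0.
  by rewrite /U /state_field !u0 /x0 /field_state/=; case: (if _ then _ else _).
have dr t : div_free (symproj s (clampU M (U t))) by exact: symproj_div.
have rr t : real_field (symproj s (clampU M (U t))) by exact: symproj_real.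
exists U; split => // t t0; split.
- move=> k i.
  (* The right-hand side is evaluated at a projected field, so the defect of each constraint has
     zero derivative and keeps its initial value 0. *)
  have h x : 0 <= x -> cderiv (fun t => U t (- k) i - (cj (U t k i))) x 0.
    move=> x0'; have := cderivB (UP x (- k) i x0') (cderiv_cj (UP x k i x0')).
    by rewrite rhs_real// subrr.
  have := cderiv0_eq t0 h; rewrite !U0 ss; case: ifP => _; rewrite ?rA ?cj0 subrr.
    by move=> /eqP; rewrite subr_eq0 => /eqP.
  by move=> /eqP; rewrite subr_eq0 => /eqP.
- move=> k.
  have h x : 0 <= x -> cderiv (fun t => fdot k (U t k)) x 0.
    move=> x0'; have := @cderiv_sum R _ (index_enum 'I_3) (fun i t => (k ord0 i)%:~R * U t k i) x
      (fun i => (k ord0 i)%:~R * rhs nu s (symproj s (clampU M (U x))) k i)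
      (fun i => cderivZ _ (UP x k i x0')).
    by rewrite -/(fdot k _) fdot_rhs.
  rewrite (cderiv0_eq t0 h) /fdot; under eq_bigr do rewrite U0.
  by case: (k \in s); [exact: dA|rewrite big1// => i _; rewrite mulr0].
- move=> k ks i.
  have h x : 0 <= x -> cderiv (fun t => U t k i) x 0.
    by move=> x0'; have := UP x k i x0'; rewrite /rhs (negbTE ks).
  by rewrite (cderiv0_eq t0 h) U0 (negbTE ks).
Qed.

End Galerkin.

(** * The energy estimate in the shrinking weight *)

Section Energy.
Context {R : realType}.
Local Notation C := (complex R).
Local Notation fnorm := (@freq_norm R).
Implicit Types (k l q : freq) (U V : freq -> 'I_3 -> C) (s : seq freq) (t : R).

Lemma is_derive_sumr (T : Type) (r : seq T) (f : T -> R -> R) (df : T -> R) (t : R) :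
  (forall x, is_derive t 1 (f x) (df x)) ->
  is_derive t 1 (fun t => \sum_(x <- r) f x t) (\sum_(x <- r) df x).
Proof.
move=> fd; elim: r => [|x r ih].
  apply: (is_derive_ext (is_derive_cst (0 : R) t (1 : R))) => [y|]; by rewrite big_nil.
apply: (is_derive_ext (is_deriveD (fd x) ih)) => [y|]; by rewrite big_cons.
Qed.

Definition genergy s m th tau U : R :=
  \sum_(k <- s) gweight m th tau k ^+ 2 * vnorm2 (U k).

Lemma genergy_ge0 s m th tau U : 0 <= genergy s m th tau U.
Proof. by apply: sumr_ge0 => k _; rewrite mulr_ge0 ?sqr_ge0// vnorm2_ge0. Qed.

Lemma gweight_ge1 m (th tau : R) k : 0 <= tau -> k != 0 -> 1 <= gweight m th tau k.
Proof.
move=> t0 k0; rewrite /gweight mulr_ege1 ?exprn_ege1 ?fnorm_ge1//.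
by rewrite -expR0 ler_expR mulr_ge0// powR_ge0.
Qed.

(** At radius [tau - lam * t] the squared weight is a pure exponential in [t]. Its logarithmic
    derivative -2 lam |k|^th is a damping that does not depend on the viscosity. *)
Lemma derive_gweight m (th tau lam : R) k t :
  is_derive t 1 (fun t => gweight m th (tau - lam * t) k ^+ 2)
    (- 2 * lam * fnorm k `^ th * gweight m th (tau - lam * t) k ^+ 2).
Proof.
pose p := fnorm k `^ th.
pose a := (fnorm k ^+ m) ^+ 2 * expR (2 * tau * p).
have e x : gweight m th (tau - lam * x) k ^+ 2 = a * expR (- 2 * lam * p * x).
  rewrite /gweight exprMn -/p /a -mulrA; congr (_ * _).
  by rewrite -expRD expr2 -expRD; congr expR; ring.
apply: (is_derive_ext (is_deriveZr a (is_derive_expM (- 2 * lam * p) t))) => [x|].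
  by rewrite e.
by rewrite e mulrCA mulrA.
Qed.

Lemma vnorm2_le_genergy s m th tau U k : 0 \notin s -> 0 <= tau ->
  supported s U -> vnorm2 (U k) <= genergy s m th tau U.
Proof.
move=> s0 t0 sU; have [ks|ks] := boolP (k \in s); last first.
  rewrite (_ : vnorm2 _ = 0) ?genergy_ge0// /vnorm2 big1// => i _.
  by rewrite sU// Normc.normc0 expr0n.
have k0 : k != 0 by apply: contraNN s0 => /eqP <-.
apply: (@le_trans _ _ (gweight m th tau k ^+ 2 * vnorm2 (U k))).
  by rewrite ler_peMl ?vnorm2_ge0// exprn_ege1// gweight_ge1.
apply: (@ler_term_sum R _ s (fun k => gweight m th tau k ^+ 2 * vnorm2 (U k))) => // q.
by rewrite mulr_ge0 ?sqr_ge0// vnorm2_ge0.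
Qed.

Lemma vnorm_le_genergy s m th tau U k (A : R) : 0 \notin s -> 0 <= tau -> 0 <= A ->
  supported s U -> genergy s m th tau U <= A ^+ 2 -> vnorm (U k) <= A.
Proof.
move=> s0 t0 A0 sU h; rewrite -ler_sqr ?nnegrE ?vnorm_ge0// sqr_vnorm.
by apply: le_trans h; exact: vnorm2_le_genergy.
Qed.

Lemma clampU_id (M : R) U : (forall k i, Normc.normc (U k i) <= M) -> clampU M U = U.
Proof.
move=> UM; apply/funext => k; apply/funext => i; have := UM k i; rewrite /clampU => h.
rewrite !clamp_id; last 2 first.
- exact: le_trans (Im_le_nm _) h.
- exact: le_trans (Re_le_nm _) h.
by case: (U k i).
Qed.

Lemma rdot_rhs nu s U k : div_free U -> k \in s ->
  rdot (U k) (rhs nu s U k) = - (nu * sqnorm k * vnorm2 (U k)) - rdot (U k) (transport s U U k).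
Proof.
move=> dU ks.
have -> : rhs nu s U k = fun i => (- (nu * sqnorm k))%:C * U k i + - leray k (transport s U U k) i.
  by apply/funext => i; rewrite /rhs ks raddfN.
by rewrite rdotD rdotr rdotN rdot_leray// rdotvv mulNr.
Qed.

(** The viscous term has a sign and is dropped, which makes the estimate uniform in [nu]. The
    transport term is at most [transport_const] times the root of the energy times the sum [H], so
    the last hypothesis lets the damping -2 lam H dominate it. *)
Lemma energy_dissipation (nu : R) s m (th tau lam : R) U : 0 <= nu ->
  uniq s -> 0 \notin s -> (8 <= m)%N -> 0 < th -> th <= 1 -> 0 <= tau -> tau <= 1 ->
  real_field U -> div_free U -> supported s U ->
  @transport_const R m * Num.sqrt (genergy s m th tau U) <= lam ->
  \sum_(k <- s) (gweight m th tau k ^+ 2 * (2 * rdot (U k) (rhs nu s U k)) +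
    vnorm2 (U k) * (- 2 * lam * fnorm k `^ th * gweight m th tau k ^+ 2)) <= 0.
Proof.
move=> nu0 us s0 m8 th0 th1 t0 t1 rU dU sU hlam.
pose H := \sum_(k <- s) fnorm k `^ th * gweight m th tau k ^+ 2 * vnorm2 (U k).
have H0 : 0 <= H.
  apply: sumr_ge0 => k _.
  exact: mulr_ge0 (mulr_ge0 (powR_ge0 _ _) (sqr_ge0 _)) (vnorm2_ge0 _).
have tw := transport_weighted us s0 m8 th0 th1 t0 t1 rU dU sU.
rewrite -/H -/(genergy s m th tau U) in tw.
set Q := \sum_(k <- s) _ in tw.
apply: (@le_trans _ _ (- 2 * Q - 2 * lam * H)).
  rewrite /Q /H !mulr_sumr -sumrB big_seq [leRHS]big_seq; apply: ler_sum => k ks.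
  rewrite rdot_rhs//.
  have n0 : 0 <= gweight m th tau k ^+ 2 * (nu * sqnorm k * vnorm2 (U k)).
    exact: mulr_ge0 (sqr_ge0 _) (mulr_ge0 (mulr_ge0 nu0 (sqnorm_ge0 _)) (vnorm2_ge0 _)).
  move: n0; move: (nu * sqnorm k) (gweight m th tau k ^+ 2) (rdot (U k) (transport s U U k)) (vnorm2 (U k)) (fnorm k `^ th) => b a c d e n0.
  rewrite -subr_ge0; have -> : - 2 * (a * c) - 2 * lam * (e * a * d) - (a * (2 * (- (b * d) - c)) + d * (- 2 * lam * e * a)) = 2 * (a * (b * d)) by ring.
  exact: mulr_ge0.
have h1 : - Q <= lam * H.
  apply: (le_trans (ler_norm _)); rewrite normrN; apply: (le_trans tw).
  by rewrite ler_wpM2r.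
lra.
Qed.

Lemma galerkin (A0 nu lam T th tau : R) (m : nat) s (A : freq -> 'I_3 -> C) :
  0 <= A0 -> 0 <= nu -> (8 <= m)%N -> 0 < th -> th <= 1 -> tau <= 1 ->
  0 <= lam -> 0 <= tau - lam * T -> @transport_const R m * (A0 + 1) <= lam ->
  uniq s -> sym_seq s -> 0 \notin s -> real_field A -> div_free A ->
  genergy s m th tau A <= A0 ^+ 2 ->
  exists U : R -> freq -> 'I_3 -> C,
  [/\ forall k i, U 0 k i = if k \in s then A k i else 0,
      forall t, 0 <= t -> [/\ real_field (U t), div_free (U t) & supported s (U t)],
      forall t, 0 <= t <= T -> genergy s m th (tau - lam * t) (U t) <= A0 ^+ 2 &
      forall t k i, 0 <= t <= T ->
        cderiv (fun t => U t k i) t (rhs nu s (U t) k i)].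
Proof.
move=> A00 nu0 m8 th0 th1 tau1 lam0 tauT hlam us ss s0 rA dA hA.
have M0 : 0 <= A0 + 1 by rewrite addr_ge0.
have [U [U0 UP Ud]] := galerkin_clamped nu M0 us ss s0 rA dA.
have tauP t : 0 <= t <= T -> 0 <= tau - lam * t /\ tau - lam * t <= 1.
  move=> /andP[t0 tT]; have := ler_wpM2l lam0 tT; have := mulr_ge0 lam0 t0; lra.
pose E t := genergy s m th (tau - lam * t) (U t).
(* Below the energy (A0 + 1)^2 all coefficients are at most A0 + 1, the level of the clamp, so
   neither the clamp nor the projection changes the field. *)
have unclamp t : 0 <= t <= T -> E t <= (A0 + 1) ^+ 2 ->
    symproj s (clampU (A0 + 1) (U t)) = U t.
  move=> tT Et; have t0 := proj1 (andP tT); have [rU dU sU] := UP t t0.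
  have [p0 _] := tauP t tT.
  rewrite clampU_id ?symproj_id// => k i; apply: (le_trans (nm_le_vnorm _ _)).
  exact: vnorm_le_genergy Et.
pose dU t k := rhs nu s (symproj s (clampU (A0 + 1) (U t))) k.
pose dE t := \sum_(k <- s) (gweight m th (tau - lam * t) k ^+ 2 * (2 * rdot (U t k) (dU t k)) +
    vnorm2 (U t k) * (- 2 * lam * fnorm k `^ th * gweight m th (tau - lam * t) k ^+ 2)).
have Ed t : 0 <= t <= T -> is_derive t 1 E (dE t).
  move=> /andP[t0 _]; apply: is_derive_sumr => k.
  apply: (is_derive_ext (is_deriveM (derive_gweight m th tau lam k t)
    (derive_vnorm2 (fun i => Ud t k i t0)))) => //.
(* The barrier sits at A0^2 with room up to (A0 + 1)^2: in that range the clamp is inactive and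
   [lam] dominates, so the energy does not increase. *)
have bound : forall t, 0 <= t <= T -> E t <= A0 ^+ 2.
  apply: (@derive_barrier _ E dE (A0 ^+ 2) ((A0 + 1) ^+ 2)) => //.
  - rewrite /E mulr0 subr0; apply: le_trans hA; rewrite le_eqVlt; apply/orP; left; apply/eqP.
    rewrite /genergy big_seq [RHS]big_seq; apply: eq_bigr => k ks.
    by congr (_ * _); apply: eq_bigr => i _; rewrite U0 ks.
  - nra.
  - move=> t tT Et; have t0 := proj1 (andP tT); have [rU dU' sU] := UP t t0.
    have [p0 p1] := tauP t tT.
    rewrite /dE /dU (unclamp t tT Et); apply: energy_dissipation => //.
    apply: le_trans hlam; rewrite ler_wpM2l//.
      by rewrite /transport_const !mulr_ge0// addr_ge0// mulr_ge0// exprn_ge0.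
    by rewrite -(ger0_norm M0) -sqrtr_sqr ler_sqrt ?sqr_ge0.
exists U; split => // t k i tT.
have := Ud t k i (proj1 (andP tT)); rewrite unclamp//.
apply: (le_trans (bound t tT)); nra.
Qed.

End Energy.

(** * Stability of the Galerkin solutions *)

Section Stability.
Context {R : realType}.
Local Notation C := (complex R).
Local Notation fnorm := (@freq_norm R).
Implicit Types (k l q : freq) (U V : freq -> 'I_3 -> C) (s : seq freq) (t : R).

Lemma vnorm_supported s U k : supported s U -> k \notin s -> vnorm (U k) = 0.
Proof. by move=> sU ks; apply: vnorm0 => i; exact: sU. Qed.

(** Three of the [m] powers of |k| pay for the passage to l^1; the exponential weight is kept
    whole. *)
Lemma l1_bound s m th (tau : R) U (A0 : R) j : (j + 3 <= m)%N ->
  uniq s -> 0 \notin s -> 0 <= tau -> 0 <= A0 -> genergy s m th tau U <= A0 ^+ 2 ->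
  \sum_(k <- s) fnorm k ^+ j * expR (tau * fnorm k `^ th) * vnorm (U k) <= 40 * A0.
Proof.
move=> jm us s0 t0 A00 hE.
have x0 k : 0 <= fnorm k by exact: fnorm_ge0.
apply: (le_trans (sum_le_sqrt6 (f := fun k => fnorm k ^+ j * expR (tau * fnorm k `^ th) * vnorm (U k)) us s0 _)).
  by move=> k; rewrite mulr_ge0 ?vnorm_ge0// mulr_ge0 ?expR_ge0// exprn_ge0.
rewrite ler_wpM2l// -[leRHS](ger0_norm A00) -sqrtr_sqr ler_sqrt ?sqr_ge0//.
apply: le_trans hE; rewrite /genergy big_seq [leRHS]big_seq; apply: ler_sum => k ks.
have k1 : 1 <= fnorm k by apply: fnorm_ge1; apply: contraNN s0 => /eqP <-.
rewrite -sqr_vnorm -exprMn ler_sqr ?nnegrE; last 2 first.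
- by rewrite mulr_ge0 ?exprn_ge0// mulr_ge0 ?vnorm_ge0// mulr_ge0 ?expR_ge0// exprn_ge0.
- by rewrite mulr_ge0 ?vnorm_ge0 ?gweight_ge0.
rewrite mulrA ler_wpM2r ?vnorm_ge0// mulrA /gweight ler_wpM2r ?expR_ge0//.
by rewrite -exprD addnC ler_weXn2l.
Qed.

Lemma l1_bound0 s m th (tau : R) U (A0 : R) j : (j + 3 <= m)%N ->
  uniq s -> 0 \notin s -> 0 <= tau -> 0 <= A0 -> genergy s m th tau U <= A0 ^+ 2 ->
  \sum_(k <- s) fnorm k ^+ j * vnorm (U k) <= 40 * A0.
Proof.
move=> jm us s0 t0 A00 hE; apply: le_trans (l1_bound jm us s0 t0 A00 hE).
apply: ler_sum => k _; rewrite ler_wpM2r ?vnorm_ge0// ler_peMr ?exprn_ge0 ?fnorm_ge0//.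
by rewrite -expR0 ler_expR mulr_ge0// powR_ge0.
Qed.

Lemma vnorm_transport_le s U V k (A B : R) : 0 <= A ->
  (forall l, vnorm (U l) <= A) -> \sum_(l <- s) fnorm l * vnorm (V l) <= B ->
  vnorm (transport s U V k) <= 27 * (A * B).
Proof.
move=> A0 hA hB; rewrite (_ : 27 = 3 * 9); last by ring.
rewrite -mulrA; apply: vnorm_le => i; apply: (le_trans (nm_sum _ _ _)).
apply: (@le_trans _ _ (9 * (A * \sum_(l <- s) fnorm l * vnorm (V l)))); last first.
  by rewrite ler_wpM2l// ler_wpM2l.
rewrite !mulr_sumr; apply: ler_sum => l _.
apply: (le_trans (nm_le_vnorm _ _)); apply: (le_trans (vnorm_transport_term _ _ _ _)).
rewrite ler_wpM2l// -mulrA mulrCA ler_wpM2r ?hA// mulr_ge0 ?fnorm_ge0 ?vnorm_ge0//.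
Qed.

Lemma transport_split s U1 U2 k i :
  transport s U2 U2 k i =
  transport s U2 (fun l j => U2 l j - U1 l j) k i +
  transport s (fun l j => U2 l j - U1 l j) U1 k i + transport s U1 U1 k i.
Proof.
rewrite -!big_split/=; apply: eq_bigr => l _; rewrite /transport_term.
have -> : fdot l (fun j => U2 (k - l) j - U1 (k - l) j) = fdot l (U2 (k - l)) - fdot l (U1 (k - l)).
  by rewrite /fdot -sumrB; apply: eq_bigr => j _; rewrite mulrBr.
by ring.
Qed.

Lemma transport_sub s1 s2 U V k i : uniq s1 -> uniq s2 -> {subset s1 <= s2} ->
  supported s1 V -> transport s1 U V k i = transport s2 U V k i.
Proof.
move=> us1 us2 s12 sV.
rewrite /transport (@sum_shift _ _ s1 s2 (fun l => transport_term U V k l i) 0)//.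
- by apply: eq_bigr => l _; rewrite subr0.
- by move=> l ls; rewrite /transport_term sV// mulr0.
- by move=> l ls; rewrite addr0; exact: s12.
Qed.

(** [v] is divergence free, so the Leray projector disappears. At frequencies of [s2] outside [s1]
    the field [U1] satisfies no equation, and its own transport term remains as a residual. *)
Lemma rdot_rhs_diff (nu1 nu2 : R) s1 s2 U1 U2 k (v := fun k i => U2 k i - U1 k i) :
  uniq s1 -> uniq s2 -> {subset s1 <= s2} -> supported s1 U1 -> k \in s2 ->
  div_free U1 -> div_free U2 ->
  rdot (v k) (fun i => rhs nu2 s2 U2 k i - rhs nu1 s1 U1 k i) =
  - (nu2 * sqnorm k * vnorm2 (v k)) - (nu2 - nu1) * sqnorm k * rdot (v k) (U1 k)
  - rdot (v k) (transport s2 U2 v k) - rdot (v k) (transport s2 v U1 k)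
  - (if k \in s1 then 0 else rdot (v k) (transport s2 U1 U1 k)).
Proof.
move=> us1 us2 s12 sU1 ks2 d1 d2.
have dv : fdot k (v k) = 0.
  rewrite /v /fdot; under eq_bigr do rewrite mulrBr.
  by rewrite sumrB -/(fdot k (U1 k)) -/(fdot k (U2 k)) d1 d2 subr0.
have e : (fun i => rhs nu2 s2 U2 k i - rhs nu1 s1 U1 k i) = fun i =>
    (- (nu2 * sqnorm k))%:C * v k i + ((- ((nu2 - nu1) * sqnorm k))%:C * U1 k i +
    (- leray k (transport s2 U2 U2 k) i +
     (if k \in s1 then leray k (transport s2 U1 U1 k) i else 0))).
  apply/funext => i; rewrite /rhs ks2; case: ifPn => ks1; last first.
    rewrite subr0 addr0 /v (sU1 k ks1) subr0 mulr0 add0r raddfN//.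
  rewrite (@leray_ext _ _ _ _ _ (fun j => transport_sub U1 k j us1 us2 s12 sU1)).
  rewrite !rmorphN !rmorphM rmorphB/= /v; ring.
rewrite e rdotD rdotD rdotD !rdotr rdotvv rdotN rdot_leray//.
have -> : rdot (v k) (transport s2 U2 U2 k) =
    rdot (v k) (transport s2 U2 v k) + rdot (v k) (transport s2 v U1 k) +
    rdot (v k) (transport s2 U1 U1 k).
  by rewrite -!rdotD; congr rdot; apply/funext => i; rewrite (transport_split s2 U1 U2).
case: ifP => _.
  rewrite rdot_leray//; ring.
rewrite (_ : rdot (v k) (fun=> 0) = 0); last first.
  by rewrite /rdot big1// => i _; rewrite mulr0.
ring.
Qed.

(** Transport of [v] by [U2] is orthogonal to [v]; transport of [U1] by [v] costs the l^1 norm of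
    |k| U1. The powers of |k| in the energies pay for the two derivatives of the viscosity
    difference and for the factor 1/(n+1) gained from the truncation. *)
Lemma stability_step (nu1 nu2 : R) n s2 m th (tau A0 : R) U1 U2
    (v := fun k i => U2 k i - U1 k i) :
  let s1 := box n.+1 in
  (8 <= m)%N -> 0 <= tau -> 0 <= A0 -> 0 <= nu2 -> uniq s2 -> 0 \notin s2 ->
  {subset s1 <= s2} ->
  real_field U1 -> div_free U1 -> supported s1 U1 -> genergy s1 m th tau U1 <= A0 ^+ 2 ->
  real_field U2 -> div_free U2 -> supported s2 U2 -> genergy s2 m th tau U2 <= A0 ^+ 2 ->
  \sum_(k <- s2) 2 * rdot (v k) (fun i => rhs nu2 s2 U2 k i - rhs nu1 s1 U1 k i) <=
  (1 + 2 * (27 * (40 * A0))) * \sum_(k <- s2) vnorm2 (v k) +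
  (9 * (nu2 - nu1) ^+ 2 * A0 ^+ 2 + 2 * (3 * (27 * (A0 * (40 * A0))) * (40 * A0) / n.+1%:R)).
Proof.
move=> s1 m8 t0 A00 nu20 us2 s20 s12 r1 d1 sU1 E1 r2 d2 sU2 E2.
have us1 : uniq s1 := uniq_box _. have s10 : 0 \notin s1 := zero_notin_box _.
have sv : supported s2 v.
  move=> k ks i; rewrite /v (sU2 k ks) (sU1 k) ?subrr//.
  by apply: contraNN ks; exact: s12.
have l1U1 : \sum_(k <- s1) fnorm k ^+ 1 * vnorm (U1 k) <= 40 * A0.
  by apply: (l1_bound0 _ us1 s10 t0 A00 E1); exact: leq_trans m8.
have l1U2 : \sum_(k <- s2) fnorm k ^+ 1 * vnorm (U2 k) <= 40 * A0.
  by apply: (l1_bound0 _ us2 s20 t0 A00 E2); exact: leq_trans m8.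
have al0 U k : 0 <= vnorm (U k) by exact: vnorm_ge0.
have x0 k : 0 <= fnorm k by exact: fnorm_ge0.
have l1U1' : \sum_(k <- s2) fnorm k * vnorm (U1 k) <= 40 * A0.
  apply: le_trans l1U1.
  apply: (@ler_sum_inj R _ s2 s1 id (fun k => fnorm k * vnorm (U1 k))) => // k.
    by rewrite mulr_ge0.
  by move=> /(vnorm_supported sU1) ->; rewrite mulr0.
have hA1 k : vnorm (U1 k) <= A0 by exact: vnorm_le_genergy E1.
have N0 : 0 < n.+1%:R :> R by [].
pose S := \sum_(k <- s2) vnorm2 (v k).
pose Q k := rdot (v k) (transport s2 v U1 k).
pose W k := if k \in s1 then 0 else rdot (v k) (transport s2 U1 U1 k).
have QS : - \sum_(k <- s2) Q k <= 27 * (40 * A0) * S.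
  apply: (le_trans (ler_norm _)); rewrite normrN.
  apply: (@le_trans _ _ (27 * \sum_(k <- s2) \sum_(l <- s2)
     vnorm (v k) * vnorm (v (k - l)) * (fnorm l * vnorm (U1 l)))).
    rewrite mulr_sumr; apply: (le_trans (ler_norm_sum _ _ _)); apply: ler_sum => k _.
    rewrite /Q rdot_sum mulr_sumr; apply: (le_trans (ler_norm_sum _ _ _)).
    apply: ler_sum => l _; apply: (le_trans (rdot_transport_le _ _ _ _ _)).
    rewrite ler_wpM2l// le_eqVlt; apply/orP; left; apply/eqP; ring.
  rewrite -mulrA ler_wpM2l//.
  apply: (@le_trans _ _ ((\sum_(l <- s2) fnorm l * vnorm (U1 l)) * \sum_(k <- s2) vnorm (v k) ^+ 2)).
    apply: young_conv => //.
    - by move=> k; rewrite mulr_ge0.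
    - by move=> k; exact: vnorm_supported.
  under [X in _ * X <= _]eq_bigr do rewrite sqr_vnorm.
  by rewrite ler_wpM2r// sumr_ge0// => k _; exact: vnorm2_ge0.
have WS : - \sum_(k <- s2) W k <= 3 * (27 * (A0 * (40 * A0))) * (40 * A0) / n.+1%:R.
  apply: (le_trans (ler_norm _)); rewrite normrN.
  apply: (le_trans (ler_norm_sum _ _ _)).
  apply: (@le_trans _ _ (\sum_(k <- s2) (3 * (27 * (A0 * (40 * A0))) / n.+1%:R) * (fnorm k ^+ 1 * vnorm (U2 k)))).
    rewrite big_seq [leRHS]big_seq; apply: ler_sum => k ks; rewrite /W; case: ifPn => ks1.
      rewrite normr0; apply: mulr_ge0; last exact: mulr_ge0 (exprn_ge0 _ (x0 k)) (vnorm_ge0 _).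
      by apply: divr_ge0 => //; rewrite mulr_ge0// mulr_ge0// mulr_ge0// mulr_ge0.
    apply: (le_trans (rdot_le _ _)).
    have k0 : k != 0 by apply: contraNN s20 => /eqP <-.
    have hx := @fnorm_notin_box R _ _ k0 ks1.
    (* Outside the smaller box [v] is [U2], and 1 < |k| / (n + 1) trades one power of |k| for decay
       in [n]. *)
    have -> : vnorm (v k) = vnorm (U2 k).
      by congr vnorm; apply/funext => i; rewrite /v (sU1 k ks1) subr0.
    have hT := vnorm_transport_le k A00 hA1 l1U1'.
    have h1 : vnorm (U2 k) <= fnorm k * vnorm (U2 k) / n.+1%:R.
      by rewrite ler_pdivlMr// mulrC ler_wpM2r// ltW.
    have := ler_pM (al0 _ _) (vnorm_ge0 _) h1 hT.
    move: (vnorm (transport _ _ _ _)) (vnorm (U2 k)) (fnorm k) => a b c h2.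
    have -> : 3 * (27 * (A0 * (40 * A0))) / n.+1%:R * (c ^+ 1 * b) =
      3 * (c * b / n.+1%:R * (27 * (A0 * (40 * A0)))) by rewrite expr1; ring.
    by rewrite -mulrA ler_wpM2l.
  rewrite -mulr_sumr.
  apply: (@le_trans _ _ ((3 * (27 * (A0 * (40 * A0))) / n.+1%:R) * (40 * A0))).
    rewrite ler_wpM2l//.
    by apply: divr_ge0 => //; rewrite mulr_ge0// mulr_ge0// mulr_ge0// mulr_ge0.
  by rewrite mulrAC.
(* The arithmetic-geometric inequality leaves (nu2 - nu1)^2, so that the final distance, a square
   root, is linear in the difference of the viscosities. *)
have PS : - \sum_(k <- s2) (nu2 - nu1) * sqnorm k * rdot (v k) (U1 k) <=
    S / 2 + 9 / 2 * (nu2 - nu1) ^+ 2 * A0 ^+ 2.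
  apply: (@le_trans _ _ (\sum_(k <- s2) (vnorm2 (v k) / 2 +
      9 / 2 * (nu2 - nu1) ^+ 2 * (sqnorm k ^+ 2 * vnorm2 (U1 k))))).
    rewrite -sumrN; apply: ler_sum => k _; apply: (le_trans (ler_norm _)).
    rewrite normrN !normrM (ger0_norm (@sqnorm_ge0 R k)).
    have := rdot_le (v k) (U1 k); rewrite -!sqr_vnorm.
    have := @sqnorm_ge0 R k; have := normr_ge0 (nu2 - nu1).
    rewrite -(real_normK (num_real (nu2 - nu1))).
    move: (`|nu2 - nu1|) (sqnorm k) (`|rdot _ _|) (vnorm (v k)) (vnorm (U1 k)) => a b c d e a0 b0 h.
    apply: (@le_trans _ _ (a * b * (3 * d * e))).
      by rewrite ler_wpM2l// mulr_ge0.
    by have := sqr_ge0 (d - 3 * a * b * e); lra.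
  rewrite big_split/= -mulr_suml lerD2l -mulr_sumr.
  apply: ler_wpM2l; first by apply: mulr_ge0; [rewrite divr_ge0 | exact: sqr_ge0].
  apply: le_trans E1.
  apply: (@le_trans _ _ (\sum_(k <- s1) sqnorm k ^+ 2 * vnorm2 (U1 k))).
    apply: (@ler_sum_inj R _ s2 s1 id (fun k => sqnorm k ^+ 2 * vnorm2 (U1 k))) => // k.
      by rewrite mulr_ge0 ?sqr_ge0 ?vnorm2_ge0.
    by move=> /(vnorm_supported sU1) h; rewrite -sqr_vnorm h expr0n mulr0.
  rewrite /genergy big_seq [leRHS]big_seq; apply: ler_sum => k ks.
  have k0 : k != 0 by apply: contraNN s10 => /eqP <-.
  rewrite ler_wpM2r ?vnorm2_ge0// ler_sqr ?nnegrE ?sqnorm_ge0 ?gweight_ge0// -sqr_fnorm.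
  apply: (@le_trans _ _ (fnorm k ^+ m)).
    by rewrite ler_weXn2l ?fnorm_ge1//; exact: leq_trans m8.
  rewrite /gweight ler_peMr ?exprn_ge0// -expR0 ler_expR mulr_ge0// powR_ge0//.
have orth : \sum_(k <- s2) rdot (v k) (transport s2 U2 v k) = 0 by exact: transport_orthogonal.
have D0 : 0 <= \sum_(k <- s2) nu2 * sqnorm k * vnorm2 (v k).
  by apply: sumr_ge0 => k _; exact: mulr_ge0 (mulr_ge0 nu20 (sqnorm_ge0 _)) (vnorm2_ge0 _).
rewrite -mulr_sumr.
have -> : \sum_(k <- s2) rdot (v k) (fun i => rhs nu2 s2 U2 k i - rhs nu1 s1 U1 k i) =
  - (\sum_(k <- s2) nu2 * sqnorm k * vnorm2 (v k))
  - (\sum_(k <- s2) (nu2 - nu1) * sqnorm k * rdot (v k) (U1 k))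
  - (\sum_(k <- s2) rdot (v k) (transport s2 U2 v k)) - (\sum_(k <- s2) Q k) - (\sum_(k <- s2) W k).
  rewrite -!sumrN -!big_split/= big_seq [RHS]big_seq; apply: eq_bigr => k ks.
  exact: rdot_rhs_diff.
rewrite orth -/S.
move: QS WS PS D0; rewrite -[27 * (40 * A0) * S]mulrA.
move: (3 * (27 * (A0 * (40 * A0))) * (40 * A0) / _) (\sum_(k <- s2) Q k) (\sum_(k <- s2) W k) (\sum_(k <- s2) _ * rdot _ _) (\sum_(k <- s2) nu2 * _ * _) => a b c d e.
have -> : (1 + 2 * (27 * (40 * A0))) * S = S + 2 * (27 * (40 * A0 * S)) by ring.
have -> : 9 * (nu2 - nu1) ^+ 2 * A0 ^+ 2 = 2 * (9 / 2 * (nu2 - nu1) ^+ 2 * A0 ^+ 2) by field.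
move: (9 / 2 * _ * _) (27 * _) => f g; lra.
Qed.

End Stability.

(** * The family of Galerkin solutions *)

Section Solutions.
Context {R : realType}.
Local Notation C := (complex R).
Local Notation fnorm := (@freq_norm R).
Implicit Types (k l q : freq) (U V : freq -> 'I_3 -> C) (s : seq freq) (t : R).

Lemma nm_opp (z : C) : Normc.normc (- z) = Normc.normc z.
Proof. by case: z => a b; rewrite /Normc.normc /= !sqrrN. Qed.

Definition proj T t : R := Num.max 0 (Num.min T t).

Lemma proj_itv T t : 0 <= T -> 0 <= proj T t <= T.
Proof. by move=> T0; rewrite /proj le_max lexx/= ge_max T0 ge_min lexx. Qed.

Lemma proj_id T t : 0 <= t <= T -> proj T t = t.
Proof. by move=> /andP[t0 tT]; rewrite /proj (min_idPr tT) (max_idPr t0). Qed.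

Lemma proj_lip T t t' : 0 <= T -> `|proj T t - proj T t'| <= `|t - t'|.
Proof.
move=> T0; rewrite /proj /Num.max /Num.min.
have h1 := ler_norm (t - t'); have h2 := ler_norm (- (t - t')); rewrite normrN in h2.
have := normr_ge0 (t - t').
by case: (ltP T t) => a1; case: (ltP T t') => a2; case: (ltP 0 T) => a3;
  case: (ltP 0 t) => a4; case: (ltP 0 t') => a5; rewrite ler_norml; lra.
Qed.

(* Time is clamped to [0, T], so that all the bounds hold for every real t. *)
Definition galerkin_solution (A0 lam T th tau : R) (m : nat) (A : freq -> 'I_3 -> C)
    (K : R) (nu : R) (n : nat) (U : R -> freq -> 'I_3 -> C) :=
  [/\ forall k i, U 0 k i = if k \in box n.+1 then A k i else 0,
      forall t, [/\ real_field (U t), div_free (U t), supported (box n.+1) (U t) &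
        genergy (box n.+1) m th (tau - lam * proj T t) (U t) <= A0 ^+ 2],
      forall t k i, 0 < t < T ->
        cderiv (fun t => U t k i) t (rhs nu (box n.+1) (U t) k i) &
      forall t t' k i, Normc.normc (U t k i - U t' k i) <= K * `|t - t'|].

(** The bound of [rhs_le], doubled by [cderiv_lip]: the first A0 is for the viscous term with nu <=
    1, 12 for the Leray projector, and the rest for the transport term. *)
Definition time_lip (A0 : R) : R := 2 * (A0 + 12 * (27 * (A0 * (40 * A0)))).

(** Gronwall's bound for the squared l^2 distance: the first [A0 ^+ 2] is the initial tail, the
    product with [T] the source. *)
Definition stability_const (A0 T : R) : R :=
  (A0 ^+ 2 + (9 * A0 ^+ 2 + 2 * (3 * (27 * (A0 * (40 * A0))) * (40 * A0))) * T) *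
  expR ((1 + 2 * (27 * (40 * A0))) * T).

Lemma sqnorm_vnorm_le s m th (tau A0 : R) U k : (8 <= m)%N -> 0 \notin s -> 0 <= tau ->
  0 <= A0 -> supported s U -> genergy s m th tau U <= A0 ^+ 2 ->
  sqnorm k * vnorm (U k) <= A0.
Proof.
move=> m8 s0 t0 A00 sU hE; have [ks|ks] := boolP (k \in s); last first.
  by rewrite (vnorm_supported sU ks) mulr0.
have k0 : k != 0 by apply: contraNN s0 => /eqP <-.
have x0 k' : 0 <= fnorm k' by exact: fnorm_ge0.
rewrite -ler_sqr ?nnegrE//; last exact: mulr_ge0 (sqnorm_ge0 _) (vnorm_ge0 _).
apply: le_trans hE; apply: (@le_trans _ _ (gweight m th tau k ^+ 2 * vnorm2 (U k))).
  rewrite exprMn sqr_vnorm ler_wpM2r ?vnorm2_ge0//.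
  rewrite ler_sqr ?nnegrE ?sqnorm_ge0 ?gweight_ge0// -sqr_fnorm.
  apply: (@le_trans _ _ (fnorm k ^+ m)).
    by rewrite ler_weXn2l ?fnorm_ge1//; exact: leq_trans m8.
  by rewrite /gweight ler_peMr ?exprn_ge0// -expR0 ler_expR mulr_ge0// powR_ge0.
apply: (@ler_term_sum R _ s (fun k => gweight m th tau k ^+ 2 * vnorm2 (U k))) => // l.
by rewrite mulr_ge0 ?sqr_ge0 ?vnorm2_ge0.
Qed.

Lemma rhs_le (nu : R) s m th (tau A0 : R) U k i : 0 <= nu -> nu <= 1 -> (8 <= m)%N ->
  uniq s -> 0 \notin s -> 0 <= tau -> 0 <= A0 -> supported s U ->
  genergy s m th tau U <= A0 ^+ 2 ->
  Normc.normc (rhs nu s U k i) <= A0 + 12 * (27 * (A0 * (40 * A0))).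
Proof.
move=> nu0 nu1 m8 us s0 t0 A00 sU hE.
have B0 : 0 <= 12 * (27 * (A0 * (40 * A0))).
  by rewrite mulr_ge0// mulr_ge0// mulr_ge0// mulr_ge0.
rewrite /rhs; case: ifPn => ks; last by rewrite Normc.normc0 addr_ge0.
have k0 : k != 0 by apply: contraNN s0 => /eqP <-.
apply: (le_trans (le_normcD _ _)); apply: lerD.
  rewrite -rmorphN Normc.normcM nm_real normrN ger0_norm; last exact: mulr_ge0 (sqnorm_ge0 _).
  apply: le_trans (sqnorm_vnorm_le k m8 s0 t0 A00 sU hE).
  have := nm_le_vnorm (U k) i; have := nm_ge0 (U k i); have := @sqnorm_ge0 R k.
  have := vnorm_ge0 (U k).
  move: (sqnorm k) (Normc.normc _) (vnorm _) => a b c c0 a0 b0 bc.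
  rewrite -mulrA.
  apply: (@le_trans _ _ (1 * (a * b))); first by rewrite ler_wpM2r// mulr_ge0.
  by rewrite mul1r ler_wpM2l.
have -> : Normc.normc (- leray k (transport s U U k) i) = Normc.normc (leray k (transport s U U k) i).
  by rewrite nm_opp.
apply: (le_trans (nm_le_vnorm _ _)); apply: (le_trans (vnorm_leray _ k0)).
rewrite ler_wpM2l//; apply: vnorm_transport_le => //.
  by move=> l; exact: vnorm_le_genergy hE.
by apply: le_trans (l1_bound0 (j := 1) _ us s0 t0 A00 hE) => //; exact: leq_trans m8.
Qed.

Lemma galerkin_stability (A0 nu1 nu2 lam T th tau : R) (m n : nat) s2 (A : freq -> 'I_3 -> C)
    (U1 U2 : R -> freq -> 'I_3 -> C) (s1 := box n.+1) :
  (8 <= m)%N -> 0 <= A0 -> 0 <= nu2 -> 0 <= lam -> 0 <= tau - lam * T -> 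
  uniq s2 -> 0 \notin s2 -> {subset s1 <= s2} ->
  (forall k i, U1 0 k i = if k \in s1 then A k i else 0) ->
  (forall k i, U2 0 k i = if k \in s2 then A k i else 0) ->
  (forall t, 0 <= t -> [/\ real_field (U1 t), div_free (U1 t) & supported s1 (U1 t)]) ->
  (forall t, 0 <= t -> [/\ real_field (U2 t), div_free (U2 t) & supported s2 (U2 t)]) ->
  (forall t, 0 <= t <= T -> genergy s1 m th (tau - lam * t) (U1 t) <= A0 ^+ 2) ->
  (forall t, 0 <= t <= T -> genergy s2 m th (tau - lam * t) (U2 t) <= A0 ^+ 2) ->
  (forall t k i, 0 <= t <= T -> cderiv (fun t => U1 t k i) t (rhs nu1 s1 (U1 t) k i)) ->
  (forall t k i, 0 <= t <= T -> cderiv (fun t => U2 t k i) t (rhs nu2 s2 (U2 t) k i)) ->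
  forall t, 0 <= t <= T ->
  \sum_(k <- s2) vnorm2 (fun i => U2 t k i - U1 t k i) <=
  stability_const A0 T * ((nu2 - nu1) ^+ 2 + n.+1%:R^-1).
Proof.
move=> m8 A00 nu20 lam0 tauT us2 s20 s12 I1 I2 P1 P2 E1 E2 D1 D2 t /andP[t0 tT].
have T0 : 0 <= T by exact: le_trans tT.
have s10 : 0 \notin s1 := zero_notin_box _.
have tauP t' : 0 <= t' <= T -> 0 <= tau - lam * t'.
  by move=> /andP[t0' tT']; have := ler_wpM2l lam0 tT'; lra.
have N0 : 0 < n.+1%:R :> R by [].
have Ni0 : 0 <= n.+1%:R^-1 :> R by [].
pose c : R := 1 + 2 * (27 * (40 * A0)).
pose b : R := 3 * (27 * (A0 * (40 * A0))) * (40 * A0).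
pose e : R := 9 * (nu2 - nu1) ^+ 2 * A0 ^+ 2 + 2 * (b / n.+1%:R).
have b0 : 0 <= b.
  rewrite /b; apply: mulr_ge0; last exact: mulr_ge0.
  by apply: mulr_ge0 => //; apply: mulr_ge0 => //; apply: mulr_ge0 => //; exact: mulr_ge0.
have c0 : 0 <= c by rewrite /c addr_ge0// mulr_ge0// mulr_ge0// mulr_ge0.
have e0 : 0 <= e.
  rewrite /e; apply: addr_ge0; first exact: mulr_ge0 (mulr_ge0 _ (sqr_ge0 _)) (sqr_ge0 _).
  by apply: mulr_ge0 => //; exact: mulr_ge0.
pose v t k i := U2 t k i - U1 t k i.
pose f t := \sum_(k <- s2) vnorm2 (v t k).
pose df t := \sum_(k <- s2) 2 * rdot (v t k) (fun i => rhs nu2 s2 (U2 t) k i - rhs nu1 s1 (U1 t) k i).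
have fd t' : 0 <= t' <= t -> is_derive t' 1 f (df t').
  move=> /andP[t0' tt']; have tT' : 0 <= t' <= T by rewrite t0' (le_trans tt').
  apply: is_derive_sumr => k; apply: derive_vnorm2 => i.
  by apply: cderivB; [exact: D2|exact: D1].
have fle t' : 0 <= t' <= t -> df t' <= c * f t' + e.
  move=> /andP[t0' tt']; have tT' : 0 <= t' <= T by rewrite t0' (le_trans tt').
  have [r1 d1 sU1] := P1 t' t0'; have [r2 d2 sU2] := P2 t' t0'.
  exact: (stability_step nu1 m8 (tauP _ tT') A00 nu20 us2 s20 s12 r1 d1 sU1 (E1 _ tT')
    r2 d2 sU2 (E2 _ tT')).
apply: (le_trans (gronwall c0 e0 t0 fd fle)).
(* The initial data agree inside the smaller box; outside it the squared weight is at least |k| > n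
   + 1, so the tail is at most the energy over n + 1. *)
have f0 : f 0 <= A0 ^+ 2 * n.+1%:R^-1.
  have T00 : 0 <= (0 : R) <= T by rewrite lexx.
  apply: (@le_trans _ _ (genergy s2 m th (tau - lam * 0) (U2 0) * n.+1%:R^-1)); last first.
    by rewrite ler_wpM2r// E2.
  rewrite /genergy mulr_suml /f big_seq [leRHS]big_seq; apply: ler_sum => k ks2.
  have k0 : k != 0 by apply: contraNN s20 => /eqP <-.
  have G0 : 0 <= gweight m th (tau - lam * 0) k ^+ 2 * vnorm2 (U2 0 k) * n.+1%:R^-1.
    exact: mulr_ge0 (mulr_ge0 (sqr_ge0 _) (vnorm2_ge0 _)) Ni0.
  have [ks1|ks1] := boolP (k \in s1).
    rewrite [leLHS](_ : _ = 0)// /vnorm2 big1// => i _.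
    by rewrite /v I1 I2 ks1 ks2 subrr Normc.normc0 expr0n.
  have -> : vnorm2 (v 0 k) = vnorm2 (U2 0 k).
    by congr vnorm2; apply/funext => i; rewrite /v I1 (negbTE ks1) subr0.
  have hx := @fnorm_notin_box R _ _ k0 ks1.
  have xg : fnorm k <= gweight m th (tau - lam * 0) k.
    rewrite /gweight; apply: (@le_trans _ _ (fnorm k ^+ m)).
      by rewrite -[leLHS]expr1 ler_weXn2l ?fnorm_ge1//; exact: leq_trans m8.
    rewrite ler_peMr ?exprn_ge0 ?fnorm_ge0// -expR0 ler_expR mulr_ge0 ?powR_ge0//.
    exact: tauP.
  have g1 := @gweight_ge1 R m th (tau - lam * 0) k (tauP _ T00) k0.
  rewrite mulrAC ler_peMl ?vnorm2_ge0// ler_pdivlMr// mul1r.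
  apply: le_trans (ltW hx) (le_trans xg _).
  by rewrite expr2 ler_peMl// (le_trans _ g1).
rewrite /stability_const -/c -/b.
have ex : expR (c * t) <= expR (c * T) by rewrite ler_expR ler_wpM2l.
have ex0 := expR_ge0 (c * t).
have fe0 : 0 <= f 0 by apply: sumr_ge0 => k _; exact: vnorm2_ge0.
apply: (@le_trans _ _ ((A0 ^+ 2 * n.+1%:R^-1 + e * T) * expR (c * T))).
  apply: ler_pM => //.
    by rewrite addr_ge0// mulr_ge0.
  by rewrite lerD// ler_wpM2l.
rewrite [leRHS]mulrAC ler_wpM2r ?expR_ge0// /e.
have h1 := mulr_ge0 (sqr_ge0 A0) (sqr_ge0 (nu2 - nu1)).
have h2 := mulr_ge0 (mulr_ge0 (sqr_ge0 A0) T0) Ni0.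
have h3 := mulr_ge0 (mulr_ge0 b0 T0) (sqr_ge0 (nu2 - nu1)).
clear -h1 h2 h3; move: h1 h2 h3; move: ((nu2 - nu1) ^+ 2) (A0 ^+ 2) (n.+1%:R^-1) b => d a N b' h1 h2 h3.
rewrite -subr_ge0 (_ : _ - _ = a * d + 9 * (a * T * N) + 2 * (b' * T * d)); last by ring.
lra.
Qed.

Lemma near_itv (T t : R) : 0 < t < T -> \forall x \near t, 0 < x < T.
Proof.
move=> tT; have : t \in `]0, T[ by rewrite in_itv.
by move=> /near_in_itvoo; apply: filterS => x /=; rewrite in_itv.
Qed.

Lemma vnorm_le_sqrt_sum s (f : freq -> 'I_3 -> C) k (a : R) : 0 <= a ->
  supported s f -> \sum_(k <- s) vnorm2 (f k) <= a -> vnorm (f k) <= Num.sqrt a.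
Proof.
move=> a0 sf h; rewrite -ler_sqr ?nnegrE ?vnorm_ge0 ?sqrtr_ge0// sqr_vnorm sqr_sqrtr//.
have [ks|ks] := boolP (k \in s).
  by apply: le_trans h; apply: (@ler_term_sum R _ s (fun k => vnorm2 (f k))) => // l; exact: vnorm2_ge0.
by rewrite -sqr_vnorm (vnorm_supported sf ks) expr0n.
Qed.

Lemma galerkin_family (A0 lam T th tau : R) (m : nat) (A : freq -> 'I_3 -> C) :
  0 <= A0 -> (8 <= m)%N -> 0 < th -> th <= 1 -> tau <= 1 -> 0 <= T ->
  0 <= lam -> 0 <= tau - lam * T -> @transport_const R m * (A0 + 1) <= lam ->
  real_field A -> div_free A -> (forall n, genergy (box n.+1) m th tau A <= A0 ^+ 2) ->
  exists U : R -> nat -> R -> freq -> 'I_3 -> C,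
  (forall nu n, 0 <= nu <= 1 ->
    galerkin_solution A0 lam T th tau m A (time_lip A0) nu n (U nu n)) /\
  (forall nu1 nu2 n n' t k, 0 <= nu1 <= 1 -> 0 <= nu2 <= 1 -> (n <= n')%N ->
    vnorm (fun i => U nu2 n' t k i - U nu1 n t k i) <=
    Num.sqrt (stability_const A0 T * ((nu2 - nu1) ^+ 2 + n.+1%:R^-1))).
Proof.
move=> A00 m8 th0 th1 tau1 T0 lam0 tauT hlam rA dA EA.
(* The claim is conditional on [0 <= a.1], so that the choice function is total in the viscosity. *)
have ex (a : R * nat) : exists U : R -> freq -> 'I_3 -> C, 0 <= a.1 ->
  [/\ forall k i, U 0 k i = if k \in box a.2.+1 then A k i else 0,
      forall t, 0 <= t -> [/\ real_field (U t), div_free (U t) & supported (box a.2.+1) (U t)],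
      forall t, 0 <= t <= T -> genergy (box a.2.+1) m th (tau - lam * t) (U t) <= A0 ^+ 2 &
      forall t k i, 0 <= t <= T ->
        cderiv (fun t => U t k i) t (rhs a.1 (box a.2.+1) (U t) k i)].
  have [nu0|nu0] := boolP (0 <= a.1); last by exists (fun _ _ _ => 0).
  have [U UP] := @galerkin R A0 a.1 lam T th tau m (box a.2.+1) A A00 nu0 m8 th0 th1 tau1
    lam0 tauT hlam (uniq_box _) (box_opp _) (zero_notin_box _) rA dA (EA _).
  by exists U.
have [V VP] := choice ex.
exists (fun nu n t => V (nu, n) (proj T t)); split.
  move=> nu n /andP[nu0 nu1]; have [I P E D] := VP (nu, n) nu0.
  have tP t : 0 <= tau - lam * proj T t.
    have /andP[p0 pT] := proj_itv t T0; have := ler_wpM2l lam0 pT; lra.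
  split.
  - by rewrite proj_id ?lexx.
  - move=> t; have pt := proj_itv t T0; have [r d sU] := P _ (proj1 (andP pt)).
    by split => //; exact: E.
  - move=> t k i tT; have tT' : 0 <= t <= T by move: tT => /andP[/ltW -> /ltW ->].
    have [D1 D2] := D t k i tT'; rewrite (proj_id tT').
    (* At interior times the clamped and the original time agree in a neighbourhood; at 0 and T the
       clamped curve may fail to be differentiable, hence the strict inequalities in
       [galerkin_solution]. *)
    by split; [apply: near_eq_is_derive D1|apply: near_eq_is_derive D2];
      apply: filterS (near_itv tT) => x /andP[/ltW h1 /ltW h2]; rewrite proj_id ?h1.
  - move=> t t' k i.
    suff h a b : 0 <= a <= T -> 0 <= b <= T -> a <= b ->
        Normc.normc (V (nu, n) b k i - V (nu, n) a k i) <= time_lip A0 * `|b - a|.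
      have K0 : 0 <= time_lip A0.
        rewrite /time_lip mulr_ge0// addr_ge0//.
        by rewrite mulr_ge0// mulr_ge0// mulr_ge0// mulr_ge0.
      apply: (@le_trans _ _ (time_lip A0 * `|proj T t - proj T t'|)); last first.
        by rewrite ler_wpM2l// proj_lip.
      have [tt'|/ltW tt'] := leP (proj T t') (proj T t); first by apply: h => //; exact: proj_itv.
      rewrite -nm_opp opprB distrC; by apply: h => //; exact: proj_itv.
    move=> aT bT ab; rewrite [`|_|]ger0_norm ?subr_ge0//.
    have xT x : a <= x <= b -> 0 <= x <= T.
      by move: aT bT => /andP[a0 _] /andP[_ bT] /andP[ax xb]; rewrite (le_trans a0)// (le_trans xb).
    rewrite /time_lip; apply: (@cderiv_lip R (fun t => V (nu, n) t k i)
      (fun t => rhs nu (box n.+1) (V (nu, n) t) k i)) => // x xab.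
      exact: D (xT _ xab).
    have [r d sU] := P x (proj1 (andP (xT _ xab))).
    have tx : 0 <= tau - lam * x by rewrite -(proj_id (xT _ xab)).
    exact: rhs_le nu0 nu1 m8 (uniq_box _) (zero_notin_box _) tx A00 sU (E _ (xT _ xab)).
move=> nu1 nu2 n n' t k /andP[nu10 _] /andP[nu20 _] nn'.
have [I1 P1 E1 D1] := VP (nu1, n) nu10; have [I2 P2 E2 D2] := VP (nu2, n') nu20.
have pt := proj_itv t T0.
have s12 : {subset box n.+1 <= box n'.+1} by exact: box_sub.
have h := galerkin_stability m8 A00 nu20 lam0 tauT (uniq_box _) (zero_notin_box _) s12
  I1 I2 P1 P2 E1 E2 D1 D2 pt.
apply: (vnorm_le_sqrt_sum (s := box n'.+1)
  (f := fun k i => V (nu2, n') (proj T t) k i - V (nu1, n) (proj T t) k i)) => //.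
  by apply: le_trans h; apply: sumr_ge0 => l _; exact: vnorm2_ge0.
have [_ _ sU1] := P1 _ (proj1 (andP pt)); have [_ _ sU2] := P2 _ (proj1 (andP pt)).
move=> l ls i; rewrite sU2// sU1 ?subrr//.
by apply: contraNN ls; exact: s12.
Qed.

End Solutions.

(** * Pressure coefficients *)

Section Pressure.
Context {R : realType}.
Local Notation C := (complex R).
Local Notation nm := (@Normc.normc R).
Local Notation fnorm := (@freq_norm R).
Implicit Types (k l q : freq) (U V : freq -> 'I_3 -> C) (s : seq freq) (t : R).

(* This is i (q . B q) / |q|^2 for B the convolution [transport s U U], rewritten with div U = 0. *)
Definition pressure s U q : C :=
  - ((@sqnorm R q)^-1%:C * \sum_(l <- s) fdot q (U (q - l)) * fdot q (U l)).

Lemma fdot0l (v : 'I_3 -> C) : fdot 0 v = 0.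
Proof. by rewrite /fdot big1// => i _; rewrite mxE mul0r. Qed.

Lemma pressure0 s U : pressure s U 0 = 0.
Proof. by rewrite /pressure big1 ?mulr0 ?oppr0// => l _; rewrite fdot0l mul0r. Qed.

Lemma sqnormN q : @sqnorm R (- q) = sqnorm q.
Proof. by rewrite /sqnorm; apply: eq_bigr => i _; rewrite mxE rmorphN sqrrN. Qed.

Lemma pressure_real s U q : uniq s -> sym_seq s -> real_field U ->
  pressure s U (- q) = cj (pressure s U q).
Proof.
move=> us ss rU; rewrite /pressure sqnormN cjN cjM cjR cj_sum; congr (- (_ * _)).
rewrite -(sum_opp _ us ss); apply: eq_bigr => l _.
rewrite cjM !fdot_cj !fdotN mulrNN; congr (_ * _); congr fdot; apply/funext => i.
  by have -> : - q - - l = - (q - l) by rewrite opprB opprK addrC.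
by rewrite rU.
Qed.

(** A product of two modes of size at most [N] has size at most [N + N], so the pressure lives in a
    box twice as large. *)
Lemma pressure_support N U q : supported (box N) U -> q \notin box (N + N) ->
  pressure (box N) U q = 0.
Proof.
move=> sU qN; have [->|q0] := eqVneq q 0; first exact: pressure0.
rewrite /pressure big1_seq ?mulr0 ?oppr0// => l /andP[_ lN].
rewrite (_ : fdot q (U (q - l)) = 0) ?mul0r//.
rewrite /fdot big1// => i _; rewrite sU ?mulr0//; apply: contra qN => qlN.
rewrite mem_box q0/=; apply/forallP => j; move: lN qlN; rewrite !mem_box.
move=> /andP[_ /forallP/(_ j) h1] /andP[_ /forallP/(_ j)]; rewrite !mxE => h2.
by move: h1 h2; move: (q ord0 j) (l ord0 j) => a b; lia.
Qed.

Lemma pressure_sub s1 s2 U q : uniq s1 -> uniq s2 -> {subset s1 <= s2} -> supported s1 U ->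
  pressure s1 U q = pressure s2 U q.
Proof.
move=> us1 us2 s12 sU; rewrite /pressure; congr (- (_ * _)).
rewrite (@sum_shift _ _ s1 s2 (fun l => fdot q (U (q - l)) * fdot q (U l)) 0)//.
- by apply: eq_bigr => l _; rewrite subr0.
- move=> l ls; rewrite (_ : fdot q (U l) = 0) ?mulr0//.
  by rewrite /fdot big1// => i _; rewrite sU// mulr0.
- by move=> l ls; rewrite addr0; exact: s12.
Qed.

(** The two factors of [q] cancel |q|^-2: the pressure is of order zero in each velocity, and no
    derivative is lost. *)
Lemma nm_pressure_term q (v w : 'I_3 -> C) :
  (sqnorm q)^-1 * (nm (fdot q v) * nm (fdot q w)) <= 9 * (vnorm v * vnorm w).
Proof.
have [->|q0] := eqVneq q 0.
  rewrite !fdot0l Normc.normc0 mul0r mulr0; apply: mulr_ge0 => //.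
  exact: mulr_ge0 (vnorm_ge0 _) (vnorm_ge0 _).
have S0 : 0 < @sqnorm R q by exact: sqnorm_gt0.
rewrite mulrC ler_pdivrMr//.
apply: (le_trans (ler_pM (nm_ge0 _) (nm_ge0 _) (nm_fdot q v) (nm_fdot q w))).
rewrite -sqr_fnorm le_eqVlt; apply/orP; left; apply/eqP.
by move: (fnorm q) (vnorm v) (vnorm w) => a b c; ring.
Qed.

Lemma nm_pressure_le s U q :
  nm (pressure s U q) <= 9 * \sum_(l <- s) vnorm (U (q - l)) * vnorm (U l).
Proof.
rewrite /pressure nm_opp Normc.normcM nm_real ger0_norm ?invr_ge0 ?sqnorm_ge0//.
apply: (@le_trans _ _ ((sqnorm q)^-1 * \sum_(l <- s) nm (fdot q (U (q - l))) * nm (fdot q (U l)))).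
  rewrite ler_wpM2l ?invr_ge0 ?sqnorm_ge0//; apply: (le_trans (nm_sum _ _ _)).
  by apply: ler_sum => l _; rewrite Normc.normcM.
by rewrite !mulr_sumr; apply: ler_sum => l _; exact: nm_pressure_term.
Qed.

(** Polarisation: Q(V, V) - Q(U, U) = Q(V, d) + Q(d, U) with d = V - U, and each term contributes 9
    B D. *)
Lemma pressure_diff s U V q (D B : R) : uniq s -> 0 <= D -> supported s V -> supported s U ->
  (forall k, vnorm (fun i => V k i - U k i) <= D) ->
  \sum_(l <- s) vnorm (U l) <= B -> \sum_(l <- s) vnorm (V l) <= B ->
  nm (pressure s V q - pressure s U q) <= 18 * B * D.
Proof.
move=> us D0 sV sU VU hU hV.
have fB v w : fdot q (fun i => v i - w i) = fdot q v - fdot q w.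
  by rewrite /fdot -sumrB; apply: eq_bigr => i _; rewrite mulrBr.
pose d k i := V k i - U k i.
have -> : pressure s V q - pressure s U q = - ((@sqnorm R q)^-1%:C *
    (\sum_(l <- s) fdot q (V (q - l)) * fdot q (d l) +
     \sum_(l <- s) fdot q (d (q - l)) * fdot q (U l))).
  rewrite /pressure -opprD -[X in _ = - X]/(_ * _) -mulrBr; congr (- (_ * _)).
  rewrite -big_split -sumrB/=; apply: eq_bigr => l _.
  rewrite /d !fB; ring.
rewrite nm_opp Normc.normcM nm_real ger0_norm ?invr_ge0 ?sqnorm_ge0//.
apply: (@le_trans _ _ (\sum_(l <- s) 9 * (vnorm (V (q - l)) * D) + \sum_(l <- s) 9 * (D * vnorm (U l)))).
  apply: (@le_trans _ _ (\sum_(l <- s) (sqnorm q)^-1 * (nm (fdot q (V (q - l))) * nm (fdot q (d l))) +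
     \sum_(l <- s) (sqnorm q)^-1 * (nm (fdot q (d (q - l))) * nm (fdot q (U l))))).
    rewrite -!mulr_sumr -mulrDr ler_wpM2l ?invr_ge0 ?sqnorm_ge0//.
    apply: (le_trans (le_normcD _ _)); apply: lerD; apply: (le_trans (nm_sum _ _ _));
      by apply: ler_sum => l _; rewrite Normc.normcM.
  apply: lerD; apply: ler_sum => l _; apply: (le_trans (nm_pressure_term _ _ _)); rewrite ler_wpM2l//.
    by rewrite ler_wpM2l ?vnorm_ge0//; exact: VU.
  by rewrite ler_wpM2r ?vnorm_ge0//; exact: VU.
rewrite -!mulr_sumr -mulr_suml.
have h : \sum_(l <- s) vnorm (V (q - l)) <= B.
  apply: le_trans hV.
  apply: (@ler_sum_inj R _ s s (fun l => q - l) (fun l => vnorm (V l))) => //.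
  - by move=> a b /addrI/oppr_inj.
  - by move=> l; exact: vnorm_ge0.
  - by move=> l; exact: vnorm_supported.
have := ler_wpM2r D0 h; have := ler_wpM2l D0 hU.
by move: (\sum_(l <- s) vnorm (U l)) (\sum_(l <- s) vnorm (V (q - l))) => a b; lra.
Qed.

Lemma fnorm_exp_le j q l : (fnorm q) ^+ j <= 2 ^+ j * (fnorm (q - l) ^+ j + fnorm l ^+ j).
Proof.
have x0 k : 0 <= fnorm k by exact: fnorm_ge0.
have h : fnorm q <= fnorm (q - l) + fnorm l.
  by have := @fnormD R (q - l) l; rewrite subrK.
wlog yz : l h / fnorm (q - l) <= fnorm l => [hw|].
  have [|/ltW yz] := leP (fnorm (q - l)) (fnorm l); first exact: hw.
  have ql : q - (q - l) = l by rewrite opprB addrC subrK.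
  by rewrite addrC; have := hw (q - l); rewrite ql; apply => //; rewrite addrC.
apply: (@le_trans _ _ ((2 * fnorm l) ^+ j)).
  by apply: lerXn2r; rewrite ?nnegrE ?mulr_ge0//; lra.
by rewrite exprMn ler_wpM2l ?exprn_ge0// lerDr exprn_ge0.
Qed.

Lemma exp_fnorm_le (th tau : R) q l : 0 < th -> th <= 1 -> 0 <= tau ->
  expR (tau * fnorm q `^ th) <= expR (tau * fnorm (q - l) `^ th) * expR (tau * fnorm l `^ th).
Proof.
move=> th0 th1 t0; rewrite -expRD ler_expR -mulrDr ler_wpM2l//.
have [->|l0] := eqVneq l 0; first by rewrite subr0 lerDl powR_ge0.
have [ql|ql] := eqVneq (q - l) 0.
  by rewrite (_ : q = l) ?lerDr ?powR_ge0//; apply/eqP; rewrite -subr_eq0 ql.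
apply: powR_subadd => //; try (by apply: fnorm_gt0); first exact: fnorm_ge0 q.
by have := @fnormD R (q - l) l; rewrite subrK.
Qed.

(** The weighted l^1 space is an algebra: the exponential weight is submultiplicative because
    [th <= 1], and the polynomial weight falls on one factor at the cost of 2^j, the other factor
    being measured with exponent 0. *)
Lemma conv_weighted_le s s' (th tau B : R) U j : uniq s -> uniq s' -> supported s U ->
  0 < th -> th <= 1 -> 0 <= tau ->
  \sum_(k <- s) fnorm k ^+ j * expR (tau * fnorm k `^ th) * vnorm (U k) <= B ->
  \sum_(k <- s) fnorm k ^+ 0 * expR (tau * fnorm k `^ th) * vnorm (U k) <= B ->
  \sum_(q <- s') fnorm q ^+ j * expR (tau * fnorm q `^ th) *
     (\sum_(l <- s) vnorm (U (q - l)) * vnorm (U l)) <= 2 ^+ j * (2 * B ^+ 2).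
Proof.
move=> us us' sU th0 th1 t0 hj h0.
pose E k := expR (tau * fnorm k `^ th).
have E0 k : 0 <= E k by exact: expR_ge0.
have x0 k : 0 <= fnorm k by exact: fnorm_ge0.
pose f k := fnorm k ^+ j * E k * vnorm (U k).
pose g k := fnorm k ^+ 0 * E k * vnorm (U k).
have fp k : 0 <= f k by exact: mulr_ge0 (mulr_ge0 (exprn_ge0 _ (x0 k)) (E0 k)) (vnorm_ge0 _).
have gp k : 0 <= g k by exact: mulr_ge0 (mulr_ge0 (exprn_ge0 _ (x0 k)) (E0 k)) (vnorm_ge0 _).
have fs k : k \notin s -> f k = 0 by move=> /(vnorm_supported sU) ks; rewrite /f ks mulr0.
have gs k : k \notin s -> g k = 0 by move=> /(vnorm_supported sU) ks; rewrite /g ks mulr0.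
have F0 : 0 <= \sum_(k <- s) f k by exact: sumr_ge0.
have G0 : 0 <= \sum_(k <- s) g k by exact: sumr_ge0.
apply: (@le_trans _ _ (2 ^+ j * (\sum_(q <- s') \sum_(l <- s) f (q - l) * g l +
    \sum_(q <- s') \sum_(l <- s) g (q - l) * f l))).
  rewrite -big_split/= mulr_sumr; apply: ler_sum => q _.
  rewrite -big_split/= !mulr_sumr; apply: ler_sum => l _.
  have h1 := fnorm_exp_le j q l; have h2 := exp_fnorm_le q l th0 th1 t0.
  have h3 := ler_pM (exprn_ge0 j (x0 q)) (E0 q) h1 h2.
  have v0 : 0 <= vnorm (U (q - l)) * vnorm (U l) by exact: mulr_ge0 (vnorm_ge0 _) (vnorm_ge0 _).
  apply: (le_trans (ler_wpM2r v0 h3)); rewrite /f /g -/(E _) -/(E _) !expr0.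
  rewrite le_eqVlt; apply/orP; left; apply/eqP.
  move: (E (q - l)) (E l) (vnorm (U l)) (vnorm (U (q - l))) (fnorm l ^+ j) (fnorm (q - l) ^+ j) (2 ^+ j) => a b c d e f' g'.
  by ring.
rewrite ler_wpM2l ?exprn_ge0//.
have c1 := conv_sum_le us us' fp gp fs; have c2 := conv_sum_le us us' gp fp gs.
have := ler_pM F0 G0 hj h0.
move: c1 c2; move: (\sum_(q <- s') _) (\sum_(q <- s') _) (\sum_(k <- s) f k) (\sum_(k <- s) g k) => a b c d; lra.
Qed.

Lemma pressure_l1 s s' (th tau B : R) U j : uniq s -> uniq s' -> supported s U ->
  0 < th -> th <= 1 -> 0 <= tau ->
  \sum_(k <- s) fnorm k ^+ j * expR (tau * fnorm k `^ th) * vnorm (U k) <= B ->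
  \sum_(k <- s) fnorm k ^+ 0 * expR (tau * fnorm k `^ th) * vnorm (U k) <= B ->
  \sum_(q <- s') fnorm q ^+ j * expR (tau * fnorm q `^ th) * nm (pressure s U q) <=
  9 * (2 ^+ j * (2 * B ^+ 2)).
Proof.
move=> us us' sU th0 th1 t0 hj h0.
have h := conv_weighted_le us us' sU th0 th1 t0 hj h0.
apply: le_trans (ler_wpM2l _ h) => //; rewrite mulr_sumr; apply: ler_sum => q _.
rewrite mulrCA ler_wpM2l ?nm_pressure_le//.
apply: mulr_ge0; last exact: expR_ge0.
by apply: exprn_ge0; exact: fnorm_ge0.
Qed.

End Pressure.

(** * Trigonometric polynomials and Fourier coefficients *)

Section Waves.
Context {R : realType}.
Local Notation C := (complex R).
Local Notation nm := (@Normc.normc R).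
Local Notation point4 := (R * point3 R)%type.
Implicit Types (k l q : freq) (s : seq freq) (t : R) (x : point3 R).

Lemma is_derive_from_line (V : normedModType R) (G : V -> R) (z v : V) (d : R) :
  is_derive (0 : R) 1 (fun s : R => G (s *: v + z)) d -> is_derive z v G d.
Proof.
have e : (fun t : R => t^-1 *: (((fun s : R => G (s *: v + z)) \o shift 0) (t *: (1 : R)) - G (0 *: v + z)))
  = (fun t : R => t^-1 *: ((G \o shift z) (t *: v) - G z)).
  apply/funext => t /=; congr (_ *: (G _ - G _)); last by rewrite scale0r add0r.
  have -> : t *: (1 : R) = t by exact: mulr1.
  by rewrite addr0.
by case=> dG <-; split; rewrite /derivable /derive -e.
Qed.

Definition wave (y : R) : C := cos y +i* sin y.

Lemma waveD y z : wave (y + z) = wave y * wave z.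
Proof. by rewrite /wave cosD sinD; apply/eqP; rewrite eq_complex /= [sin y * _ + _]addrC !eqxx. Qed.

Lemma waveN y : wave (- y) = cj (wave y).
Proof. by rewrite /wave cosN sinN. Qed.

Lemma nm_wave y : nm (wave y) = 1.
Proof. by rewrite /Normc.normc /wave cos2Dsin2 sqrtr1. Qed.

Lemma wave_periodic y (n : int) : wave (y + n%:~R * (2 * pi)) = wave y.
Proof.
have e : (n%:~R * (2 * pi) : R) = (pi *+ 2) *~ n by rewrite mulrzl mulr_natl.
rewrite e /wave; case: n {e} => n.
  by rewrite -!pmulrn (periodicn (@cosD2pi R)) (periodicn (@sinD2pi R)).
rewrite NegzE mulrNz -!pmulrn -[in RHS](subrK ((pi *+ 2) *+ n.+1) y).
by rewrite (periodicn (@cosD2pi R)) (periodicn (@sinD2pi R)).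
Qed.

Lemma is_derive_wave (V : normedModType R) (L : V -> R) (z v : V) (a : R) (c : C) :
  (forall s : R, L (s *: v + z) = s * a + L z) ->
  is_derive z v (fun z => complex.Re (c * wave (L z))) (a * complex.Re ('i * c * wave (L z))).
Proof.
move=> hL; apply: is_derive_from_line; case: c => c1 c2.
have h : is_derive (0 : R) 1 (fun s : R => s * a + L z) a.
  apply: (is_derive_ext (is_deriveD (is_deriveM (is_derive_id (0 : R) (1 : R)) (is_derive_cst a (0 : R) (1 : R))) (is_derive_cst (L z) (0 : R) (1 : R)))) => //.
  by rewrite scaler0 add0r addr0; exact: mulr1.
have hc : is_derive (0 : R) 1 (fun s : R => cos (s * a + L z)) (- sin (L z) * a).
  have := @is_derive1_comp R cos (fun s : R => s * a + L z) 0 _ _ (is_derive_cos _) h.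
  by rewrite mul0r add0r; apply.
have hs : is_derive (0 : R) 1 (fun s : R => sin (s * a + L z)) (cos (L z) * a).
  have := @is_derive1_comp R sin (fun s : R => s * a + L z) 0 _ _ (is_derive_sin _) h.
  by rewrite mul0r add0r.
apply: (is_derive_ext (is_deriveB (is_deriveZr c1 hc) (is_deriveZr c2 hs))) => [s|].
  by rewrite /wave hL.
by rewrite /wave /=; ring.
Qed.

Lemma freq_dot_line k (h : R) (v x : point3 R) :
  freq_dot k (h *: v + x) = h * freq_dot k v + freq_dot k x.
Proof.
rewrite /freq_dot mulr_sumr -big_split/=; apply: eq_bigr => i _.
have -> : coordinate (h *: v + x) i = h * coordinate v i + coordinate x i.
  case: x v => [[x1 x2] x3] [[v1 v2] v3].
  by rewrite /coordinate; case: i => -[|[|[|//]]].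
by ring.
Qed.

Lemma coordinate_unit i j : coordinate (unit_vector i : point3 R) j = (i == j)%:R.
Proof. by case: i => -[|[|[|//]]] ?; case: j => -[|[|[|//]]]. Qed.

Lemma freq_dot_unit k i : freq_dot k (unit_vector i : point3 R) = (k ord0 i)%:~R.
Proof.
rewrite /freq_dot (bigD1 i)//= coordinate_unit eqxx mulr1 big1 ?addr0// => j ji.
by rewrite coordinate_unit eq_sym (negbTE ji) mulr0.
Qed.

Lemma freq_dotD k l x : freq_dot (k + l) x = freq_dot k x + freq_dot l x.
Proof.
by rewrite /freq_dot -big_split; apply: eq_bigr => i _ /=; rewrite mxE rmorphD mulrDl.
Qed.

Lemma freq_dotN k x : freq_dot (- k) x = - freq_dot k x.
Proof. by rewrite /freq_dot -sumrN; apply: eq_bigr => i _; rewrite mxE rmorphN mulNr. Qed.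

Lemma freq_dot0 x : freq_dot 0 x = 0.
Proof. by rewrite /freq_dot big1// => i _; rewrite mxE mul0r. Qed.

Lemma freq_dot_wave_periodic k x i :
  wave (freq_dot k (x + (2 * pi) *: unit_vector i)) = wave (freq_dot k x).
Proof. by rewrite addrC freq_dot_line freq_dot_unit addrC mulrC wave_periodic. Qed.

Lemma continuous_sumr (V : topologicalType) (T : Type) (r : seq T) (f : T -> V -> R) :
  (forall a, continuous (f a)) -> continuous (fun z => \sum_(a <- r) f a z).
Proof.
move=> cf; elim: r => [|a r ih] z.
  by under eq_fun do rewrite big_nil; exact: cvg_cst.
under eq_fun do rewrite big_cons.
by apply: (@cvgD _ _ _ (nbhs z)); [exact: cf|exact: ih].
Qed.

Lemma continuous_coordinate i : continuous (fun x : point3 R => coordinate x i).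
Proof.
move=> x; rewrite /coordinate; case: i => -[|[|[|//]]] /= _.
- by apply: (@continuous_comp _ _ _ fst fst); exact: cvg_fst.
- by apply: (@continuous_comp _ _ _ fst snd); [exact: cvg_fst|exact: cvg_snd].
- exact: cvg_snd.
Qed.

Lemma continuous_freq_dot k : continuous (fun x : point3 R => freq_dot k x).
Proof.
apply: continuous_sumr => i x; apply: cvgM; first exact: cvg_cst.
exact: continuous_coordinate.
Qed.

Lemma continuous_wave (V : topologicalType) (c : V -> C) (L : V -> R) :
  continuous (fun z => complex.Re (c z)) -> continuous (fun z => complex.Im (c z)) ->
  continuous L -> continuous (fun z => complex.Re (c z * wave (L z))).
Proof.
move=> c1 c2 cL.
have -> : (fun z => complex.Re (c z * wave (L z))) =
    fun z => complex.Re (c z) * cos (L z) - complex.Im (c z) * sin (L z).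
  by apply/funext => z; rewrite /wave; case: (c z).
move=> z; apply: (@cvgB _ _ _ (nbhs z)); apply: (@cvgM _ _ (nbhs z)).
- exact: c1.
- by apply: (@continuous_comp _ _ _ L cos); [exact: cL|exact: continuous_cos].
- exact: c2.
- by apply: (@continuous_comp _ _ _ L sin); [exact: cL|exact: continuous_sin].
Qed.

Definition trig s (c : freq -> C) x : R :=
  \sum_(k <- s) complex.Re (c k * wave (freq_dot k x)).

Lemma continuous_trig s c : continuous (trig s c).
Proof.
apply: continuous_sumr => k; apply: (@continuous_wave _ (fun=> c k)).
- by move=> z; exact: cvg_cst.
- by move=> z; exact: cvg_cst.
- exact: continuous_freq_dot.
Qed.

Lemma continuous_trig_time s (c : R -> freq -> C) :
  (forall k, continuous (fun t => complex.Re (c t k))) ->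
  (forall k, continuous (fun t => complex.Im (c t k))) ->
  continuous (fun z : point4 => trig s (c z.1) z.2).
Proof.
move=> c1 c2; apply: continuous_sumr => k.
apply: (@continuous_wave _ (fun z : point4 => c z.1 k) (fun z => freq_dot k z.2)) => z.
- by apply: (@continuous_comp _ _ _ fst (fun t => complex.Re (c t k))); [exact: cvg_fst|exact: c1].
- by apply: (@continuous_comp _ _ _ fst (fun t => complex.Im (c t k))); [exact: cvg_fst|exact: c2].
- by apply: (@continuous_comp _ _ _ snd (freq_dot k)); [exact: cvg_snd|exact: continuous_freq_dot].
Qed.

Lemma trig_periodic s c : torus_periodic (trig s c).
Proof. by move=> x i; apply: eq_bigr => k _; rewrite freq_dot_wave_periodic. Qed.

Lemma trig_le s c x : `|trig s c x| <= \sum_(k <- s) nm (c k).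
Proof.
apply: (le_trans (ler_norm_sum _ _ _)); apply: ler_sum => k _.
by apply: (le_trans (Re_le_nm _)); rewrite Normc.normcM nm_wave mulr1.
Qed.

Lemma trigB s c d x : trig s c x - trig s d x = trig s (fun k => c k - d k) x.
Proof.
rewrite /trig -sumrB; apply: eq_bigr => k _.
by rewrite mulrBl raddfB.
Qed.

Lemma trig_sub s1 s2 c x : uniq s1 -> uniq s2 -> {subset s1 <= s2} ->
  (forall k, k \notin s1 -> c k = 0) -> trig s1 c x = trig s2 c x.
Proof.
move=> us1 us2 s12 c0; rewrite /trig (@sum_shift _ _ s1 s2 (fun k => complex.Re (c k * wave (freq_dot k x))) 0)//.
- by apply: eq_bigr => k _; rewrite subr0.
- by move=> k ks; rewrite c0// mul0r raddf0.
- by move=> k ks; rewrite addr0; exact: s12.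
Qed.

Lemma is_derive_sumV (V : normedModType R) (T : Type) (r : seq T) (f : T -> V -> R)
  (df : T -> R) (z v : V) : (forall a, is_derive z v (f a) (df a)) ->
  is_derive z v (fun z => \sum_(a <- r) f a z) (\sum_(a <- r) df a).
Proof.
move=> fd; elim: r => [|a r ih].
  rewrite big_nil (_ : (fun _ => _) = cst 0); first exact: is_derive_cst.
  by apply/funext => y; rewrite big_nil.
rewrite big_cons (_ : (fun _ => _) = f a \+ (fun z => \sum_(a <- r) f a z)); first exact: is_deriveD.
by apply/funext => y; rewrite big_cons.
Qed.

Lemma is_derive_trig s (c : freq -> C) x i :
  is_derive x (unit_vector i : point3 R) (trig s c)
    (trig s (fun k => 'i * (k ord0 i)%:~R * c k) x).
Proof.
apply: is_derive_sumV => k; apply: is_derive_eq.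
  apply: is_derive_wave => h; exact: freq_dot_line.
have -> : ((k ord0 i)%:~R : C) = ((k ord0 i)%:~R : R)%:C by rewrite rmorph_int.
rewrite freq_dot_unit; case: (c k) (wave _) => a b [c' d] /=; ring.
Qed.

Lemma is_derive_trig_space s (c : R -> freq -> C) (z : point4) i :
  is_derive z ((0, unit_vector i) : point4) (fun z => trig s (c z.1) z.2)
    (trig s (fun k => 'i * (k ord0 i)%:~R * c z.1 k) z.2).
Proof.
apply: is_derive_from_line.
have /is_derive_line := is_derive_trig s (c z.1) (0 *: unit_vector i + z.2) i.
rewrite scale0r add0r => h; apply: (is_derive_ext h) => // y.
case: z {h} => [t x]; rewrite scale_pair add_pair /=.
by have -> : y *: (0 : R) + t = t by rewrite scaler0 add0r.
Qed.

Lemma is_derive_trig_time s (c dc : R -> freq -> C) (z : point4) :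
  (forall k, cderiv (fun t => c t k) z.1 (dc z.1 k)) ->
  is_derive z ((1, 0) : point4) (fun z => trig s (c z.1) z.2) (trig s (dc z.1) z.2).
Proof.
move=> cd; apply: is_derive_from_line; case: z cd => t x cd.
have e (y : R) : (y *: ((1, 0) : point4) + (t, x)) = (y + t, x).
  rewrite scale_pair add_pair scaler0 add0r; congr (_, _).
  by congr (_ + _); exact: mulr1.
have sh (f : R -> R) (d : R) : is_derive t 1 f d -> is_derive (0 : R) 1 (fun y : R => f (y + t)) d.
  move=> fd; have h : is_derive (0 : R) 1 (fun y : R => y + t) 1.
    by apply: (is_derive_ext (is_deriveD (is_derive_id (0 : R) (1 : R)) (is_derive_cst t (0 : R) (1 : R)))) => //; rewrite addr0.
  have := @is_derive1_comp R f (fun y : R => y + t) 0 d 1.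
  by rewrite add0r mulr1 => /(_ fd h).
have -> : (fun s0 : R => trig s (c (s0 *: ((1, 0) : point4) + (t, x)).1)
    (s0 *: ((1, 0) : point4) + (t, x)).2) = fun y : R => trig s (c (y + t)) x.
  by apply/funext => y; rewrite e.
apply: is_derive_sumr => k /=; have [d1 d2] := cd k.
have := is_deriveB (is_deriveZr (cos (freq_dot k x)) (sh _ _ d1))
  (is_deriveZr (sin (freq_dot k x)) (sh _ _ d2)).
move=> h; apply: (is_derive_ext h) => [y|].
  by rewrite !fctE /wave; case: (c (y + t) k) => a b; rewrite /= mulrC [sin _ * _]mulrC.
by rewrite /wave; case: (dc t k) => a b; rewrite /= mulrC [sin _ * _]mulrC.
Qed.

(* Each wave of nonzero frequency is the derivative of a periodic function. *)
Lemma integral_wave k (c : C) : k != 0 ->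
  \int[leb3]_(x in cell) complex.Re (c * wave (freq_dot k x)) = 0.
Proof.
move=> k0; have [i ki] : exists i, k ord0 i != 0.
  apply/existsP; apply: contraNT k0; rewrite negb_exists => /forallP h.
  by apply/eqP/rowP => i; rewrite mxE; apply/eqP; have := h i; rewrite negbK.
pose d : C := - 'i * ((k ord0 i)%:~R)^-1 * c.
have kiC : ((k ord0 i)%:~R : C) != 0 by rewrite intr_eq0.
apply: (@integral_cell_derive R i (trig [:: k] (fun=> d))).
- apply: (@continuous_wave _ (fun=> c)); do ?[by move=> z; exact: cvg_cst].
  exact: continuous_freq_dot.
- move=> x; apply: (is_derive_eq (is_derive_trig [:: k] (fun=> d) x i)).
  rewrite /trig big_seq1; congr (complex.Re (_ * _)).
  rewrite /d !mulNr mulrN; have := sqr_i R; rewrite expr2 => ii.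
  rewrite (_ : 'i * (k ord0 i)%:~R * ('i / (k ord0 i)%:~R * c) =
    'i * 'i * c * ((k ord0 i)%:~R / (k ord0 i)%:~R)); last by ring.
  by rewrite ii divff// mulr1 mulN1r opprK.
- exact: trig_periodic.
Qed.

Lemma integral_cell_cst (a : R) : \int[leb3]_(x in cell) a = a * (2 * pi) ^+ 3.
Proof.
have -> : \int[leb3]_(x in cell) a = a * fine (leb3 (@cell R)).
  by apply: Rintegral_cst; exact: measurable_cell.
by rewrite leb3_cell.
Qed.

Lemma integral_cell_sum (T : Type) (r : seq T) (f : T -> point3 R -> R) :
  (forall a, continuous (f a)) ->
  \int[leb3]_(x in cell) (\sum_(a <- r) f a x) = \sum_(a <- r) \int[leb3]_(x in cell) f a x.
Proof.
move=> cf; elim: r => [|a r ih].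
  by rewrite big_nil; under eq_Rintegral do rewrite big_nil; rewrite integral_cell_cst mul0r.
rewrite big_cons -ih; under eq_Rintegral do rewrite big_cons.
rewrite RintegralD//; [exact: measurable_cell|exact: continuous_integrable3|].
by apply: continuous_integrable3; exact: continuous_sumr.
Qed.


Lemma continuous_cos_freq k : continuous (fun x : point3 R => cos (freq_dot k x)).
Proof.
by move=> x; apply: (@continuous_comp _ _ _ (freq_dot k) cos); [exact: continuous_freq_dot|exact: continuous_cos].
Qed.

Lemma continuous_sin_freq k : continuous (fun x : point3 R => sin (freq_dot k x)).
Proof.
by move=> x; apply: (@continuous_comp _ _ _ (freq_dot k) sin); [exact: continuous_freq_dot|exact: continuous_sin].
Qed.

Lemma integral_cos k : \int[leb3]_(x in cell) cos (freq_dot k x : R) = (k == 0)%:R * (2 * pi) ^+ 3.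
Proof.
have [->|k0] := eqVneq k 0.
  by under eq_Rintegral do rewrite freq_dot0 cos0; rewrite integral_cell_cst.
rewrite mul0r -[RHS](integral_wave 1 k0); apply: eq_Rintegral => x _.
by rewrite mul1r.
Qed.

Lemma integral_sin k : \int[leb3]_(x in cell) sin (freq_dot k x : R) = 0.
Proof.
have [->|k0] := eqVneq k 0.
  by under eq_Rintegral do rewrite freq_dot0 sin0; rewrite integral_cell_cst mul0r.
rewrite -(integral_wave (- 'i) k0); apply: eq_Rintegral => x _.
by rewrite /wave /=; ring.
Qed.

Lemma sum_delta s (g : freq -> R) k : uniq s -> (forall l, l \notin s -> g l = 0) ->
  \sum_(l <- s) (l == k)%:R * g l = g k.
Proof.
move=> us g0; have [ks|ks] := boolP (k \in s).
  rewrite (bigD1_seq k)//= eqxx mul1r big1 ?addr0// => l lk.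
  by rewrite (negbTE lk) mul0r.
rewrite g0// big1_seq// => l /andP[_ ls]; case: eqP => [lk|]; last by rewrite mul0r.
by rewrite -lk ls in ks.
Qed.

Lemma integral_cellZ (a : R) (f : point3 R -> R) : continuous f ->
  \int[leb3]_(x in cell) (a * f x) = a * \int[leb3]_(x in cell) f x.
Proof.
by move=> cf; apply: RintegralZl; [exact: measurable_cell|exact: continuous_integrable3].
Qed.

Lemma integral_cellD (f g : point3 R -> R) : continuous f -> continuous g ->
  \int[leb3]_(x in cell) (f x + g x) =
  \int[leb3]_(x in cell) f x + \int[leb3]_(x in cell) g x.
Proof.
by move=> cf cg; apply: RintegralD; [exact: measurable_cell|exact: continuous_integrable3..].
Qed.

Lemma integral_cell_comb4 (a b c d : R) (f1 f2 f3 f4 : point3 R -> R) :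
  continuous f1 -> continuous f2 -> continuous f3 -> continuous f4 ->
  \int[leb3]_(x in cell) (a * f1 x + b * f2 x + c * f3 x + d * f4 x) =
  a * \int[leb3]_(x in cell) f1 x + b * \int[leb3]_(x in cell) f2 x +
  c * \int[leb3]_(x in cell) f3 x + d * \int[leb3]_(x in cell) f4 x.
Proof.
have cZ e (f : point3 R -> R) : continuous f -> continuous (fun x => e * f x).
  by move=> cf x; apply: (@cvgM _ _ (nbhs x)); [exact: cvg_cst|exact: cf].
have cD (f g : point3 R -> R) : continuous f -> continuous g -> continuous (fun x => f x + g x).
  by move=> cf cg x; apply: (@cvgD _ _ _ (nbhs x)); [exact: cf|exact: cg].
move=> h1 h2 h3 h4.
have [k1 k2 k3 k4] := And4 (cZ a _ h1) (cZ b _ h2) (cZ c _ h3) (cZ d _ h4).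
rewrite (integral_cellD (cD _ _ (cD _ _ k1 k2) k3) k4) (integral_cellD (cD _ _ k1 k2) k3).
by rewrite (integral_cellD k1 k2) !integral_cellZ.
Qed.

(** Product formulas turn each term into waves of frequencies l - k and l + k, which integrate to 0
    unless l = k or l = -k. Each of these two contributes one half, and the reality condition makes
    the halves match. *)
Lemma fourier_trig s (c : freq -> C) k : uniq s -> 0 \notin s ->
  (forall l, l \notin s -> c l = 0) -> (forall l, c (- l) = cj (c l)) ->
  fourier (trig s c) k = c k.
Proof.
move=> us s0 cs rc.
have P0 : (2 * pi : R) ^+ 3 != 0 by rewrite expf_neq0// mulf_neq0// lt0r_neq0// pi_gt0.
have c1 := continuous_cos_freq; have s1 := continuous_sin_freq.
have nk (l : freq) : ((l + k) == 0) = (l == - k) by rewrite addr_eq0.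
have cc l (f : point3 R -> R) : continuous f -> continuous (fun x => complex.Re (c l * wave (freq_dot l x)) * f x).
  move=> cf x; apply: (@cvgM _ _ (nbhs x)); last exact: cf.
  apply: (@continuous_wave _ (fun=> c l)); do ?[by move=> z; exact: cvg_cst].
  exact: continuous_freq_dot.
have hRe : \int[leb3]_(x in cell) (trig s c x * cos (freq_dot k x)) =
    (2 * pi) ^+ 3 * complex.Re (c k).
  under eq_Rintegral do rewrite /trig mulr_suml.
  rewrite (integral_cell_sum _ (f := fun l x => complex.Re (c l * wave (freq_dot l x)) * cos (freq_dot k x))); last first.
    by move=> l; apply: cc; exact: continuous_cos_freq.
  have e l : \int[leb3]_(x in cell) (complex.Re (c l * wave (freq_dot l x)) * cos (freq_dot k x)) =
      (2 * pi) ^+ 3 / 2 * ((l == k)%:R * complex.Re (c l) + (l == - k)%:R * complex.Re (c l)).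
    transitivity (\int[leb3]_(x in cell) (complex.Re (c l) / 2 * cos (freq_dot (l - k) x) +
      complex.Re (c l) / 2 * cos (freq_dot (l + k) x) +
      - (complex.Im (c l) / 2) * sin (freq_dot (l - k) x) +
      - (complex.Im (c l) / 2) * sin (freq_dot (l + k) x))).
      apply: eq_Rintegral => x _; rewrite !freq_dotD freq_dotN !cosD !sinD cosN sinN /wave.
      by case: (c l) => a b /=; field.
    rewrite integral_cell_comb4// !integral_cos !integral_sin nk subr_eq0.
    by ring.
  under eq_bigr do rewrite e.
  rewrite -mulr_sumr big_split/= !sum_delta//; last 2 first.
  - by move=> l /cs ->.
  - by move=> l /cs ->.
  rewrite rc; case: (c k) => a b /=; by field.
have hIm : \int[leb3]_(x in cell) (trig s c x * sin (freq_dot k x)) =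
    - ((2 * pi) ^+ 3 * complex.Im (c k)).
  under eq_Rintegral do rewrite /trig mulr_suml.
  rewrite (integral_cell_sum _ (f := fun l x => complex.Re (c l * wave (freq_dot l x)) * sin (freq_dot k x))); last first.
    by move=> l; apply: cc; exact: continuous_sin_freq.
  have e l : \int[leb3]_(x in cell) (complex.Re (c l * wave (freq_dot l x)) * sin (freq_dot k x)) =
      (2 * pi) ^+ 3 / 2 * (- ((l == k)%:R * complex.Im (c l)) + (l == - k)%:R * complex.Im (c l)).
    transitivity (\int[leb3]_(x in cell) (- (complex.Im (c l) / 2) * cos (freq_dot (l - k) x) +
      complex.Im (c l) / 2 * cos (freq_dot (l + k) x) +
      - (complex.Re (c l) / 2) * sin (freq_dot (l - k) x) +
      complex.Re (c l) / 2 * sin (freq_dot (l + k) x))).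
      apply: eq_Rintegral => x _; rewrite !freq_dotD freq_dotN !cosD !sinD cosN sinN /wave.
      by case: (c l) => a b /=; field.
    rewrite integral_cell_comb4// !integral_cos !integral_sin nk subr_eq0.
    by ring.
  under eq_bigr do rewrite e.
  rewrite -mulr_sumr big_split/= sumrN !sum_delta//; last 2 first.
  - by move=> l /cs ->.
  - by move=> l /cs ->.
  rewrite rc; case: (c k) => a b /=; by field.
rewrite /fourier hRe hIm !mulrN opprK !mulKf//.
by case: (c k).
Qed.

Lemma fourier_le (f : point3 R -> R) (M : R) k : continuous f -> (forall x, `|f x| <= M) ->
  nm (fourier f k) <= 2 * M.
Proof.
move=> cf fM; have P0 : 0 < (2 * pi : R) ^+ 3 by rewrite exprn_gt0// mulr_gt0// pi_gt0.
have h (g : point3 R -> R) : continuous g -> (forall x, `|g x| <= 1) ->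
    `|((2 * pi) ^- 3 * \int[leb3]_(x in cell) (f x * g x))%R| <= M.
  move=> cg g1; rewrite normrM ger0_norm ?invr_ge0 ?(ltW P0)// mulrC ler_pdivrMr//.
  have := @normr_Rintegral_le_cst _ _ _ leb3 (@cell R) (fun x => f x * g x) M
    (@measurable_cell R) (@leb3_cell_fin R).
  have -> : (2 * pi : R) ^+ 3 = fine (leb3 (@cell R)) by rewrite leb3_cell.
  apply.
    apply: measurable_funTS; apply: continuous_measurable3 => x.
    by apply: (@cvgM _ _ (nbhs x)); [exact: cf|exact: cg].
  move=> x _; rewrite normrM -[leRHS]mulr1; apply: ler_pM => //; exact: fM.
apply: (le_trans (nm_le_ReIm _)); rewrite /fourier /= normrN (_ : 2 * M = M + M); last by ring.
apply: lerD; apply: h; do ?[exact: continuous_cos_freq|exact: continuous_sin_freq] => x.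
  by rewrite ler_norml cos_geN1 cos_le1.
by rewrite ler_norml sin_geN1 sin_le1.
Qed.

Lemma integrable_cellM (h w : point3 R -> R) : leb3.-integrable cell (EFin \o h) ->
  continuous w -> (forall x, `|w x| <= 1) ->
  leb3.-integrable cell (EFin \o (fun x => h x * w x)).
Proof.
move=> hi cw w1; apply: (integrableMl _ hi); [exact: measurable_cell| |].
  by apply: measurable_funTS; exact: continuous_measurable3.
exists 1; split => // y y1 x _; exact: le_trans (w1 x) (ltW y1).
Qed.

Lemma fourierB (f g : point3 R -> R) k :
  leb3.-integrable cell (EFin \o f) -> leb3.-integrable cell (EFin \o g) ->
  fourier (f \- g) k = fourier f k - fourier g k.
Proof.
move=> fi gi.
have h (w : point3 R -> R) : continuous w -> (forall x, `|w x| <= 1) ->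
    \int[leb3]_(x in cell) ((f \- g) x * w x) =
    \int[leb3]_(x in cell) (f x * w x) - \int[leb3]_(x in cell) (g x * w x).
  move=> cw w1; rewrite -RintegralB; [|exact: measurable_cell|exact: integrable_cellM..].
  by apply: eq_Rintegral => x _ /=; rewrite mulrBl.
rewrite /fourier !h; do ?[exact: continuous_cos_freq|exact: continuous_sin_freq].
- by apply/eqP; rewrite eq_complex /=; apply/andP; split; apply/eqP; ring.
- by move=> x; rewrite ler_norml sin_geN1 sin_le1.
- by move=> x; rewrite ler_norml cos_geN1 cos_le1.
Qed.

Lemma fourierN (f : point3 R -> R) k : leb3.-integrable cell (EFin \o f) ->
  fourier f (- k) = cj (fourier f k).
Proof.
move=> fi; rewrite /fourier /cj /= opprK; congr (_ +i* _).
  by congr (_ * _); apply: eq_Rintegral => x _; rewrite freq_dotN cosN.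
rewrite -mulrN; congr (_ * _).
have := @RintegralZl _ _ _ leb3 (@cell R) (fun x => f x * sin (freq_dot k x)) (-1)
  (@measurable_cell R) (integrable_cellM fi (@continuous_sin_freq k) _).
rewrite mulN1r => e.
rewrite -[RHS]opprK -e => [|x]; last by rewrite ler_norml sin_geN1 sin_le1.
by congr (- _); apply: eq_Rintegral => x _; rewrite freq_dotN sinN mulrN mulN1r.
Qed.

End Waves.

(** * Limits of families of Fourier modes *)

Section ModeLimit.
Context {R : realType}.
Local Notation C := (complex R).
Local Notation nm := (@Normc.normc R).
Local Notation fnorm := (@freq_norm R).
Local Notation point4 := (R * point3 R)%type.
Implicit Types (k l q : freq) (s : seq freq) (t : R) (x : point3 R).

Lemma le_vanishing (a b : R) (e : nat -> R) : e @ \oo --> 0 ->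
  (forall n, a <= b + e n) -> a <= b.
Proof.
move=> e0 h; apply/ler_addgt0Pr => eps eps0.
have /cvgrPdist_le/(_ eps eps0)[N _ hN] := e0.
have := hN N (leqnn N); rewrite /= sub0r normrN => hN'.
by apply: (le_trans (h N)); rewrite lerD2l; apply: le_trans hN'; exact: ler_norm.
Qed.

Lemma uniform_limit_continuous (V : topologicalType) (f : V -> R) (g : nat -> V -> R)
  (e : nat -> R) : (forall n, continuous (g n)) -> e @ \oo --> 0 ->
  (forall n z, `|f z - g n z| <= e n) -> continuous f.
Proof.
move=> cg e0 fg z; apply/cvgrPdist_le => eps eps0.
have eps3 : 0 < eps / 3 by rewrite divr_gt0.
have /cvgrPdist_le/(_ _ eps3)[N _ hN] := e0.
have eN : e N <= eps / 3.
  have := hN N (leqnn N); rewrite /= sub0r normrN; apply: le_trans; exact: ler_norm.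
have /cvgrPdist_le/(_ _ eps3) := cg N z; apply: filterS => y hy.
have h1 := fg N z; have h2 := fg N y.
have -> : f z - f y = (f z - g N z) + (g N z - g N y) + - (f y - g N y) by ring.
apply: (le_trans (ler_normD _ _)); rewrite normrN.
have h3 := ler_normD (f z - g N z) (g N z - g N y).
lra.
Qed.

(** The l^1 distance allowed by [l1_le_sup]: the root comes from interpolating a sup distance [d]
    with the weighted bound [B], the factor 40 from [sum_le_sqrt6]. *)
Definition sup_rate (B d : R) : R := 40 * Num.sqrt (2 * B * d).

Lemma sup_rate_cvg0 (B : R) (d : nat -> R) : d @ \oo --> 0 -> sup_rate B (d n) @[n --> \oo] --> 0.
Proof.
move=> d0; rewrite /sup_rate -[X in _ --> X](_ : 40 * Num.sqrt (2 * B * 0) = 0); last first.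
  by rewrite mulr0 sqrtr0 mulr0.
apply: cvgM; first exact: cvg_cst.
apply: (@cvg_comp _ _ _ (fun n => 2 * B * d n) Num.sqrt _ (nbhs (2 * B * 0))); last exact: sqrt_continuous.
by apply: cvgM => //; exact: cvg_cst.
Qed.

(* By Cauchy-Schwarz, closeness in the sup norm and a weighted l1 bound give closeness in l1. *)
Lemma l1_le_sup s (c d : freq -> C) (B e : R) : uniq s -> 0 \notin s -> 0 <= e ->
  \sum_(k <- s) fnorm k ^+ 6 * nm (c k) <= B ->
  \sum_(k <- s) fnorm k ^+ 6 * nm (d k) <= B ->
  (forall k, nm (c k - d k) <= e) -> \sum_(k <- s) nm (c k - d k) <= sup_rate B e.
Proof.
move=> us s0 e0 hc hd hcd.
apply: (le_trans (sum_le_sqrt6 (f := fun k => nm (c k - d k)) us s0 (fun k => nm_ge0 _))).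
rewrite /sup_rate ler_wpM2l//.
suff h : \sum_(k <- s) (fnorm k ^+ 3 * nm (c k - d k)) ^+ 2 <= 2 * B * e.
  by rewrite ler_sqrt//; apply: le_trans h; apply: sumr_ge0 => k _; exact: sqr_ge0.
apply: (@le_trans _ _ (\sum_(k <- s) (fnorm k ^+ 6 * nm (c k) + fnorm k ^+ 6 * nm (d k)) * e)).
  apply: ler_sum => k _; rewrite exprMn -exprM expr2 mulrA -mulrDr.
  apply: ler_pM; [|exact: nm_ge0| |exact: hcd].
    by rewrite mulr_ge0 ?exprn_ge0 ?fnorm_ge0 ?nm_ge0.
  rewrite ler_wpM2l ?exprn_ge0 ?fnorm_ge0//.
  by apply: (le_trans (le_normcD _ _)); rewrite nm_opp.
rewrite -mulr_suml big_split/= ler_wpM2r//.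
by move: hc hd; move: (\sum_(k <- s) _) (\sum_(k <- s) _) => a b; lra.
Qed.

(** What the truncations satisfy uniformly and the limit inherits. The sum ranges over finite lists,
    so that the bound passes to the limit term by term. *)
Definition spectral (th B L : R) (j : nat) (tau : R -> R) (f : R -> freq -> C) :=
  [/\ forall t, f t 0 = 0,
      forall t s, uniq s ->
        \sum_(k <- s) fnorm k ^+ j * expR (tau t * fnorm k `^ th) * nm (f t k) <= B &
      forall t t' k, nm (f t k - f t' k) <= L * `|t - t'|].

(** The coefficients are Cauchy in l^1 uniformly in time, so the trigonometric polynomials converge
    uniformly on space-time and the limit is jointly continuous. [sg n] is the size of the box: n +
    1 for the velocity, twice that for the pressure. *)
Lemma mode_limit (c : nat -> R -> freq -> C) (sg : nat -> nat) (th B L : R) (j : nat)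
    (tau : R -> R) (d : nat -> R) :
  (6 <= j)%N -> {homo sg : n m / (n <= m)%N} -> (forall t, 0 <= tau t) ->
  (forall n t k, c n t (- k) = cj (c n t k)) ->
  (forall n t k, k \notin box (sg n) -> c n t k = 0) ->
  (forall n t s, uniq s ->
    \sum_(k <- s) fnorm k ^+ j * expR (tau t * fnorm k `^ th) * nm (c n t k) <= B) ->
  (forall n m t k, (n <= m)%N -> nm (c m t k - c n t k) <= d n) ->
  d @ \oo --> 0 ->
  (forall n t t' k, nm (c n t k - c n t' k) <= L * `|t - t'|) ->
  exists f : R -> point3 R -> R,
  [/\ continuous (fun z : point4 => f z.1 z.2), forall t, torus_periodic (f t),
      forall n t x, `|f t x - trig (box (sg n)) (c n t) x| <= sup_rate B (d n),
      forall n t k, nm (fourier (f t) k - c n t k) <= 2 * sup_rate B (d n) &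
      spectral th B L j tau (fun t => fourier (f t))].
Proof.
move=> j6 sgm t0 cr cs cB cd d0 cL.
have d_ge0 n : 0 <= d n by apply: le_trans (cd n n 0 0 (leqnn n)); exact: nm_ge0.
have x0 k : 0 <= fnorm k by exact: fnorm_ge0.
have cB6 n t s : uniq s -> 0 \notin s -> \sum_(k <- s) fnorm k ^+ 6 * nm (c n t k) <= B.
  move=> us s0; apply: le_trans (cB n t s us); rewrite big_seq [leRHS]big_seq.
  apply: ler_sum => k ks; have k0 : k != 0 by apply: contraNN s0 => /eqP <-.
  rewrite ler_wpM2r ?nm_ge0//; apply: (@le_trans _ _ (fnorm k ^+ j)).
    by rewrite ler_weXn2l ?fnorm_ge1.
  by rewrite ler_peMr ?exprn_ge0// -expR0 ler_expR mulr_ge0// powR_ge0.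
have cauchy t x n m : (n <= m)%N ->
    `|trig (box (sg m)) (c m t) x - trig (box (sg n)) (c n t) x| <= sup_rate B (d n).
  move=> nm'; have sub := box_sub (sgm _ _ nm').
  rewrite (trig_sub x (uniq_box _) (uniq_box _) sub (cs n t)) trigB.
  apply: (le_trans (trig_le _ _ _)); apply: l1_le_sup => //.
  - exact: uniq_box.
  - exact: zero_notin_box.
  - by apply: cB6; [exact: uniq_box|exact: zero_notin_box].
  - by apply: cB6; [exact: uniq_box|exact: zero_notin_box].
  - by move=> k; exact: cd.
have r0 := sup_rate_cvg0 B d0.
have ex (z : point4) : exists l : R, forall n, `|l - trig (box (sg n)) (c n z.1) z.2| <= sup_rate B (d n).
  have [l _ hl] := cauchy_rate_cvg (u := fun n => trig (box (sg n)) (c n z.1) z.2)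
    (fun n m => @cauchy z.1 z.2 n m) r0.
  by exists l.
have [F hF] := choice ex.
have cont n : continuous (fun z : point4 => trig (box (sg n)) (c n z.1) z.2).
  apply: continuous_trig_time => k; apply: (@lipschitz_continuous R _ L) => t t';
    apply: le_trans (cL n t t' k); rewrite -raddfB; [exact: Re_le_nm|exact: Im_le_nm].
have contF : continuous F by exact: uniform_limit_continuous cont r0 (fun n z => hF z n).
have contFt t : continuous (fun x => F (t, x)).
  move=> x; apply: (@continuous_comp _ _ _ (fun x => (t, x)) F); last exact: contF.
  by apply: (@continuous_pair _ _ _ (fun=> t) id) => y; [exact: cvg_cst|exact: cvg_id].
have hf n t k : nm (fourier (fun x => F (t, x)) k - c n t k) <= 2 * sup_rate B (d n).
  rewrite -(fourier_trig k (uniq_box (sg n)) (zero_notin_box _) (cs n t) (cr n t)) -fourierB; last 2 first.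
  - exact: continuous_integrable3 (contFt t).
  - by apply: continuous_integrable3; exact: continuous_trig.
  apply: fourier_le => [x|x]; last exact: hF (t, x) n.
  by apply: (@cvgB _ _ _ (nbhs x)); [exact: contFt|exact: continuous_trig].
exists (fun t x => F (t, x)); split => //.
- by rewrite (_ : (fun z => _) = F)//; apply/funext => -[].
- move=> t x i; apply/eqP; rewrite -subr_eq0 -normr_le0.
  have r0' : 2 * sup_rate B (d n) @[n --> \oo] --> 0.
    by rewrite -[X in _ --> X](mulr0 2); apply: cvgM => //; exact: cvg_cst.
  apply: (le_vanishing r0') => n; rewrite add0r.
  have h1 := hF (t, x + (2 * pi) *: unit_vector i) n; have h2 := hF (t, x) n.
  rewrite /= trig_periodic in h1; rewrite /= in h2.
  move: h1 h2; move: (trig _ _ _) (F _) (F _) (sup_rate _ _) => a b e r h1 h2.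
  have -> : e - b = (e - a) - (b - a) by ring.
  by have := ler_normB (e - a) (b - a); lra.
split.
- move=> t; apply: (@Normc.eq0_normc R); apply/eqP; rewrite eq_le nm_ge0 andbT.
  have r0' : 2 * sup_rate B (d n) @[n --> \oo] --> 0.
    by rewrite -[X in _ --> X](mulr0 2); apply: cvgM => //; exact: cvg_cst.
  apply: (le_vanishing r0') => n; rewrite add0r.
  by have := hf n t 0; rewrite (cs n t 0) ?subr0// zero_notin_box.
- move=> t s us; pose X k := fnorm k ^+ j * expR (tau t * fnorm k `^ th).
  have X0 k : 0 <= X k by rewrite mulr_ge0 ?exprn_ge0 ?expR_ge0.
  have r0' : 2 * sup_rate B (d n) * \sum_(k <- s) X k @[n --> \oo] --> 0.
    rewrite -[Y in _ --> Y](mul0r (\sum_(k <- s) X k)); apply: cvgM; last exact: cvg_cst.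
    by rewrite -[Y in _ --> Y](mulr0 2); apply: cvgM => //; exact: cvg_cst.
  apply: (le_vanishing r0') => n; apply: le_trans (lerD (cB n t s us) (lexx _)).
  apply: (@le_trans _ _ (\sum_(k <- s) X k * (nm (c n t k) + 2 * sup_rate B (d n)))).
    apply: ler_sum => k _; apply: (ler_wpM2l (X0 k)).
    rewrite -[X in nm X <= _](subrK (c n t k)) addrC.
    by apply: (le_trans (le_normcD _ _)); rewrite lerD2l; exact: hf.
  rewrite le_eqVlt; apply/orP; left; apply/eqP.
  by rewrite mulr_sumr -big_split; apply: eq_bigr => k _; rewrite mulrDr [X k * (2 * _)]mulrC.
- move=> t t' k.
  have r0' : 4 * sup_rate B (d n) @[n --> \oo] --> 0.
    by rewrite -[X in _ --> X](mulr0 4); apply: cvgM => //; exact: cvg_cst.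
  apply: (le_vanishing r0') => n.
  have -> : fourier (fun x => F (t, x)) k - fourier (fun x => F (t', x)) k =
    (fourier (fun x => F (t, x)) k - c n t k) + ((c n t k - c n t' k) +
     - (fourier (fun x => F (t', x)) k - c n t' k)) by ring.
  have h1 := hf n t k; have h2 := hf n t' k; have h3 := cL n t t' k.
  apply: (le_trans (le_normcD _ _)); apply: (le_trans (lerD h1 (le_normcD _ _))).
  by rewrite nm_opp; lra.
Qed.

End ModeLimit.

(** * The weak formulation *)

Section Weak.
Context {R : realType}.
Local Notation point4 := (R * point3 R)%type.
Implicit Types (phi : point4 -> R) (z : point4) (i j : 'I_3) (T nu : R).

Local Notation et := ((1, 0) : point4).
Local Notation ex i := ((0, unit_vector i) : point4).

Lemma smooth_continuous phi : smooth phi -> continuous phi.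
Proof. by move=> /(_ [::])[]. Qed.

Lemma smooth_derive phi v : smooth phi -> smooth ('D_v phi).
Proof.
move=> sphi vs; have := sphi (rcons vs v).
by rewrite -cats1 foldr_cat /=.
Qed.

Lemma smooth_is_derive phi z v : smooth phi -> is_derive z v phi ('D_v phi z).
Proof. by move=> /(_ [::])[_ h]; apply: derivableP; exact: h. Qed.

Lemma derive_translate phi z (v w : point4) : (forall z, phi (z + w) = phi z) ->
  'D_v phi (z + w) = 'D_v phi z.
Proof.
move=> pw; rewrite /derive.
rewrite (_ : (fun h : R => h^-1 *: ((phi \o shift (z + w)) (h *: v) - phi (z + w))) =
  (fun h : R => h^-1 *: ((phi \o shift z) (h *: v) - phi z)))//.
by apply/funext => h /=; rewrite addrA !pw.
Qed.

Lemma periodic_pair phi : (forall t, torus_periodic (fun x => phi (t, x))) <->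
  (forall i z, phi (z + (0, (2 * pi) *: unit_vector i)) = phi z).
Proof.
split=> [h i [t x]|h t x i].
  by rewrite add_pair addr0; exact: h.
by rewrite -[RHS](h i) add_pair addr0.
Qed.

Lemma periodic_derive phi (v : point4) : (forall t, torus_periodic (fun x => phi (t, x))) ->
  forall t : R, torus_periodic (fun x => 'D_v phi (t, x)).
Proof.
move=> /periodic_pair h t x i.
have := @derive_translate phi (t, x) v (0, (2 * pi) *: unit_vector i) (h i).
by rewrite add_pair addr0.
Qed.

(** Continuity is bundled in because it supplies the integrability behind additivity: such functions
    are closed under linear combinations. *)
Definition zero_mean T (g : point4 -> R) :=
  continuous g /\ \int[leb4]_(z in cylinder T) g z = 0.

Lemma continuous4M (f g : point4 -> R) : continuous f -> continuous g ->
  continuous (fun z => f z * g z).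
Proof. by move=> cf cg z; apply: (@cvgM _ _ (nbhs z)); [exact: cf|exact: cg]. Qed.

Lemma continuous4D (f g : point4 -> R) : continuous f -> continuous g ->
  continuous (fun z => f z + g z).
Proof. by move=> cf cg z; apply: (@cvgD _ _ _ (nbhs z)); [exact: cf|exact: cg]. Qed.

Lemma continuous4_cst (a : R) : continuous (fun _ : point4 => a).
Proof. by move=> z; exact: cvg_cst. Qed.

Lemma continuous4N (f : point4 -> R) : continuous f -> continuous (fun z => - f z).
Proof. by move=> cf z; apply: (@cvgN _ _ _ (nbhs z)); exact: cf. Qed.

Lemma zero_meanD T f g : 0 <= T -> zero_mean T f -> zero_mean T g ->
  zero_mean T (fun z => f z + g z).
Proof.
move=> T0 [cf f0] [cg g0]; split; first exact: continuous4D.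
rewrite RintegralD ?f0 ?g0 ?addr0//; [exact: measurable_cylinder|exact: continuous_integrable4..].
Qed.

Lemma zero_meanZ T (a : R) f : 0 <= T -> zero_mean T f -> zero_mean T (fun z => a * f z).
Proof.
move=> T0 [cf f0]; split; first exact: continuous4M (@continuous4_cst a) cf.
rewrite RintegralZl ?f0 ?mulr0//; [exact: measurable_cylinder|exact: continuous_integrable4].
Qed.

Lemma zero_mean_sum T (I : Type) (r : seq I) (f : I -> point4 -> R) : 0 <= T ->
  (forall a, zero_mean T (f a)) -> zero_mean T (fun z => \sum_(a <- r) f a z).
Proof.
move=> T0 fz; elim: r => [|a r ih].
  under eq_fun do rewrite big_nil.
  split; first exact: continuous4_cst.
  by rewrite Rintegral_cst ?mul0r//; exact: measurable_cylinder.
under eq_fun do rewrite big_cons.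
by apply: zero_meanD => //; exact: fz.
Qed.

Lemma zero_mean_eq T (f g : point4 -> R) : 0 <= T -> continuous f -> continuous g ->
  zero_mean T (fun z => f z - g z) ->
  \int[leb4]_(z in cylinder T) f z = \int[leb4]_(z in cylinder T) g z.
Proof.
move=> T0 cf cg [_]; rewrite RintegralB; last 3 first.
- exact: measurable_cylinder.
- exact: continuous_integrable4.
- exact: continuous_integrable4.
by move=> /eqP; rewrite subr_eq0 => /eqP.
Qed.

Lemma zero_mean_space T i (G g : point4 -> R) : 0 <= T -> continuous g ->
  (forall z, is_derive z (ex i) G (g z)) ->
  (forall t, torus_periodic (fun x => G (t, x))) -> zero_mean T g.
Proof. by move=> T0 cg dG pG; split => //; exact: integral_cylinder_space dG pG. Qed.

Lemma test_near0 T phi z : (exists a b, [/\ 0 < a, b < T &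
    forall t x, t \notin `[a, b] -> phi (t, x) = 0]) ->
  ~~ (0 < z.1 < T) -> \near z, phi z = 0.
Proof.
case=> a [b [a0 bT h]] zT.
have zab : z.1 \notin `[a, b].
  apply: contra zT; rewrite in_itv/= => /andP[az zb].
  by rewrite (lt_le_trans a0 az) (le_lt_trans zb bT).
have : \forall z' \near z, z'.1 \in ~` [set` `[a, b]].
  have cl : open (~` [set` `[a, b]] : set R) by apply: closed_openC; exact: itv_closed.
  have : \forall t \near z.1, (~` [set` `[a, b]]) t.
    by apply: open_nbhs_nbhs; split => //=; apply/negP.
  move=> /(@cvg_fst _ _ (nbhs z.1) (nbhs z.2)) hh.
  have hz : nbhs z (fun y : point4 => (~` [set` `[a, b]]) y.1) by exact: hh.
  by apply: filterS hz => y /mem_set.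
by apply: filterS => -[t x] /set_mem /= /negP; exact: h.
Qed.

Lemma is_derive_mul (V : normedModType R) (f g : V -> R) (y v : V) (df dg : R) :
  is_derive y v f df -> is_derive y v g dg ->
  is_derive y v (fun y => f y * g y) (df * g y + f y * dg).
Proof.
move=> hf hg; rewrite (_ : (fun y => _) = f * g)//; apply: (is_derive_eq (is_deriveM hf hg)).
by rewrite /GRing.scale/= addrC [g y * _]mulrC.
Qed.

(** [u] is differentiable in time only for 0 < t < T. At other times [phi] vanishes in a
    neighbourhood, so the product has derivative 0 whatever [u] does, and the boundary terms are
    0. *)
Lemma zero_mean_time T (u ut : point4 -> R) phi : 0 < T -> test_function T phi ->
  continuous u -> continuous ut ->
  (forall z, 0 < z.1 < T -> is_derive z et u (ut z)) ->
  zero_mean T (fun z => ut z * phi z + u z * dt phi z).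
Proof.
move=> T0 [sphi pphi supp] cu cut du.
have cphi := smooth_continuous sphi.
have cdphi : continuous (dt phi) := smooth_continuous (smooth_derive et sphi).
have cg : continuous (fun z => ut z * phi z + u z * dt phi z).
  by apply: continuous4D; exact: continuous4M.
split => //; apply: (@integral_cylinder_time R (fun z => u z * phi z)) => //.
  move=> z; have [zT|zT] := boolP (0 < z.1 < T).
    by apply: is_derive_mul; [exact: du|exact: smooth_is_derive].
  have n0 := test_near0 supp zT.
  have d0 : dt phi z = 0.
    have /(@derive_val _ _ _) : is_derive z et phi 0.
      by apply: (near_eq_is_derive _ (is_derive_cst (0 : R) z et)); apply: filterS n0 => y ->.
    exact.
  have phi0 : phi z = 0 by exact: (nbhs_singleton n0).
  rewrite phi0 d0 !mulr0 addr0.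
  by apply: (near_eq_is_derive _ (is_derive_cst (0 : R) z et)); apply: filterS n0 => y ->; rewrite mulr0.
have [a [b [a0 bT h]]] := supp.
move=> x; rewrite !h ?mulr0// in_itv/=.
  by apply/negP => /andP[_]; rewrite leNgt bT.
by apply/negP => /andP[]; rewrite leNgt a0.
Qed.

Definition momentum_integrand nu (u : 'I_3 -> point4 -> R) (p : point4 -> R) i phi z : R :=
  - (u i z * dt phi z) - nu * (u i z * laplacian phi z)
  - \sum_(j < 3) u j z * u i z * dx j phi z - p z * dx i phi z.

Lemma continuous_momentum_integrand nu u p i phi : smooth phi ->
  (forall j, continuous (u j)) -> continuous p ->
  continuous (momentum_integrand nu u p i phi).
Proof.
move=> sphi cu cp.
have c1 v : continuous ('D_v phi) by exact: smooth_continuous (smooth_derive v sphi).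
have c2 v w : continuous ('D_v ('D_w phi)).
  exact: smooth_continuous (smooth_derive v (smooth_derive w sphi)).
do ![apply: continuous4D => //]; do ?apply: continuous4N => //.
- by apply: continuous4M => //; exact: c1.
- apply: continuous4M; first exact: continuous4_cst.
  by apply: continuous4M => //; apply: continuous_sumr => j; exact: c2.
- by apply: continuous_sumr => j; do ![apply: continuous4M => //]; exact: c1.
- by apply: continuous4M => //; exact: c1.
Qed.

Lemma momentum_by_parts T nu (u ut : 'I_3 -> point4 -> R) (ux uxx : 'I_3 -> 'I_3 -> point4 -> R)
    (p : point4 -> R) (px : 'I_3 -> point4 -> R) i phi : 0 < T -> test_function T phi ->
  (forall i, continuous (u i)) -> (forall i, continuous (ut i)) ->
  (forall j i, continuous (ux j i)) -> (forall j i, continuous (uxx j i)) ->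
  continuous p -> (forall i, continuous (px i)) ->
  (forall i z, 0 < z.1 < T -> is_derive z et (u i) (ut i z)) ->
  (forall j i z, is_derive z (ex j) (u i) (ux j i z)) ->
  (forall j i z, is_derive z (ex j) (ux j i) (uxx j i z)) ->
  (forall i z, is_derive z (ex i) p (px i z)) ->
  (forall i t, torus_periodic (fun x => u i (t, x))) ->
  (forall j i t, torus_periodic (fun x => ux j i (t, x))) ->
  (forall t, torus_periodic (fun x => p (t, x))) ->
  \int[leb4]_(z in cylinder T) momentum_integrand nu u p i phi z =
  \int[leb4]_(z in cylinder T) ((ut i z - nu * (\sum_(j < 3) uxx j i z) +
    \sum_(j < 3) (ux j j z * u i z + u j z * ux j i z) + px i z) * phi z).
Proof.
move=> T0 tphi cu cut cux cuxx cp cpx dtu dxu dxux dxp pu pux pp.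
have T0' := ltW T0; have [sphi pphi supp] := tphi.
have cphi := smooth_continuous sphi.
have sx j : smooth (dx j phi) by exact: smooth_derive.
have cphix j : continuous (dx j phi) by exact: smooth_continuous (sx j).
have cphixx j : continuous (dx j (dx j phi)) by exact: smooth_continuous (smooth_derive _ (sx j)).
have dphi j z : is_derive z (ex j) phi (dx j phi z) by exact: smooth_is_derive.
have dphix j z : is_derive z (ex j) (dx j phi) (dx j (dx j phi) z) := smooth_is_derive z (ex j) (sx j).
have pphix j := @periodic_derive phi (ex j) pphi.
have mulp (f g : point4 -> R) : (forall t, torus_periodic (fun x => f (t, x))) ->
    (forall t, torus_periodic (fun x => g (t, x))) ->
    forall t, torus_periodic (fun x => f (t, x) * g (t, x)).
  by move=> pf pg t x k; rewrite pf pg.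
have Z0 := zero_mean_time T0 tphi (cu i) (cut i) (dtu i).
have ZA j : zero_mean T (fun z => ux j i z * dx j phi z + u i z * dx j (dx j phi) z).
  apply: (@zero_mean_space T j (fun z => u i z * dx j phi z)) => //.
  - by apply: continuous4D; apply: continuous4M.
  - by move=> z; exact: is_derive_mul.
  - exact: (mulp (u i) (dx j phi) (pu i) (pphix j)).
have ZB j : zero_mean T (fun z => uxx j i z * phi z + ux j i z * dx j phi z).
  apply: (@zero_mean_space T j (fun z => ux j i z * phi z)) => //.
  - by apply: continuous4D; apply: continuous4M.
  - by move=> z; exact: is_derive_mul.
  - exact: (mulp (ux j i) phi).
have ZC j : zero_mean T (fun z => (ux j j z * u i z + u j z * ux j i z) * phi z + u j z * u i z * dx j phi z).
  apply: (@zero_mean_space T j (fun z => u j z * u i z * phi z)) => //.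
  - apply: continuous4D; apply: continuous4M => //; last exact: continuous4M.
    by apply: continuous4D; apply: continuous4M.
  - by move=> z; apply: is_derive_mul => //; exact: is_derive_mul.
  - by apply: (mulp (fun z => u j z * u i z)) => //; exact: (mulp (u j) (u i)).
have ZP : zero_mean T (fun z => px i z * phi z + p z * dx i phi z).
  apply: (@zero_mean_space T i (fun z => p z * phi z)) => //.
  - by apply: continuous4D; apply: continuous4M.
  - by move=> z; exact: is_derive_mul.
  - exact: (mulp p phi).
apply: zero_mean_eq => //.
- exact: continuous_momentum_integrand.
- apply: continuous4M => //; do ![apply: continuous4D => //].
  + apply: continuous4N; apply: continuous4M; first exact: continuous4_cst.
    by apply: continuous_sumr => j.
  + by apply: continuous_sumr => j; apply: continuous4D; apply: continuous4M.
have ZAs := zero_mean_sum (index_enum 'I_3) T0' ZA.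
have ZBs := zero_mean_sum (index_enum 'I_3) T0' ZB.
have ZCs := zero_mean_sum (index_enum 'I_3) T0' ZC.
(* Five families of exact derivatives: time, the Laplacian moved in two steps (the mixed terms
   cancel between the coefficients - nu and nu), the convective flux and the pressure. *)
have Z := zero_meanD T0' (zero_meanZ (-1) T0' Z0) (zero_meanD T0' (zero_meanZ (- nu) T0' ZAs)
  (zero_meanD T0' (zero_meanZ nu T0' ZBs) (zero_meanD T0' (zero_meanZ (-1) T0' ZCs) (zero_meanZ (-1) T0' ZP)))).
apply: (eq_ind _ (zero_mean T) Z).
apply/funext => z; rewrite /momentum_integrand /laplacian.
rewrite [X in - nu * X](_ : _ = \sum_(j < 3) ux j i z * dx j phi z + u i z * \sum_(j < 3) dx j (dx j phi) z);
  last by rewrite big_split/= mulr_sumr.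
rewrite [X in nu * X + (-1 * _ + _)](_ : _ = (\sum_(j < 3) uxx j i z) * phi z + \sum_(j < 3) ux j i z * dx j phi z);
  last by rewrite big_split/= mulr_suml.
rewrite [X in -1 * X + -1 * (px i z * _ + _)](_ : _ = (\sum_(j < 3) (ux j j z * u i z + u j z * ux j i z)) * phi z +
    \sum_(j < 3) u j z * u i z * dx j phi z); last by rewrite big_split/= mulr_suml.
move: (\sum_(j < 3) dx j (dx j phi) z) (\sum_(j < 3) uxx j i z)
  (\sum_(j < 3) (ux j j z * u i z + u j z * ux j i z)) (\sum_(j < 3) u j z * u i z * dx j phi z)
  (\sum_(j < 3) ux j i z * dx j phi z) (ut i z) (u i z) (p z) (px i z) (phi z) (dt phi z) (dx i phi z)
  => A1 A2 A3 A4 A5 B1 B2 B3 B4 B5 B6 B7.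
clear; ring.
Qed.

Lemma divergence_by_parts T (u : 'I_3 -> point4 -> R) (ux : 'I_3 -> point4 -> R) phi :
  0 < T -> test_function T phi ->
  (forall i, continuous (u i)) -> (forall i, continuous (ux i)) ->
  (forall i z, is_derive z (ex i) (u i) (ux i z)) ->
  (forall i t, torus_periodic (fun x => u i (t, x))) ->
  (forall z, \sum_(i < 3) ux i z = 0) ->
  \int[leb4]_(z in cylinder T) (- \sum_(i < 3) u i z * dx i phi z) = 0.
Proof.
move=> T0 [sphi pphi _] cu cux dxu pu div0; have T0' := ltW T0.
have cphi := smooth_continuous sphi.
have cphix j : continuous (dx j phi) by exact: smooth_continuous (smooth_derive _ sphi).
have Z j : zero_mean T (fun z => ux j z * phi z + u j z * dx j phi z).
  apply: (@zero_mean_space T j (fun z => u j z * phi z)) => //.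
  - by apply: continuous4D; apply: continuous4M.
  - by move=> z; apply: is_derive_mul => //; exact: smooth_is_derive.
  - by move=> t x k; rewrite pu pphi.
have [_ h] := zero_meanZ (-1) T0' (zero_mean_sum (index_enum 'I_3) T0' Z).
rewrite -[RHS]h; apply: eq_Rintegral => z _; rewrite mulN1r big_split/= -mulr_suml.
by rewrite -/(\sum_(j < 3) ux j z) div0 mul0r add0r.
Qed.

End Weak.

(** * The residual of the Galerkin equations *)

Section Residual.
Context {R : realType}.
Local Notation C := (complex R).
Local Notation nm := (@Normc.normc R).
Local Notation fnorm := (@freq_norm R).
Local Notation point4 := (R * point3 R)%type.
Implicit Types (k l q : freq) (s : seq freq) (t : R) (x : point3 R) (U : freq -> 'I_3 -> C).

(** Products of complex exponentials are convolutions, which the real parts in [trig] obscure; under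
    the reality condition the two sums agree. *)
Definition ctrig s (c : freq -> C) x : C := \sum_(k <- s) c k * wave (freq_dot k x).

Lemma Re_ctrig s c x : complex.Re (ctrig s c x) = trig s c x.
Proof. by rewrite /ctrig raddf_sum. Qed.

Lemma ctrig_real s c x : uniq s -> sym_seq s -> (forall k, c (- k) = cj (c k)) ->
  ctrig s c x = (trig s c x)%:C.
Proof.
move=> us ss rc; rewrite -Re_ctrig.
suff : cj (ctrig s c x) = ctrig s c x.
  by case: (ctrig s c x) => a b [] /eqP; rewrite eq_sym -addr_eq0 -mulr2n mulrn_eq0 => /eqP ->.
rewrite /ctrig cj_sum -(sum_opp _ us ss); apply: eq_bigr => k _.
by rewrite cjM -rc freq_dotN waveN opprK cjK.
Qed.

Lemma sum_cube_box (V : nmodType) N (f : freq -> V) : f 0 = 0 ->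
  \sum_(k <- cube N) f k = \sum_(k <- box N) f k.
Proof.
move=> f0; rewrite /box big_filter [RHS]big_mkcond; apply: eq_bigr => k _.
by case: eqP => // ->.
Qed.

(** Incompressibility puts the transport term in divergence form, so it has zero mean. *)
Lemma transport_zero s U i : div_free U -> transport s U U 0 i = 0.
Proof.
move=> dU; rewrite /transport big1// => l _; rewrite /transport_term sub0r.
have := dU (- l); rewrite fdotN => /eqP; rewrite oppr_eq0 => /eqP ->.
by rewrite mulr0 mul0r.
Qed.

Lemma ctrig_transport N U x i : div_free U -> supported (box N) U ->
  \sum_(j < 3) ctrig (box N) (fun k => U k j) x *
    ctrig (box N) (fun k => 'i * (k ord0 j)%:~R * U k i) x =
  ctrig (box (N + N)) (fun q => transport (box N) U U q i) x.
Proof.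
move=> dU sU.
pose w k := wave (freq_dot k x).
transitivity (\sum_(l <- box N) \sum_(k <- box N) 'i * fdot l (U k) * U l i * w (k + l)).
  rewrite exchange_big/=.
  under eq_bigr => j _ do rewrite /ctrig mulr_suml.
  rewrite exchange_big/=; apply: eq_bigr => k _.
  under eq_bigr => j _ do rewrite mulr_sumr.
  rewrite exchange_big/=; apply: eq_bigr => l _.
  rewrite /fdot mulr_sumr !mulr_suml; apply: eq_bigr => j _.
  rewrite /w freq_dotD waveD; ring.
(* The sum k + l of two box frequencies may be 0, which the box excludes; the reindexing takes place
   in the cube, whose extra term is 0 by [transport_zero]. *)
rewrite /ctrig -[RHS]sum_cube_box; last by rewrite transport_zero// mul0r.
rewrite [RHS](eq_bigr (fun q => \sum_(l <- box N) 'i * fdot l (U (q - l)) * U l i * w q)); last first.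
  by move=> q _; rewrite /transport mulr_suml.
rewrite [RHS]exchange_big/= big_seq [RHS]big_seq; apply: eq_bigr => l lN.
rewrite (@sum_shift _ _ (box N) (cube (N + N)) (fun k => 'i * fdot l (U k) * U l i * w (k + l)) l).
- by apply: eq_bigr => q _; rewrite subrK.
- exact: uniq_box.
- exact: uniq_cube.
- move=> k kN; rewrite (_ : fdot l (U k) = 0) ?mulr0 ?mul0r//.
  by rewrite /fdot big1// => j _; rewrite sU// mulr0.
- move=> k; move: lN; rewrite !mem_box mem_cube => /andP[_ /forallP h1] /andP[_ /forallP h2].
  apply/forallP => j; have := h1 j; have := h2 j; rewrite mxE.
  by move: (k ord0 j) (l ord0 j) => a b; lia.
Qed.

Lemma fdot_transport s U q : div_free U ->
  fdot q (transport s U U q) = 'i * \sum_(l <- s) fdot q (U (q - l)) * fdot q (U l).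
Proof.
move=> dU; rewrite {1}/fdot /transport.
under eq_bigr => i _ do rewrite mulr_sumr.
rewrite exchange_big/= mulr_sumr; apply: eq_bigr => l _.
rewrite -(fdot_sub q l dU) [fdot q (U l)]/fdot 2!mulr_sumr; apply: eq_bigr => i _.
by rewrite /transport_term; ring.
Qed.

Lemma leray_pressure s U q i : div_free U ->
  leray q (transport s U U q) i =
  transport s U U q i + 'i * (q ord0 i)%:~R * pressure s U q.
Proof. by move=> dU; rewrite /leray fdot_transport// /pressure; ring. Qed.

(** Inside the box the Galerkin equation is exact once the gradient part removed by the Leray
    projector is written as a pressure; outside, only the projected transport term is left. *)
Lemma residual_coef (nu : R) n U q i : let s := box n.+1 in
  div_free U -> supported s U ->
  rhs nu s U q i + nu%:C * (sqnorm q)%:C * U q i + transport s U U q i +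
    'i * (q ord0 i)%:~R * pressure s U q =
  if q \in s then 0 else leray q (transport s U U q) i.
Proof.
move=> s dU sU; rewrite /rhs; case: ifPn => qs.
  by rewrite (leray_pressure s q i dU) rmorphM; ring.
by rewrite (leray_pressure s q i dU) sU// mulr0 addr0 add0r.
Qed.

(** Nonzero frequencies outside the box exceed n + 1 in norm, so one power |q| <= |q - l| + |l| is
    spent to gain 1/(n+1). It is charged to either factor of the convolution, hence two sums and the
    bound 2 B^2. *)
Lemma residual_le n U (B : R) x i : let s := box n.+1 in
  div_free U -> supported s U ->
  \sum_(k <- s) fnorm k ^+ 0 * vnorm (U k) <= B ->
  \sum_(k <- s) fnorm k ^+ 1 * vnorm (U k) <= B ->
  \sum_(k <- s) fnorm k ^+ 2 * vnorm (U k) <= B ->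
  `|trig (box (n.+1 + n.+1)) (fun q => if q \in s then 0 else leray q (transport s U U q) i) x|
   <= 12 * (27 * (2 * B ^+ 2)) / n.+1%:R.
Proof.
move=> s dU sU h0 h1 h2; set s2 := box _.
have us : uniq s by exact: uniq_box.
have x0 k : 0 <= fnorm k by exact: fnorm_ge0.
have v0 k : 0 <= vnorm (U k) by exact: vnorm_ge0.
pose f j k := fnorm k ^+ j * vnorm (U k).
have fp j k : 0 <= f j k by rewrite mulr_ge0 ?exprn_ge0.
have fs j k : k \notin s -> f j k = 0 by move=> /(vnorm_supported sU) ks; rewrite /f ks mulr0.
have N0 : 0 < n.+1%:R :> R by [].
apply: (le_trans (trig_le _ _ _)).
apply: (@le_trans _ _ (\sum_(q <- s2) 12 * (27 / n.+1%:R * (\sum_(l <- s) f 1%N (q - l) * f 1%N l +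
    \sum_(l <- s) f 0%N (q - l) * f 2%N l)))).
  rewrite big_seq [leRHS]big_seq; apply: ler_sum => q qs2.
  have S0 : 0 <= \sum_(l <- s) f 1%N (q - l) * f 1%N l + \sum_(l <- s) f 0%N (q - l) * f 2%N l.
    by rewrite addr_ge0// sumr_ge0// => l _; rewrite mulr_ge0.
  case: ifPn => qs.
    rewrite Normc.normc0; apply: mulr_ge0 => //; apply: mulr_ge0 => //; exact: divr_ge0.
  have q0 : q != 0 by apply: contraTneq qs2 => ->; exact: zero_notin_box.
  have hx := @fnorm_notin_box R _ _ q0 qs.
  apply: (le_trans (nm_le_vnorm _ _)); apply: (le_trans (vnorm_leray _ q0)); rewrite ler_wpM2l//.
  rewrite mulrAC ler_pdivlMr//.
  apply: (@le_trans _ _ (vnorm (transport s U U q) * fnorm q)).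
    by rewrite ler_wpM2l ?vnorm_ge0// ltW.
  apply: (@le_trans _ _ (3 * (\sum_(l <- s) 9 * (fnorm l * vnorm (U (q - l)) * vnorm (U l))) * fnorm q)).
    rewrite ler_wpM2r//; apply: vnorm_le => j; apply: (le_trans (nm_sum _ _ _)).
    apply: ler_sum => l _; apply: (le_trans (nm_le_vnorm _ _)); exact: vnorm_transport_term.
  rewrite -mulr_sumr mulrA -mulrA (_ : 3 * 9 = 27 :> R); last by ring.
  rewrite ler_wpM2l// -big_split/= mulr_suml; apply: ler_sum => l _.
  have hq : fnorm q <= fnorm (q - l) + fnorm l by have := @fnormD R (q - l) l; rewrite subrK.
  have := ler_wpM2l (mulr_ge0 (mulr_ge0 (x0 l) (v0 (q - l))) (v0 l)) hq.
  rewrite /f; move: (fnorm q) (fnorm l) (fnorm (q - l)) (vnorm (U l)) (vnorm (U (q - l))) => a b c d e h.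
  by apply: (le_trans h); rewrite le_eqVlt; apply/orP; left; apply/eqP; ring.
rewrite -mulr_sumr -mulrA ler_wpM2l// -mulr_sumr mulrAC -mulrA -[leRHS]mulrA ler_wpM2l//.
rewrite ler_wpM2r// big_split/=.
have c1 := conv_sum_le us (uniq_box (n.+1 + n.+1)) (fp 1%N) (fp 1%N) (fs 1%N).
have c2 := conv_sum_le us (uniq_box (n.+1 + n.+1)) (fp 0%N) (fp 2%N) (fs 0%N).
have F j : 0 <= \sum_(k <- s) f j k by exact: sumr_ge0.
have m1 := ler_pM (F 1%N) (F 1%N) h1 h1; have m2 := ler_pM (F 0%N) (F 2%N) h0 h2.
have := lerD (le_trans c1 m1) (le_trans c2 m2).
by rewrite (_ : 2 * B ^+ 2 = B * B + B * B)//; ring.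
Qed.

Lemma trigD s c d x : trig s c x + trig s d x = trig s (fun k => c k + d k) x.
Proof. by rewrite /trig -big_split; apply: eq_bigr => k _; rewrite mulrDl raddfD. Qed.

Lemma trigZ s (a : R) c x : a * trig s c x = trig s (fun k => a%:C * c k) x.
Proof.
rewrite /trig mulr_sumr; apply: eq_bigr => k _; rewrite -mulrA.
by case: (c k * _) => b d /=; ring.
Qed.

Lemma eq_trig s c d x : c =1 d -> trig s c x = trig s d x.
Proof. by move=> /funext ->. Qed.

Lemma momentum_residual (nu : R) n U x i : let s := box n.+1 in let s2 := box (n.+1 + n.+1) in
  real_field U -> div_free U -> supported s U ->
  trig s (fun k => rhs nu s U k i) x
  - nu * (\sum_(j < 3) trig s (fun k => 'i * (k ord0 j)%:~R * ('i * (k ord0 j)%:~R * U k i)) x)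
  + \sum_(j < 3) (trig s (fun k => 'i * (k ord0 j)%:~R * U k j) x * trig s (fun k => U k i) x +
      trig s (fun k => U k j) x * trig s (fun k => 'i * (k ord0 j)%:~R * U k i) x)
  + trig s2 (fun q => 'i * (q ord0 i)%:~R * pressure s U q) x =
  trig s2 (fun q => if q \in s then 0 else leray q (transport s U U q) i) x.
Proof.
move=> s s2 rU dU sU; have us : uniq s by exact: uniq_box.
have us2 : uniq s2 by exact: uniq_box.
have ss2 : {subset s <= s2} by apply: box_sub; exact: leq_addr.
have ss : sym_seq s by exact: box_opp.
have div0 : \sum_(j < 3) trig s (fun k => 'i * (k ord0 j)%:~R * U k j) x = 0.
  rewrite /trig exchange_big/= big1// => k _; rewrite -raddf_sum -mulr_suml.
  have -> : \sum_(j < 3) 'i * (k ord0 j)%:~R * U k j = 'i * fdot k (U k).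
    by rewrite /fdot mulr_sumr; apply: eq_bigr => j _; rewrite mulrA.
  by rewrite dU mulr0 mul0r.
(* By [div0] the divergence form of the transport term reduces to the convective one. *)
rewrite big_split/= -mulr_suml div0 mul0r add0r.
have -> : \sum_(j < 3) trig s (fun k => U k j) x * trig s (fun k => 'i * (k ord0 j)%:~R * U k i) x =
    trig s2 (fun q => transport s U U q i) x.
  rewrite -Re_ctrig -ctrig_transport// raddf_sum; apply: eq_bigr => j _.
  rewrite !ctrig_real//; first by rewrite /= mulr0 subr0.
  by move=> k; rewrite rU mxE !cjM cj_i cj_int rmorphN; ring.
have -> : \sum_(j < 3) trig s (fun k => 'i * (k ord0 j)%:~R * ('i * (k ord0 j)%:~R * U k i)) x =
    trig s (fun k => - ((sqnorm k)%:C * U k i)) x.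
  rewrite /trig exchange_big/=; apply: eq_bigr => k _; rewrite -raddf_sum -mulr_suml.
  congr (complex.Re (_ * _)); rewrite -sqnormC mulr_suml -sumrN; apply: eq_bigr => j _.
  have := sqr_i R; rewrite expr2 => ii.
  rewrite (_ : 'i * (k ord0 j)%:~R * ('i * (k ord0 j)%:~R * U k i) =
    'i * 'i * ((k ord0 j)%:~R * (k ord0 j)%:~R * U k i)); last by ring.
  by rewrite ii mulN1r.
rewrite -mulNr trigZ trigD (trig_sub x us us2 ss2); last first.
  by move=> k ks; rewrite /rhs (negbTE ks) sU// mulr0 oppr0 mulr0 addr0.
rewrite !trigD; apply: eq_trig => q; rewrite -(residual_coef nu q i dU sU) -/s; congr (_ + _ + _ + _).
by rewrite rmorphN mulrN mulNr opprK mulrA.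
Qed.

End Residual.

(** * Weak equations of the Galerkin solutions *)

Section GalerkinWeak.
Context {R : realType}.
Local Notation C := (complex R).
Local Notation nm := (@Normc.normc R).
Local Notation fnorm := (@freq_norm R).
Local Notation point4 := (R * point3 R)%type.
Implicit Types (k l q : freq) (s : seq freq) (t : R) (x : point3 R) (U : R -> freq -> 'I_3 -> C).

Definition ccontinuous (f : R -> C) :=
  continuous (fun t => complex.Re (f t)) /\ continuous (fun t => complex.Im (f t)).

Lemma ccontinuous_cst (c : C) : ccontinuous (fun _ => c).
Proof. by split => t; exact: cvg_cst. Qed.

Lemma ccontinuousD f g : ccontinuous f -> ccontinuous g -> ccontinuous (fun t => f t + g t).
Proof.
move=> [f1 f2] [g1 g2]; split.
  under eq_fun do rewrite raddfD.
  by move=> t; apply: (@cvgD _ _ _ (nbhs t)); [exact: f1|exact: g1].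
under eq_fun do rewrite raddfD.
by move=> t; apply: (@cvgD _ _ _ (nbhs t)); [exact: f2|exact: g2].
Qed.

Lemma ccontinuousM f g : ccontinuous f -> ccontinuous g -> ccontinuous (fun t => f t * g t).
Proof.
move=> [f1 f2] [g1 g2]; split.
  have -> : (fun t => complex.Re (f t * g t)) =
      fun t => complex.Re (f t) * complex.Re (g t) - complex.Im (f t) * complex.Im (g t).
    by apply/funext => t; case: (f t) (g t) => a b [].
  move=> t; apply: (@cvgB _ _ _ (nbhs t)); apply: (@cvgM _ _ (nbhs t)).
  - exact: f1.
  - exact: g1.
  - exact: f2.
  - exact: g2.
have -> : (fun t => complex.Im (f t * g t)) =
    fun t => complex.Re (f t) * complex.Im (g t) + complex.Im (f t) * complex.Re (g t).
  by apply/funext => t; case: (f t) (g t) => a b [].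
move=> t; apply: (@cvgD _ _ _ (nbhs t)); apply: (@cvgM _ _ (nbhs t)).
- exact: f1.
- exact: g2.
- exact: f2.
- exact: g1.
Qed.

Lemma ccontinuousN f : ccontinuous f -> ccontinuous (fun t => - f t).
Proof.
move=> /(ccontinuousM (ccontinuous_cst (-1))).
by under eq_fun do rewrite mulN1r.
Qed.

Lemma ccontinuous_sum (T : Type) (r : seq T) (f : T -> R -> C) :
  (forall a, ccontinuous (f a)) -> ccontinuous (fun t => \sum_(a <- r) f a t).
Proof.
move=> cf; elim: r => [|a r ih].
  by under eq_fun do rewrite big_nil; exact: ccontinuous_cst.
by under eq_fun do rewrite big_cons; apply: ccontinuousD.
Qed.

Lemma ccontinuous_lip (f : R -> C) (L : R) :
  (forall t t', nm (f t - f t') <= L * `|t - t'|) -> ccontinuous f.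
Proof.
by move=> h; split; apply: (@lipschitz_continuous R _ L) => t t'; apply: le_trans (h t t');
  rewrite -raddfB; [exact: Re_le_nm|exact: Im_le_nm].
Qed.

Lemma ccontinuous_fdot q (f : R -> 'I_3 -> C) : (forall i, ccontinuous (fun t => f t i)) ->
  ccontinuous (fun t => fdot q (f t)).
Proof.
move=> cf; apply: ccontinuous_sum => i; apply: ccontinuousM; first exact: ccontinuous_cst.
exact: cf.
Qed.

Lemma ccontinuous_rhs (nu : R) s U k i : (forall k i, ccontinuous (fun t => U t k i)) ->
  ccontinuous (fun t => rhs nu s (U t) k i).
Proof.
move=> cU; rewrite /rhs; case: (boolP (k \in s)) => _ /=; last exact: ccontinuous_cst.
have ct j : ccontinuous (fun t => transport s (U t) (U t) k j).
  apply: ccontinuous_sum => l; apply: ccontinuousM; last exact: cU.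
  apply: ccontinuousM; first exact: ccontinuous_cst.
  by apply: ccontinuous_fdot => j'; exact: cU.
apply: ccontinuousD.
  by apply: ccontinuousM; [exact: ccontinuous_cst|exact: cU].
apply: ccontinuousN; apply: ccontinuousD; first exact: ct.
apply: ccontinuousN; apply: ccontinuousM; first exact: ccontinuous_cst.
by apply: ccontinuousM; [exact: ccontinuous_cst|exact: ccontinuous_fdot].
Qed.

Lemma ccontinuous_pressure s U q : (forall k i, ccontinuous (fun t => U t k i)) ->
  ccontinuous (fun t => pressure s (U t) q).
Proof.
move=> cU; apply: ccontinuousN; apply: ccontinuousM; first exact: ccontinuous_cst.
by apply: ccontinuous_sum => l; apply: ccontinuousM; apply: ccontinuous_fdot => j; exact: cU.
Qed.

Lemma continuous_trig_coef s (c : R -> freq -> C) : (forall k, ccontinuous (fun t => c t k)) ->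
  continuous (fun z : point4 => trig s (c z.1) z.2).
Proof. by move=> cc; apply: continuous_trig_time => k; have [] := cc k. Qed.

Definition galerkin_field n (U : R -> freq -> 'I_3 -> C) (i : 'I_3) (z : point4) : R :=
  trig (box n.+1) (fun k => U z.1 k i) z.2.

Definition galerkin_pressure n (U : R -> freq -> 'I_3 -> C) (z : point4) : R :=
  trig (box (n.+1 + n.+1)) (pressure (box n.+1) (U z.1)) z.2.

Section Solution.
Variables (A0 lam T th tau : R) (m : nat) (A : freq -> 'I_3 -> C) (K nu : R) (n : nat).
Variable U : R -> freq -> 'I_3 -> C.
Hypothesis sol : galerkin_solution A0 lam T th tau m A K nu n U.
Hypothesis T0 : 0 < T.

Lemma galerkin_ccontinuous k i : ccontinuous (fun t => U t k i).
Proof. by case: sol => _ _ _ lipU; apply: (@ccontinuous_lip _ K) => t t'; exact: lipU. Qed.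

Lemma continuous_galerkin_field i : continuous (galerkin_field n U i).
Proof.
by apply: (continuous_trig_coef _ (c := fun t k => U t k i)) => k; exact: galerkin_ccontinuous.
Qed.

Lemma continuous_galerkin_pressure : continuous (galerkin_pressure n U).
Proof.
apply: (continuous_trig_coef _ (c := fun t => pressure (box n.+1) (U t))) => k.
by apply: ccontinuous_pressure => q i; exact: galerkin_ccontinuous.
Qed.

Lemma galerkin_divergence phi : test_function T phi ->
  \int[leb4]_(z in cylinder T) (- \sum_(i < 3) galerkin_field n U i z * dx i phi z) = 0.
Proof.
move=> tphi; have cU := galerkin_ccontinuous.
apply: (@divergence_by_parts R T (galerkin_field n U)
  (fun i z => trig (box n.+1) (fun k => 'i * (k ord0 i)%:~R * U z.1 k i) z.2)) => //.
- exact: continuous_galerkin_field.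
- move=> i; apply: (continuous_trig_coef _ (c := fun t k => 'i * (k ord0 i)%:~R * U t k i)) => k.
  by apply: ccontinuousM; [exact: ccontinuous_cst|exact: cU].
- by move=> i z; exact: (is_derive_trig_space _ (fun t k => U t k i)).
- by move=> i t; exact: (@trig_periodic R (box n.+1) (fun k => U t k i)).
- case=> t x; have [_ dU _ _] := (let: And4 _ h _ _ := sol in h) t.
  rewrite /trig exchange_big/= big1// => k _; rewrite -raddf_sum -mulr_suml.
  have -> : \sum_(j < 3) 'i * (k ord0 j)%:~R * U t k j = 'i * fdot k (U t k).
    by rewrite /fdot mulr_sumr; apply: eq_bigr => j _; rewrite mulrA.
  by rewrite dU mulr0 mul0r.
Qed.

Lemma galerkin_momentum phi i (M : R) : test_function T phi -> (4 < m)%N ->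
  0 <= A0 -> 0 <= lam -> 0 <= tau - lam * T ->
  (forall z, cylinder T z -> `|phi z| <= M) ->
  `|\int[leb4]_(z in cylinder T) momentum_integrand nu (galerkin_field n U)
      (galerkin_pressure n U) i phi z| <=
  12 * (27 * (2 * (40 * A0) ^+ 2)) / n.+1%:R * M * (T * (2 * pi) ^+ 3).
Proof.
move=> tphi m4 A00 lam0 tauT hM; have cU := galerkin_ccontinuous; have T0' := ltW T0.
have [_ P D lipU] := sol; have [sphi _ _] := tphi.
have cphi := smooth_continuous sphi.
have cik c j : (forall k, ccontinuous (fun t => c t k)) ->
    forall k, ccontinuous (fun t => 'i * (k ord0 j)%:~R * c t k).
  by move=> cc k; apply: ccontinuousM; [exact: ccontinuous_cst|exact: cc].
pose ut i z := trig (box n.+1) (fun k => rhs nu (box n.+1) (U z.1) k i) z.2.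
pose ux j i z := trig (box n.+1) (fun k => 'i * (k ord0 j)%:~R * U z.1 k i) z.2.
pose uxx j i z := trig (box n.+1) (fun k => 'i * (k ord0 j)%:~R * ('i * (k ord0 j)%:~R * U z.1 k i)) z.2.
pose px i z := trig (box (n.+1 + n.+1)) (fun q => 'i * (q ord0 i)%:~R * pressure (box n.+1) (U z.1) q) z.2.
have cut i' : continuous (ut i').
  apply: (continuous_trig_coef _ (c := fun t k => rhs nu (box n.+1) (U t) k i')) => k.
  by apply: ccontinuous_rhs => q j; exact: cU.
have cux j i' : continuous (ux j i').
  apply: (continuous_trig_coef _ (c := fun t k => 'i * (k ord0 j)%:~R * U t k i')).
  by apply: cik => k; exact: cU.
have cuxx j i' : continuous (uxx j i').
  apply: (continuous_trig_coef _ (c := fun t k => 'i * (k ord0 j)%:~R * ('i * (k ord0 j)%:~R * U t k i'))).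
  by apply: (cik (fun t k => 'i * (k ord0 j)%:~R * U t k i')); apply: cik => k; exact: cU.
have cpx i' : continuous (px i').
  apply: (continuous_trig_coef _ (c := fun t q => 'i * (q ord0 i')%:~R * pressure (box n.+1) (U t) q)).
  by apply: cik => k; apply: ccontinuous_pressure => q j; exact: cU.
have dut i' z : 0 < z.1 < T -> is_derive z ((1, 0) : point4) (galerkin_field n U i') (ut i' z).
  move=> zT; apply: (is_derive_trig_time _ (c := fun t k => U t k i')
    (dc := fun t k => rhs nu (box n.+1) (U t) k i')) => k; exact: D.
have dux j i' z : is_derive z ((0, unit_vector j) : point4) (galerkin_field n U i') (ux j i' z).
  exact: (is_derive_trig_space _ (fun t k => U t k i')).
have duxx j i' z : is_derive z ((0, unit_vector j) : point4) (ux j i') (uxx j i' z).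
  exact: (is_derive_trig_space _ (fun t k => 'i * (k ord0 j)%:~R * U t k i')).
have dpx i' z : is_derive z ((0, unit_vector i') : point4) (galerkin_pressure n U) (px i' z).
  exact: (is_derive_trig_space _ (fun t => pressure (box n.+1) (U t))).
have pu i' t : torus_periodic (fun x => galerkin_field n U i' (t, x)).
  exact: (@trig_periodic R (box n.+1) (fun k => U t k i')).
have pux j i' t : torus_periodic (fun x => ux j i' (t, x)).
  exact: (@trig_periodic R (box n.+1) (fun k => 'i * (k ord0 j)%:~R * U t k i')).
have pp t : torus_periodic (fun x => galerkin_pressure n U (t, x)).
  exact: (@trig_periodic R (box (n.+1 + n.+1)) (pressure (box n.+1) (U t))).
rewrite (@momentum_by_parts R T nu (galerkin_field n U) ut ux uxx (galerkin_pressure n U) px i phi T0 tphi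
  continuous_galerkin_field cut cux cuxx continuous_galerkin_pressure cpx dut dux duxx dpx pu pux pp).
have [E hE] : exists E : point4 -> R, E = fun z => trig (box (n.+1 + n.+1)) (fun q => if q \in box n.+1 then 0
    else leray q (transport (box n.+1) (U z.1) (U z.1) q) i) z.2 by eexists.
rewrite (_ : \int[leb4]_(z in cylinder T) _ = \int[leb4]_(z in cylinder T) (E z * phi z)); last first.
  apply: eq_Rintegral => z _; have [rU dU sU _] := P z.1.
  by rewrite hE (momentum_residual nu z.2 i rU dU sU).
have cE : continuous E.
  rewrite hE; apply: (continuous_trig_coef _ (c := fun t q => if q \in box n.+1 then 0
    else leray q (transport (box n.+1) (U t) (U t) q) i)) => k.
  case: (boolP (k \in box n.+1)) => _ /=; first exact: ccontinuous_cst.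
  have ct j : ccontinuous (fun t => transport (box n.+1) (U t) (U t) k j).
    apply: ccontinuous_sum => l; apply: ccontinuousM; last exact: cU.
    apply: ccontinuousM; first exact: ccontinuous_cst.
    by apply: ccontinuous_fdot => j'; exact: cU.
  apply: ccontinuousD => //; apply: ccontinuousN; apply: ccontinuousM; first exact: ccontinuous_cst.
  by apply: ccontinuousM; [exact: ccontinuous_cst|exact: ccontinuous_fdot].
have -> : T * (2 * pi) ^+ 3 = fine (leb4 (cylinder T)) by rewrite leb4_cylinder.
apply: (@normr_Rintegral_le_cst _ _ _ leb4) => //.
- exact: measurable_cylinder.
- exact: leb4_cylinder_fin.
- by apply: measurable_funTS; apply: continuous_measurable4; exact: continuous4M.
move=> z cz; rewrite normrM; apply: ler_pM => //; last exact: hM.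
rewrite hE; have [rU dU sU eU] := P z.1.
have tz : 0 <= tau - lam * proj T z.1.
  have /andP[p0 pT] := proj_itv z.1 T0'; have := ler_wpM2l lam0 pT; lra.
have l1 j : (j + 3 <= m)%N -> \sum_(k <- box n.+1) fnorm k ^+ j * vnorm (U z.1 k) <= 40 * A0.
  by move=> jm; exact: (l1_bound0 jm (uniq_box _) (zero_notin_box _) tz A00 eU).
apply: residual_le => //; apply: l1 => //; exact: leq_trans m4.
Qed.

End Solution.

End GalerkinWeak.

(** * Passage to the limit in the weak equations *)

Section WeakLimit.
Context {R : realType}.
Local Notation point4 := (R * point3 R)%type.
Implicit Types (phi : point4 -> R) (z : point4) (i j : 'I_3) (T nu : R).

Lemma integral_limit T (f : point4 -> R) (fn : nat -> point4 -> R) (e e' : nat -> R) :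
  0 <= T -> continuous f -> (forall n, continuous (fn n)) ->
  (forall n z, cylinder T z -> `|f z - fn n z| <= e n) -> e @ \oo --> 0 ->
  (forall n, `|\int[leb4]_(z in cylinder T) fn n z| <= e' n) -> e' @ \oo --> 0 ->
  \int[leb4]_(z in cylinder T) f z = 0.
Proof.
move=> T0 cf cfn he e0 he' e'0; apply/eqP; rewrite -normr_le0.
have r0 : e' n + e n * (T * (2 * pi) ^+ 3) @[n --> \oo] --> 0.
  rewrite -[X in _ --> X](_ : 0 + 0 * (T * (2 * pi) ^+ 3) = 0); last by rewrite mul0r addr0.
  by apply: cvgD => //; apply: cvgM => //; exact: cvg_cst.
apply: (le_vanishing r0) => n; rewrite add0r.
rewrite (_ : \int[leb4]_(z in cylinder T) f z = \int[leb4]_(z in cylinder T) fn n z +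
    \int[leb4]_(z in cylinder T) (f z - fn n z)); last first.
  rewrite RintegralB; [ring|exact: measurable_cylinder|exact: continuous_integrable4..].
apply: (le_trans (ler_normD _ _)); apply: lerD => //.
have -> : T * (2 * pi) ^+ 3 = fine (leb4 (cylinder T)) by rewrite leb4_cylinder.
apply: (@normr_Rintegral_le_cst _ _ _ leb4) => //.
- exact: measurable_cylinder.
- exact: leb4_cylinder_fin.
- apply: measurable_funTS; apply: continuous_measurable4; apply: continuous4D => //.
  exact: continuous4N.
- exact: he.
Qed.

Lemma test_bounded T phi : test_function T phi -> exists M : R, 0 <= M /\
  forall z, cylinder T z -> [/\ `|phi z| <= M, `|dt phi z| <= M, `|laplacian phi z| <= M &
    forall j, `|dx j phi z| <= M].
Proof.
move=> [sphi _ _].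
have c1 v : continuous ('D_v phi) := smooth_continuous (smooth_derive v sphi).
have [M1 h1] := continuous_bounded4 T (smooth_continuous sphi).
have [M2 h2] := continuous_bounded4 T (c1 ((1, 0) : point4)).
have cl : continuous (laplacian phi).
  apply: continuous_sumr => j; exact: smooth_continuous (smooth_derive _ (smooth_derive _ sphi)).
have [M3 h3] := continuous_bounded4 T cl.
have /choice[M4 h4] : forall j, exists M, forall z, cylinder T z -> `|dx j phi z| <= M.
  by move=> j; exact: continuous_bounded4 (c1 _).
exists (`|M1| + `|M2| + `|M3| + \sum_(j < 3) `|M4 j|); split.
  by rewrite !addr_ge0// sumr_ge0.
have S0 : 0 <= \sum_(j < 3) `|M4 j| by rewrite sumr_ge0.
have := ler_norm M1; have := ler_norm M2; have := ler_norm M3.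
have := normr_ge0 M1; have := normr_ge0 M2; have := normr_ge0 M3 => n3 n2 n1 l3 l2 l1 z cz.
split.
- by apply: (le_trans (h1 z cz)); lra.
- by apply: (le_trans (h2 z cz)); lra.
- by apply: (le_trans (h3 z cz)); lra.
move=> j; apply: (le_trans (h4 j z cz)).
have : `|M4 j| <= \sum_(j < 3) `|M4 j|.
  by rewrite (bigD1 j)//= lerDl sumr_ge0.
have := ler_norm (M4 j); lra.
Qed.

Lemma norm_sum4_le (a b c d a' b' c' d' : R) :
  `|a| <= a' -> `|b| <= b' -> `|c| <= c' -> `|d| <= d' ->
  `|- a - b - c - d| <= a' + b' + c' + d'.
Proof.
rewrite !ler_norml => /andP[? ?] /andP[? ?] /andP[? ?] /andP[? ?].
by apply/andP; split; lra.
Qed.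

Lemma momentum_limit T nu (u : 'I_3 -> point4 -> R) (p : point4 -> R)
    (un : nat -> 'I_3 -> point4 -> R) (pn : nat -> point4 -> R) i phi (e e' : nat -> R) (B : R) :
  0 <= T -> 0 <= nu -> test_function T phi ->
  (forall i, continuous (u i)) -> continuous p ->
  (forall n i, continuous (un n i)) -> (forall n, continuous (pn n)) ->
  (forall i z, `|u i z| <= B) -> (forall n i z, `|un n i z| <= B) ->
  (forall n i z, `|u i z - un n i z| <= e n) -> (forall n z, `|p z - pn n z| <= e n) ->
  e @ \oo --> 0 ->
  (forall n, `|\int[leb4]_(z in cylinder T) momentum_integrand nu (un n) (pn n) i phi z| <= e' n) ->
  e' @ \oo --> 0 ->
  \int[leb4]_(z in cylinder T) momentum_integrand nu u p i phi z = 0.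
Proof.
move=> T0 nu0 tphi cu cp cun cpn uB unB ue pe e0 he' e'0.
have [M [M0 hM]] := test_bounded tphi; have [sphi _ _] := tphi.
(* In the constant, 2 counts the time derivative and the pressure, nu the Laplacian, and 6 B the
   three products, each differing by at most 2 B e_n. *)
apply: (@integral_limit T _ (fun n => momentum_integrand nu (un n) (pn n) i phi)
  (fun n => e n * (M * (2 + nu + 6 * B))) e') => //.
- exact: continuous_momentum_integrand.
- by move=> n; exact: continuous_momentum_integrand.
- move=> n z cz; have [_ m2 m3 m4] := hM z cz.
  have B0 : 0 <= B by apply: le_trans (uB i z).
  have en0 : 0 <= e n by apply: le_trans (ue n i z).
  have prodM a b : `|a| <= e n -> `|b| <= M -> `|a * b| <= e n * M.
    by move=> ha hb; rewrite normrM; exact: ler_pM.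
  have h1 := prodM _ _ (ue n i z) m2; have h2 := prodM _ _ (ue n i z) m3.
  have h4 := prodM _ _ (pe n z) (m4 i).
  have h3 j : `|(u j z * u i z - un n j z * un n i z) * dx j phi z| <= 2 * B * e n * M.
    rewrite normrM; apply: ler_pM (normr_ge0 _) (normr_ge0 _) _ (m4 j).
    have -> : u j z * u i z - un n j z * un n i z =
      u j z * (u i z - un n i z) + (u j z - un n j z) * un n i z by ring.
    apply: (le_trans (ler_normD _ _)); rewrite !normrM.
    have k1 := ler_pM (normr_ge0 _) (normr_ge0 _) (uB j z) (ue n i z).
    have k2 := ler_pM (normr_ge0 _) (normr_ge0 _) (ue n j z) (unB n i z).
    by have := lerD k1 k2; rewrite (_ : 2 * B * e n = B * e n + e n * B)//; ring.
  pose S := \sum_(j < 3) (u j z * u i z - un n j z * un n i z) * dx j phi z.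
  have hS : `|S| <= 3 * (2 * B * e n * M).
    apply: (le_trans (ler_norm_sum _ _ _)).
    by apply: (le_trans (ler_sum _ (fun j _ => h3 j))); rewrite sumr_const card_ord [leRHS]mulr_natl.
  rewrite (_ : momentum_integrand nu u p i phi z - _ =
      - ((u i z - un n i z) * dt phi z) - nu * ((u i z - un n i z) * laplacian phi z)
      - S - (p z - pn n z) * dx i phi z); last first.
    rewrite /momentum_integrand /S; under [X in _ = _ - X - _]eq_bigr do rewrite mulrBl.
    rewrite sumrB; move: (\sum_(j < 3) _) (\sum_(j < 3) _) => a b; ring.
  have h5 : `|nu * ((u i z - un n i z) * laplacian phi z)| <= nu * (e n * M).
    by rewrite normrM (ger0_norm nu0) ler_wpM2l.
  apply: (le_trans (norm_sum4_le h1 h5 hS h4)).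
  by rewrite le_eqVlt; apply/orP; left; apply/eqP; ring.
- rewrite -[X in _ --> X](mul0r (M * (2 + nu + 6 * B))).
  by apply: cvgM => //; exact: cvg_cst.
Qed.

Lemma divergence_limit T (u : 'I_3 -> point4 -> R) (un : nat -> 'I_3 -> point4 -> R) phi (e : nat -> R) :
  0 <= T -> test_function T phi -> (forall i, continuous (u i)) ->
  (forall n i, continuous (un n i)) ->
  (forall n i z, `|u i z - un n i z| <= e n) -> e @ \oo --> 0 ->
  (forall n, \int[leb4]_(z in cylinder T) (- \sum_(i < 3) un n i z * dx i phi z) = 0) ->
  \int[leb4]_(z in cylinder T) (- \sum_(i < 3) u i z * dx i phi z) = 0.
Proof.
move=> T0 tphi cu cun ue e0 hn; have [M [M0 hM]] := test_bounded tphi; have [sphi _ _] := tphi.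
have cx j : continuous (dx j phi) := smooth_continuous (smooth_derive _ sphi).
have cI (v : 'I_3 -> point4 -> R) : (forall i, continuous (v i)) ->
    continuous (fun z => - \sum_(i < 3) v i z * dx i phi z).
  by move=> cv; apply: continuous4N; apply: continuous_sumr => j; apply: continuous4M.
apply: (@integral_limit T _ (fun n z => - \sum_(i < 3) un n i z * dx i phi z)
  (fun n => e n * (3 * M)) (fun=> 0)) => //.
- exact: cI.
- by move=> n; apply: cI.
- move=> n z cz; have [_ _ _ m4] := hM z cz.
  rewrite -opprD normrN -sumrB; apply: (le_trans (ler_norm_sum _ _ _)).
  apply: (@le_trans _ _ (\sum_(j < 3) e n * M)).
    by apply: ler_sum => j _; rewrite -mulrBl normrM; apply: ler_pM.
  by rewrite sumr_const card_ord -[leLHS]mulr_natl mulrCA.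
- by rewrite -[X in _ --> X](mul0r (3 * M)); apply: cvgM => //; exact: cvg_cst.
- by move=> n; rewrite hn normr0.
- exact: cvg_cst.
Qed.

End WeakLimit.

(** * Gevrey and Sobolev norms *)

Section Norms.
Context {R : realType}.
Local Notation C := (complex R).
Local Notation nm := (@Normc.normc R).
Local Notation fnorm := (@freq_norm R).
Implicit Types (k l q : freq) (s : seq freq) (t : R) (x : point3 R) (w c : freq -> R).

Lemma fsbig_EFin (A : set freq) (f : freq -> R) : finite_set A ->
  exists2 s, uniq s & (\sum_(k \in A) (f k)%:E)%E = (\sum_(k <- s) f k)%:E.
Proof.
move=> fA; exists (finmap.enum_fset (fset_set A)); first exact: finmap.fset_uniq.
by rewrite fsbig_finite//= sumEFin.
Qed.

Lemma weighted_norm_le w c (B : R) : (forall s, uniq s -> \sum_(k <- s) w k * c k <= B) ->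
  (weighted_norm w c <= (Num.sqrt B)%:E)%E.
Proof.
move=> h; have B0 : 0 <= B by have := h [::] isT; rewrite big_nil.
have e : (\esum_(k in [set: freq]) (w k * c k)%:E <= B%:E)%E.
  apply: ge_ereal_sup => _ /= [X [fX _] <-].
  have [s us ->] := fsbig_EFin (fun k => w k * c k) fX.
  by rewrite lee_fin; exact: h.
rewrite /weighted_norm -(powR12_sqrt B0) -poweR_EFin.
have [e0|e0] := leP 0%E (\esum_(k in [set: freq]) (w k * c k)%:E)%E.
  by apply: gt0_ler_poweR => //; rewrite in_itv/= ?e0 ?leey// lee_fin B0.
have : (0 <= \esum_(k in [set: freq]) (w k * c k)%:E)%E.
  by apply: esum_ge; exists set0; [exact: fsets_set0|rewrite fsbig_set0].
by rewrite leNgt e0.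
Qed.

Lemma weighted_norm_ge0 w c : (0 <= weighted_norm w c)%E.
Proof. exact: poweR_ge0. Qed.

Lemma weighted_norm_fin w c : (weighted_norm w c < +oo)%E ->
  exists M : R, forall s, uniq s -> \sum_(k <- s) w k * c k <= M.
Proof.
move=> /lty_poweRy; rewrite /= invr_eq0 => /(_ _)/wrap[]; first by rewrite pnatr_eq0.
set S := (\esum_(k in _) _)%E => Soo.
have hs s : uniq s -> ((\sum_(k <- s) w k * c k)%:E <= S)%E.
  move=> us; apply: esum_ge; exists [set` s].
    by split => //; exact: finite_seq.
  by rewrite -fsbig_seq// sumEFin.
have S0 : (0 <= S)%E by have := hs [::] isT; rewrite big_nil.
exists (fine S) => s us; rewrite -lee_fin fineK ?ge0_fin_numE//; exact: hs.
Qed.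

(** The formula of [gweight] in another role: it is used to the first power against |c_k|, not
    squared against |c_k|^2. *)
Definition freq_weight (th : R) (j : nat) (tau : R) k : R :=
  fnorm k ^+ j * expR (tau * fnorm k `^ th).

Lemma freq_weight_ge1 th j tau k : 0 <= tau -> k != 0 -> 1 <= freq_weight th j tau k.
Proof.
move=> t0 k0; rewrite /freq_weight mulr_ege1 ?exprn_ege1 ?fnorm_ge1//.
by rewrite -expR0 ler_expR mulr_ge0// powR_ge0.
Qed.

Lemma freq_weight_ge0 th j tau k : 0 <= freq_weight th j tau k.
Proof. by rewrite mulr_ge0 ?exprn_ge0 ?expR_ge0// fnorm_ge0. Qed.

(** The Gevrey weight multiplies squares, so [r] and [tau] enter it doubled, and a linear weight
    must have twice the exponent and the radius to dominate it. Since |k| >= 1, powers are monotone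
    in the exponent. *)
Lemma gevrey_weight_le (s r tau tau' : R) j k : k != 0 -> 2 * r <= j%:R -> 2 * tau <= tau' ->
  gevrey_weight s r tau k <= freq_weight s^-1 j tau' k.
Proof.
move=> k0 rj tt'; have k1 := @fnorm_ge1 R k k0.
rewrite /gevrey_weight /freq_weight; apply: ler_pM; rewrite ?powR_ge0 ?expR_ge0//.
  by rewrite -powR_mulrn ?fnorm_ge0// ler_powR.
by rewrite ler_expR ler_wpM2r ?powR_ge0.
Qed.

Lemma sobolev_weight_le (r th tau : R) j k : k != 0 -> 0 <= r -> 2 * r <= j%:R -> 0 <= tau ->
  sobolev_weight r k <= 2 `^ r * freq_weight th j tau k.
Proof.
move=> k0 r0 rj t0; have k1 := @fnorm_ge1 R k k0.
have x0 : 0 <= fnorm k by exact: fnorm_ge0.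
apply: (@le_trans _ _ ((2 * fnorm k ^+ 2) `^ r)).
  apply: ge0_ler_powR => //; rewrite ?nnegrE ?addr_ge0 ?mulr_ge0 ?exprn_ge0//.
  by have : 1 <= fnorm k ^+ 2 by [rewrite exprn_ege1]; lra.
rewrite powRM ?exprn_ge0// ler_wpM2l ?powR_ge0//.
rewrite -powR_mulrn// -powRrM /freq_weight -[leLHS]mulr1.
apply: ler_pM; rewrite ?powR_ge0//.
  by rewrite -powR_mulrn// ler_powR// mulrC.
by rewrite -expR0 ler_expR mulr_ge0// powR_ge0.
Qed.

(* One factor [nm (c k - d k)] is bounded by the sup norm, the other by the weighted l1 norms. *)
Lemma weighted_sum_le s (W X : freq -> R) (c d : freq -> C) (B e K : R) :
  uniq s -> (forall k, 0 <= W k) -> (forall k, 0 <= X k) -> 0 <= K ->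
  (forall k, k != 0 -> W k <= K * X k) -> c 0 = d 0 ->
  (forall s, uniq s -> \sum_(k <- s) X k * nm (c k) <= B) ->
  (forall s, uniq s -> \sum_(k <- s) X k * nm (d k) <= B) ->
  (forall k, nm (c k - d k) <= e) ->
  \sum_(k <- s) W k * nm (c k - d k) ^+ 2 <= K * (2 * B * e).
Proof.
move=> us W0 X0 K0 WX cd0 hc hd hcd.
have e0 : 0 <= e by apply: le_trans (hcd 0); exact: nm_ge0.
apply: (@le_trans _ _ (\sum_(k <- s) K * ((X k * nm (c k) + X k * nm (d k)) * e))).
  apply: ler_sum => k _; have [->|k0] := eqVneq k 0.
    rewrite cd0 subrr Normc.normc0 expr0n mulr0 !mulr_ge0// -mulrDr mulr_ge0//.
    by rewrite addr_ge0// nm_ge0.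
  rewrite -mulrDr -mulrA mulrA; apply: ler_pM.
  - exact: W0.
  - exact: sqr_ge0.
  - exact: WX.
  rewrite expr2; apply: ler_pM; rewrite ?nm_ge0//.
  by apply: (le_trans (le_normcD _ _)); rewrite nm_opp.
rewrite -mulr_sumr ler_wpM2l// -mulr_suml big_split/= ler_wpM2r//.
have := hc s us; have := hd s us.
by move: (\sum_(k <- s) _) (\sum_(k <- s) _) => a b; lra.
Qed.

Section Spectral.
Variables (th : R) (j : nat) (tau : R -> R) (B L : R).
Hypothesis tau_ge0 : forall t, 0 <= tau t.
Local Notation spec f := (spectral th B L j tau (fun t => fourier (f t))).
Implicit Types (f g : R -> scalar_field R).

Lemma spectral_le f t k : spec f -> nm (fourier (f t) k) <= B.
Proof.
move=> [f0 fB _]; have B0 : 0 <= B by have := fB 0 [::] isT; rewrite big_nil.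
have [->|k0] := eqVneq k 0; first by rewrite f0 Normc.normc0.
have := fB t [:: k] isT; rewrite big_seq1; apply: le_trans.
by rewrite ler_peMl ?nm_ge0//; exact: (freq_weight_ge1 th j (tau_ge0 t) k0).
Qed.

Lemma spectral_norm_le (W : freq -> R) (K : R) f t : spec f -> 0 <= K ->
  (forall k, 0 <= W k) -> (forall k, k != 0 -> W k <= K * freq_weight th j (tau t) k) ->
  forall s, uniq s -> \sum_(k <- s) W k * sqmod (f t) k <= K * (2 * B * B).
Proof.
move=> hf K0 W0 WX s us; have [f0 fB _] := hf.
have B0 : 0 <= B by have := fB 0 [::] isT; rewrite big_nil.
have := @weighted_sum_le s W (freq_weight th j (tau t)) (fourier (f t)) (fun=> 0) B B K us W0
  (freq_weight_ge0 _ _ _) K0 WX (f0 t) (fB t) _ _.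
under [X in (_ -> _ -> X <= _) -> _]eq_bigr do rewrite subr0.
apply => [s' us'|k].
  by rewrite big1// => k _; rewrite Normc.normc0 mulr0.
by rewrite subr0; exact: spectral_le.
Qed.

Lemma spectral_diff_le (W : freq -> R) (K e : R) f g t t' : spec f -> spec g -> 0 <= K ->
  periodic_integrable (f t) -> periodic_integrable (g t') ->
  (forall k, 0 <= W k) -> (forall k, k != 0 -> W k <= K * freq_weight th j (tau t) k) ->
  (forall k, k != 0 -> W k <= K * freq_weight th j (tau t') k) ->
  (forall k, nm (fourier (f t) k - fourier (g t') k) <= e) ->
  forall s, uniq s -> \sum_(k <- s) W k * sqmod (f t \- g t') k <= K * (2 * B * e).
Proof.
move=> hf hg K0 [_ fi] [_ gi] W0 WX WX' fg s us.
have [f0 fB _] := hf; have [g0 gB _] := hg.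
under eq_bigr do rewrite /sqmod fourierB//.
(* The two fields are taken at different times, hence with different radii; the smaller of the two
   weights is controlled by both l^1 bounds. *)
pose X k := Num.min (freq_weight th j (tau t) k) (freq_weight th j (tau t') k).
apply: (weighted_sum_le (X := X)) => //.
- by move=> k; rewrite le_min !freq_weight_ge0.
- by move=> k k0; rewrite /X /Num.min; case: ifP => _; [exact: WX|exact: WX'].
- by rewrite f0 g0.
- move=> s' us'; apply: le_trans (fB t s' us'); apply: ler_sum => k _.
  by rewrite ler_wpM2r ?nm_ge0// ge_min lexx.
- move=> s' us'; apply: le_trans (gB t' s' us'); apply: ler_sum => k _.
  by rewrite ler_wpM2r ?nm_ge0// ge_min lexx orbT.
Qed.

End Spectral.

Lemma vsqmod_sum_le s (W : freq -> R) (u : vector_field R) (B : R) :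
  (forall i, \sum_(k <- s) W k * sqmod (component u i) k <= B) ->
  \sum_(k <- s) W k * vsqmod u k <= 3 * B.
Proof.
move=> h; under eq_bigr do rewrite /vsqmod mulr_sumr.
rewrite exchange_big/=; apply: (le_trans (ler_sum _ (fun i _ => h i))).
by rewrite sumr_const card_ord mulr_natl.
Qed.

Lemma componentB (u v : vector_field R) i : component (u \- v) i = component u i \- component v i.
Proof. by apply/funext => x; rewrite /component /= !mxE. Qed.

End Norms.

(** * The limit fields *)

Section LimitFields.
Context {R : realType}.
Local Notation C := (complex R).
Local Notation nm := (@Normc.normc R).
Local Notation fnorm := (@freq_norm R).
Local Notation point4 := (R * point3 R)%type.
Implicit Types (k l q : freq) (s : seq freq) (t : R) (x : point3 R).

(** With N + 1 > n / th and y = |k|^th, the power |k|^n is at most y^(N+1), and the exponential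
    series contains the term (tau y)^(N+1) / (N+1)!. *)
Lemma exp_beats_power (n : nat) (th tau : R) : 0 < th -> 0 < tau ->
  exists2 K : R, 0 <= K & forall k, k != 0 -> fnorm k ^+ n <= K * expR (tau * fnorm k `^ th).
Proof.
move=> th0 tau0; pose N := Num.truncn (n%:R / th).
exists (N.+1`!%:R / tau ^+ N.+1); first by rewrite divr_ge0// exprn_ge0// ltW.
move=> k k0; have k1 := @fnorm_ge1 R k k0; have x0 : 0 <= fnorm k by exact: fnorm_ge0.
set y := fnorm k `^ th; have y1 : 1 <= y by rewrite -(powRr0 (fnorm k)) ler_powR// ltW.
have y0 : 0 <= y by exact: le_trans y1.
apply: (@le_trans _ _ (y ^+ N.+1)).
  rewrite -!powR_mulrn// /y -powRrM ler_powR// mulrC -ler_pdivrMr//.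
  by apply: ltW; apply: truncnS_gt.
have t0 : 0 < tau ^+ N.+1 by exact: exprn_gt0.
have F0 : 0 < (N.+1)`!%:R :> R by rewrite ltr0n fact_gt0.
rewrite mulrAC ler_pdivlMr// -exprMn -ler_pdivrMl//.
have h := expR_ge1Dxn N (mulr_ge0 (ltW tau0) y0).
by apply: le_trans h; rewrite [y * tau]mulrC [_^-1 * _]mulrC lerDr.
Qed.

(** The squared weight at radius [tau0 / 2] uses half of the exponent in exp(2 tau0 |k|^(1/s)); the
    other half dominates |k|^(2m) whatever [m] is. *)
Lemma initial_energy (r tau0 tau s : R) (a : vector_field R) (m : nat) :
  0 <= r -> 0 < tau0 -> 1 <= s -> tau <= tau0 / 2 -> in_gevrey s r tau0 a ->
  exists2 A0 : R, 0 <= A0 & forall n,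
    genergy (box n.+1) m s^-1 tau (fun k i => fourier (component a i) k) <= A0 ^+ 2.
Proof.
move=> r0 t0 s1 tt [_ /weighted_norm_fin[M hM]].
have s0 : 0 < s^-1 by rewrite invr_gt0 (lt_le_trans ltr01).
have [K K0 hK] := exp_beats_power (m + m) s0 t0.
have M0 : 0 <= M by have := hM [::] isT; rewrite big_nil.
exists (Num.sqrt (K * M)); first exact: sqrtr_ge0.
move=> n; rewrite sqr_sqrtr ?mulr_ge0//.
apply: le_trans (ler_wpM2l K0 (hM _ (uniq_box n.+1))).
rewrite mulr_sumr /genergy big_seq [leRHS]big_seq; apply: ler_sum => k kn.
have k0 : k != 0 by exact: box_neq0 kn.
rewrite mulrA /vsqmod -/(vnorm2 (fun i => fourier (component a i) k)) ler_wpM2r ?vnorm2_ge0//.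
have k1 := @fnorm_ge1 R k k0; have x0 : 0 <= fnorm k by exact: fnorm_ge0.
rewrite /gweight /gevrey_weight exprMn -exprM muln2 -addnn.
set y := fnorm k `^ s^-1; have y0 : 0 <= y by exact: powR_ge0.
have e1 : expR (tau * y) ^+ 2 <= expR (tau0 * y).
  rewrite expr2 -expRD ler_expR -mulrDl ler_wpM2r//; lra.
have x1 : 1 <= fnorm k `^ (2 * r).
  by rewrite -[leLHS](powRr0 (fnorm k)) ler_powR// mulr_ge0.
apply: (@le_trans _ _ (K * expR (tau0 * y) * expR (tau0 * y))).
  by apply: ler_pM; rewrite ?exprn_ge0 ?expR_ge0//; exact: hK.
rewrite -!mulrA ler_wpM2l// -expRD -mulrDl (_ : tau0 + tau0 = 2 * tau0); last by ring.
by rewrite mulrA ler_peMl// expR_ge0.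
Qed.

Section Limit.
Variables (A0 lam T th tau K nu : R) (m J : nat) (A : freq -> 'I_3 -> C).
Variables (U : nat -> R -> freq -> 'I_3 -> C) (d : nat -> R).
Hypotheses (Jm : (J + 3 <= m)%N) (J6 : (6 <= J)%N) (A00 : 0 <= A0).
Hypotheses (th0 : 0 < th) (th1 : th <= 1) (T0 : 0 <= T) (lam0 : 0 <= lam).
Hypothesis tauT : 0 <= tau - lam * T.
Hypothesis sol : forall n, galerkin_solution A0 lam T th tau m A K nu n (U n).
Hypothesis Ud : forall n n' t k, (n <= n')%N ->
  vnorm (fun i => U n' t k i - U n t k i) <= d n.
Hypothesis d0 : d @ \oo --> 0.

Let tauw t := tau - lam * proj T t.

(** The constant of [pressure_l1] for velocities of weighted l^1 norm 40 A0. Likewise [pressure_lip]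
    is that of [pressure_diff], a vector with K-Lipschitz components moving by at most 3 K per unit
    of time. *)
Definition pressure_bound : R := 9 * (2 ^+ J * (2 * (40 * A0) ^+ 2)).
Definition pressure_lip : R := 18 * (40 * A0) * (3 * K).

Lemma tauw_ge0 t : 0 <= tauw t.
Proof.
by rewrite /tauw; have /andP[p0 pT] := proj_itv t T0; have := ler_wpM2l lam0 pT; move: tauT; lra.
Qed.

Lemma galerkin_l1 j n t : (j + 3 <= m)%N ->
  \sum_(k <- box n.+1) fnorm k ^+ j * expR (tauw t * fnorm k `^ th) * vnorm (U n t k) <= 40 * A0.
Proof.
move=> jm; have [_ /(_ t)[_ _ _ E] _ _] := sol n.
exact: (l1_bound jm (uniq_box _) (zero_notin_box _) (tauw_ge0 t) A00 E).
Qed.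

Lemma galerkin_l1_0 n t : \sum_(k <- box n.+1) vnorm (U n t k) <= 40 * A0.
Proof.
have [_ /(_ t)[_ _ _ E] _ _] := sol n.
have h := l1_bound0 (leq_trans _ Jm) (uniq_box _) (zero_notin_box _) (tauw_ge0 t) A00 E.
by have := h 0%N; rewrite leq_add2r => /(_ isT); under eq_bigr do rewrite mul1r.
Qed.

Lemma velocity_limit i : exists f : R -> point3 R -> R,
  [/\ continuous (fun z : point4 => f z.1 z.2), forall t, torus_periodic (f t),
      forall n t x, `|f t x - galerkin_field n (U n) i (t, x)| <= sup_rate (40 * A0) (d n),
      forall n t k, nm (fourier (f t) k - U n t k i) <= 2 * sup_rate (40 * A0) (d n) &
      spectral th (40 * A0) K J tauw (fun t => fourier (f t))].
Proof.
apply: (@mode_limit R (fun n t k => U n t k i) succn th (40 * A0) K J tauw d J6) => //.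
- exact: tauw_ge0.
- by move=> n t k; have [_ /(_ t)[rU _ _ _] _ _] := sol n; exact: rU.
- by move=> n t k kn; have [_ /(_ t)[_ _ sU _] _ _] := sol n; exact: sU.
- move=> n t s us; apply: le_trans (galerkin_l1 n t Jm).
  have [_ /(_ t)[_ _ sU _] _ _] := sol n.
  apply: (@le_trans _ _ (\sum_(k <- s) fnorm k ^+ J * expR (tauw t * fnorm k `^ th) * vnorm (U n t k))).
    apply: ler_sum => k _; rewrite ler_wpM2l ?nm_le_vnorm//.
    exact: (freq_weight_ge0 th J (tauw t) k).
  apply: (@ler_sum_inj R _ s (box n.+1) id
    (fun k => fnorm k ^+ J * expR (tauw t * fnorm k `^ th) * vnorm (U n t k))) => // k.
    by rewrite mulr_ge0 ?vnorm_ge0//; exact: (freq_weight_ge0 th J (tauw t) k).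
  by move=> /(vnorm_supported sU) ->; rewrite mulr0.
- move=> n n' t k nn'; apply: le_trans (Ud t k nn').
  exact: (nm_le_vnorm (fun i => U n' t k i - U n t k i)).
- by move=> n t t' k; have [_ _ _ lipU] := sol n; exact: lipU.
Qed.

Lemma pressure_limit : exists p : R -> point3 R -> R,
  [/\ continuous (fun z : point4 => p z.1 z.2), forall t, torus_periodic (p t),
      forall n t x, `|p t x - galerkin_pressure n (U n) (t, x)| <=
        sup_rate pressure_bound (18 * (40 * A0) * d n),
      forall n t q, nm (fourier (p t) q - pressure (box n.+1) (U n t) q) <=
        2 * sup_rate pressure_bound (18 * (40 * A0) * d n) &
      spectral th pressure_bound pressure_lip J tauw (fun t => fourier (p t))].
Proof.
have d_ge0 n : 0 <= d n by apply: le_trans (Ud 0 0 (leqnn n)); exact: vnorm_ge0.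
have A40 : 0 <= 18 * (40 * A0) by rewrite mulr_ge0// mulr_ge0.
have K0 : 0 <= K.
  have [_ _ _ lipU] := sol 0; have := lipU 0 1 0 ord0.
  by rewrite sub0r normrN1 mulr1; apply: le_trans; exact: nm_ge0.
apply: (@mode_limit R (fun n t q => pressure (box n.+1) (U n t) q) (fun n => (n.+1 + n.+1)%N)
  th pressure_bound pressure_lip J tauw (fun n => 18 * (40 * A0) * d n) J6) => //.
- by move=> n n' nn'; exact: leq_add.
- exact: tauw_ge0.
- move=> n t k; have [_ /(_ t)[rU _ _ _] _ _] := sol n.
  by apply: pressure_real => //; [exact: uniq_box|exact: box_opp].
- move=> n t k kn; have [_ /(_ t)[_ _ sU _] _ _] := sol n; exact: pressure_support.
- move=> n t s us; have [_ /(_ t)[_ _ sU _] _ _] := sol n.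
  apply: pressure_l1 => //; [exact: uniq_box|exact: tauw_ge0|exact: galerkin_l1|].
  by apply: galerkin_l1; apply: leq_trans Jm; rewrite leq_add2r.
- move=> n n' t k nn'.
  have [_ /(_ t)[_ _ sU _] _ _] := sol n; have [_ /(_ t)[_ _ sU' _] _ _] := sol n'.
  have ss : {subset box n.+1 <= box n'.+1} by exact: box_sub.
  rewrite (pressure_sub k (uniq_box _) (uniq_box _) ss sU).
  have sU2 : supported (box n'.+1) (U n t).
    by move=> l ln; apply: sU; apply: contra ln; exact: ss.
  apply: pressure_diff => //; [exact: uniq_box| | |exact: galerkin_l1_0].
    by move=> l; exact: Ud.
  apply: le_trans (galerkin_l1_0 n t).
  apply: (@ler_sum_inj R _ (box n'.+1) (box n.+1) id (fun k => vnorm (U n t k))) => //.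
  - exact: uniq_box.
  - by move=> l; exact: vnorm_ge0.
  - by move=> l; exact: vnorm_supported.
- rewrite -[X in _ --> X](mulr0 (18 * (40 * A0))).
  by apply: cvgM => //; exact: cvg_cst.
- move=> n t t' k; have [_ P _ lipU] := sol n.
  have [_ _ sU _] := P t; have [_ _ sU' _] := P t'.
  rewrite /pressure_lip -[leRHS]mulrA; apply: pressure_diff => //.
  + exact: uniq_box.
  + by rewrite !mulr_ge0.
  + move=> l; rewrite -mulrA; apply: vnorm_le => i; exact: lipU.
  + exact: galerkin_l1_0.
  + exact: galerkin_l1_0.
Qed.

End Limit.

End LimitFields.

(** * Membership in the Sobolev and Gevrey classes *)

Section Membership.
Context {R : realType}.
Local Notation C := (complex R).
Local Notation nm := (@Normc.normc R).
Implicit Types (k l q : freq) (s : seq freq) (t : R) (x : point3 R).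

Variables (sg : R) (J : nat) (tauw : R -> R) (B L : R).
Hypothesis tauw0 : forall t, 0 <= tauw t.
Local Notation th := sg^-1.

Definition spectral_scalar (p : R -> scalar_field R) :=
  (forall t, periodic_integrable (p t)) /\ spectral th B L J tauw (fun t => fourier (p t)).

Definition spectral_vector (u : R -> vector_field R) :=
  (forall i, spectral_scalar (fun t => component (u t) i)) /\
  forall t k, \sum_(i < 3) (k ord0 i)%:~R * fourier (component (u t) i) k = 0.

Lemma gevrey_weight_ge0 (s r tau : R) k : 0 <= gevrey_weight s r tau k.
Proof. by rewrite mulr_ge0 ?powR_ge0 ?expR_ge0. Qed.

Lemma sobolev_weight_ge0 (r : R) k : 0 <= sobolev_weight r k.
Proof. exact: powR_ge0. Qed.

Let gevrey_weight1 (r tau t : R) k : k != 0 -> 2 * r <= J%:R -> 2 * tau <= tauw t ->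
  gevrey_weight sg r tau k <= 1 * freq_weight th J (tauw t) k.
Proof. by move=> k0 rJ tt; rewrite mul1r; exact: gevrey_weight_le. Qed.

Section Scalar.
Variable p : R -> scalar_field R.
Hypothesis hp : spectral_scalar p.

Lemma scalar_sobolev_norm_le (r t : R) : 0 <= r -> 2 * r <= J%:R ->
  (scalar_sobolev_norm r (p t) <= (Num.sqrt (2 `^ r * (2 * B * B)))%:E)%E.
Proof.
move=> r0 rJ; apply: weighted_norm_le => s us.
apply: (spectral_norm_le (W := sobolev_weight r) (K := 2 `^ r) (t := t) tauw0 hp.2) => //.
  by move=> k; exact: sobolev_weight_ge0.
by move=> k k0; exact: sobolev_weight_le.
Qed.

Lemma scalar_gevrey_norm_le (r tau t : R) : 2 * r <= J%:R -> 2 * tau <= tauw t ->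
  (scalar_gevrey_norm sg r tau (p t) <= (Num.sqrt (1 * (2 * B * B)))%:E)%E.
Proof.
move=> rJ tt; apply: weighted_norm_le => s us.
apply: (spectral_norm_le (tau := tauw) (t := t) tauw0 hp.2) => //.
  by move=> k; exact: gevrey_weight_ge0.
by move=> k k0; exact: gevrey_weight1.
Qed.

Lemma spectral_in_scalar_sobolev (r t : R) : 0 <= r -> 2 * r <= J%:R ->
  in_scalar_sobolev r (p t).
Proof.
move=> r0 rJ; have [hpi [p0 _ _]] := hp; split => //.
by apply: le_lt_trans (scalar_sobolev_norm_le _ r0 rJ) _; rewrite ltry.
Qed.

Lemma spectral_in_scalar_gevrey (r tau t : R) : 0 <= r -> 2 * r <= J%:R ->
  2 * tau <= tauw t -> in_scalar_gevrey sg r tau (p t).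
Proof.
move=> r0 rJ tt; split; first exact: spectral_in_scalar_sobolev.
by apply: le_lt_trans (scalar_gevrey_norm_le rJ tt) _; rewrite ltry.
Qed.

Lemma spectral_scalar_Linfty (r : R) (tau : R -> R) (T : R) : 0 <= r -> 2 * r <= J%:R ->
  (forall t, t \in `[0, T] -> 2 * tau t <= tauw t) -> Linfty_scalar_gevrey sg r tau T p.
Proof.
move=> r0 rJ tt; split.
  by apply: aeW => t tT; apply: spectral_in_scalar_gevrey => //; exact: tt.
apply: (@le_lt_trans _ _ (Num.sqrt (1 * (2 * B * B)))%:E); last by rewrite ltry.
apply/ess_supP; apply: aeW => t; rewrite patchE; case: ifPn => tT.
  by apply: scalar_gevrey_norm_le => //; apply: tt; move: tT; rewrite inE.
by rewrite lee_fin sqrtr_ge0.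
Qed.

End Scalar.

Lemma sqrt_dist_cvg0 (c t : R) (D : set R) :
  (Num.sqrt (c * `|t' - t|))%:E @[t' --> within D (nbhs t)] --> 0%E.
Proof.
apply: cvg_EFin; first exact: nearW.
apply: cvg_within_filter.
suff : Num.sqrt (c * `|t' - t|) @[t' --> t] --> Num.sqrt (c * `|t - t|).
  by rewrite subrr normr0 mulr0 sqrtr0.
apply: (@cvg_comp _ _ _ (fun t' => c * `|t' - t|) Num.sqrt _ (nbhs (c * `|t - t|))); last exact: sqrt_continuous.
apply: cvgM; first exact: cvg_cst.
by apply: cvg_norm; apply: cvgB; [exact: cvg_id|exact: cvg_cst].
Qed.

Lemma sobolev_weight0 k : sobolev_weight 0 k = 1 :> R.
Proof. by rewrite /sobolev_weight powRr0. Qed.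

(** The Lipschitz modulus of the modes in time, interpolated with the l^1 bound, gives the Hoelder
    exponent 1/2 in L^2; this is the source of the time continuity. *)
Lemma sobolev_diff0 p t t' s : spectral_scalar p -> uniq s ->
  \sum_(k <- s) sobolev_weight 0 k * sqmod (p t' \- p t) k <= 1 * (2 * B * (L * `|t' - t|)).
Proof.
move=> hp us; have [hpi hps] := hp; have [_ _ hL] := hps.
apply: (spectral_diff_le (tau := tauw) (t := t') (t' := t) hps hps) => //.
- by move=> k; exact: sobolev_weight_ge0.
- by move=> k k0; rewrite sobolev_weight0 mul1r freq_weight_ge1.
- by move=> k k0; rewrite sobolev_weight0 mul1r freq_weight_ge1.
Qed.

Lemma spectral_scalar_time_continuous p (T : R) : spectral_scalar p ->
  scalar_time_continuous T p.
Proof.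
move=> hp t tT; split; first by apply: spectral_in_scalar_sobolev => //; rewrite mulr0.
apply: (@squeeze_cvge _ _ _ _ (fun=> 0%E) _ (fun t' => (Num.sqrt (1 * (2 * B * L) * `|t' - t|))%:E)).
- apply: nearW => t'; rewrite weighted_norm_ge0/=; apply: weighted_norm_le => s us.
  by apply: (le_trans (sobolev_diff0 _ _ hp us)); rewrite !mulrA.
- exact: cvg_cst.
- exact: sqrt_dist_cvg0.
Qed.

Section Vector.
Variable u : R -> vector_field R.
Hypothesis hu : spectral_vector u.

Lemma spectral_sobolev_norm_le (r t : R) : 0 <= r -> 2 * r <= J%:R ->
  (sobolev_norm r (u t) <= (Num.sqrt (3 * (2 `^ r * (2 * B * B))))%:E)%E.
Proof.
move=> r0 rJ; apply: weighted_norm_le => s us; apply: vsqmod_sum_le => i.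
apply: (spectral_norm_le (W := sobolev_weight r) (K := 2 `^ r) (t := t)
  (f := fun t => component (u t) i) tauw0 (hu.1 i).2) => //.
  by move=> k; exact: sobolev_weight_ge0.
by move=> k k0; exact: sobolev_weight_le.
Qed.

Lemma spectral_gevrey_norm_le (r tau t : R) : 2 * r <= J%:R -> 2 * tau <= tauw t ->
  (gevrey_norm sg r tau (u t) <= (Num.sqrt (3 * (1 * (2 * B * B))))%:E)%E.
Proof.
move=> rJ tt; apply: weighted_norm_le => s us; apply: vsqmod_sum_le => i.
apply: (spectral_norm_le (f := fun t => component (u t) i) (tau := tauw) (t := t) tauw0 (hu.1 i).2) => //.
  by move=> k; exact: gevrey_weight_ge0.
by move=> k k0; exact: gevrey_weight1.
Qed.

Lemma spectral_in_sobolev (r t : R) : 0 <= r -> 2 * r <= J%:R -> in_sobolev r (u t).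
Proof.
move=> r0 rJ; have [hi hd] := hu; split => //.
- by move=> i; have [h _] := hi i; exact: h.
- by move=> i; have [_ [h _ _]] := hi i; exact: h.
- by apply: le_lt_trans (spectral_sobolev_norm_le _ r0 rJ) _; rewrite ltry.
Qed.

Lemma spectral_in_gevrey (r tau t : R) : 0 <= r -> 2 * r <= J%:R ->
  2 * tau <= tauw t -> in_gevrey sg r tau (u t).
Proof.
move=> r0 rJ tt; split; first exact: spectral_in_sobolev.
by apply: le_lt_trans (spectral_gevrey_norm_le rJ tt) _; rewrite ltry.
Qed.

Lemma spectral_Linfty (r : R) (tau : R -> R) (T : R) : 0 <= r -> 2 * r <= J%:R ->
  (forall t, t \in `[0, T] -> 2 * tau t <= tauw t) -> Linfty_gevrey sg r tau T u.
Proof.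
move=> r0 rJ tt; split.
  by apply: aeW => t tT; apply: spectral_in_gevrey => //; exact: tt.
apply: (@le_lt_trans _ _ (Num.sqrt (3 * (1 * (2 * B * B))))%:E); last by rewrite ltry.
apply/ess_supP; apply: aeW => t; rewrite patchE; case: ifPn => tT.
  by apply: spectral_gevrey_norm_le => //; apply: tt; move: tT; rewrite inE.
by rewrite lee_fin sqrtr_ge0.
Qed.

Lemma spectral_time_continuous (T : R) : time_continuous T u.
Proof.
move=> t tT; split; first by apply: spectral_in_sobolev => //; rewrite mulr0.
apply: (@squeeze_cvge _ _ _ _ (fun=> 0%E) _ (fun t' => (Num.sqrt (3 * (1 * (2 * B * L)) * `|t' - t|))%:E)).
- apply: nearW => t'; rewrite weighted_norm_ge0/=; apply: weighted_norm_le => s us.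
  rewrite -[3 * _ * _]mulrA; apply: vsqmod_sum_le => i; rewrite componentB.
  apply: (le_trans (sobolev_diff0 (p := fun t => component (u t) i) _ _ (hu.1 i) us)).
  by rewrite !mulrA.
- exact: cvg_cst.
- exact: sqrt_dist_cvg0.
Qed.

End Vector.

Lemma scalar_gevrey_diff_le (p q : R -> scalar_field R) (r tau e t : R) :
  spectral_scalar p -> spectral_scalar q -> 2 * r <= J%:R -> 2 * tau <= tauw t ->
  (forall k, nm (fourier (p t) k - fourier (q t) k) <= e) ->
  (scalar_gevrey_norm sg r tau (p t \- q t)%R <= (Num.sqrt (1 * (2 * B * e)))%:E)%E.
Proof.
move=> [pi ps] [qi qs] rJ tt pq; apply: weighted_norm_le => s us.
apply: (spectral_diff_le (tau := tauw) (t := t) (t' := t) ps qs) => //.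
- by move=> k; exact: gevrey_weight_ge0.
- by move=> k k0; exact: gevrey_weight1.
- by move=> k k0; exact: gevrey_weight1.
Qed.

Lemma gevrey_diff_le (u v : R -> vector_field R) (r tau e t : R) :
  spectral_vector u -> spectral_vector v -> 2 * r <= J%:R -> 2 * tau <= tauw t ->
  (forall i k, nm (fourier (component (u t) i) k - fourier (component (v t) i) k) <= e) ->
  (gevrey_norm sg r tau (u t \- v t)%R <= (Num.sqrt (3 * (1 * (2 * B * e))))%:E)%E.
Proof.
move=> [us _] [vs _] rJ tt uv; apply: weighted_norm_le => s uniqs.
apply: vsqmod_sum_le => i; rewrite componentB; have [ui uspec] := us i; have [vi vspec] := vs i.
apply: (spectral_diff_le (f := fun t => component (u t) i) (g := fun t => component (v t) i)
  (tau := tauw) (t := t) (t' := t) uspec vspec) => //.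
- by move=> k; exact: gevrey_weight_ge0.
- by move=> k k0; exact: gevrey_weight1.
- by move=> k k0; exact: gevrey_weight1.
Qed.

End Membership.

(** * A solution for a fixed viscosity *)

Section Assembly.
Context {R : realType}.
Local Notation C := (complex R).
Local Notation nm := (@Normc.normc R).
Local Notation fnorm := (@freq_norm R).
Local Notation point4 := (R * point3 R)%type.
Implicit Types (k l q : freq) (s : seq freq) (t : R) (x : point3 R).

(* The initial datum need not coincide everywhere with the sum of its Fourier series. *)
Definition patched (a : vector_field R) (f : 'I_3 -> R -> scalar_field R) t : vector_field R :=
  if t == 0 then a else fun x => \row_i f i t x.

Lemma component_patched a f t i :
  component (patched a f t) i = if t == 0 then component a i else f i t.
Proof.
rewrite /patched; case: ifP => // _.
by apply/funext => x; rewrite /component mxE.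
Qed.

Lemma uc_patched a f T i (z : point4) : z \in cylinder T -> uc (patched a f) i z = f i z.1 z.2.
Proof.
move=> /set_mem[/= zT _]; rewrite /uc component_patched gt_eqF//.
by move: zT; rewrite in_itv => /andP[].
Qed.

Variables (A0 lam T sg tau K nu : R) (m J : nat) (a : vector_field R).
Variables (U : nat -> R -> freq -> 'I_3 -> C) (d : nat -> R).
Let A : freq -> 'I_3 -> C := fun k i => fourier (component a i) k.
Hypotheses (Jm : (J + 3 <= m)%N) (J6 : (6 <= J)%N) (A00 : 0 <= A0) (nu0 : 0 <= nu).
Hypotheses (sg1 : 1 <= sg) (T0 : 0 < T) (lam0 : 0 <= lam).
Hypothesis tauT : 0 <= tau - lam * T.
Hypothesis sol : forall n, galerkin_solution A0 lam T sg^-1 tau m A K nu n (U n).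
Hypothesis Ud : forall n n' t k, (n <= n')%N ->
  vnorm (fun i => U n' t k i - U n t k i) <= d n.
Hypothesis d0 : d @ \oo --> 0.
Hypothesis a_integrable : forall i, periodic_integrable (component a i).
Hypothesis a_mean : forall i, fourier (component a i) 0 = 0.

Local Notation tauw := (fun t => tau - lam * proj T t).
Local Notation rate_u := (fun n => sup_rate (40 * A0) (d n)).
Local Notation rate_p := (fun n => sup_rate (pressure_bound A0 J) (18 * (40 * A0) * d n)).

Lemma rate_u_cvg : rate_u @ \oo --> 0.
Proof. exact: sup_rate_cvg0. Qed.

Lemma rate_p_cvg : rate_p @ \oo --> 0.
Proof.
apply: sup_rate_cvg0; rewrite -[X in _ --> X](mulr0 (18 * (40 * A0))).
by apply: cvgM => //; exact: cvg_cst.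
Qed.

Lemma vanishing_twice (e : nat -> R) : e @ \oo --> 0 -> (fun n => 2 * e n) @ \oo --> 0.
Proof.
move=> e0; rewrite -[X in _ --> X](mulr0 2); apply: cvgM => //; exact: cvg_cst.
Qed.

Lemma initial_limit (f : R -> scalar_field R) i :
  (forall n t k, nm (fourier (f t) k - U n t k i) <= 2 * rate_u n) ->
  spectral sg^-1 (40 * A0) K J tauw (fun t => fourier (f t)) ->
  forall k, fourier (f 0) k = fourier (component a i) k.
Proof.
move=> fU [f0 _ _] k; have [->|k0] := eqVneq k 0; first by rewrite f0 a_mean.
(* The mode [k] belongs to every truncation from [N0] on, where at time 0 it equals that of the
   datum. *)
have [N0 hN] := @box_large [:: k] (fun l => ltac:(by rewrite inE => /eqP ->)).
apply/eqP; rewrite -subr_eq0; apply/eqP; apply: (@Normc.eq0_normc R).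
apply/eqP; rewrite eq_le nm_ge0 andbT.
have r0 : 2 * rate_u (n + N0)%N @[n --> \oo] --> 0.
  by have := vanishing_twice rate_u_cvg; rewrite -(cvg_shiftn N0).
apply: (le_vanishing r0) => n; rewrite add0r.
have [I _ _ _] := sol (n + N0); have := fU (n + N0)%N 0 k; rewrite I.
by rewrite (hN (n + N0).+1 _ k) ?inE// ltnW// ltnS leq_addl.
Qed.

Lemma field_bound (f : R -> scalar_field R) i :
  (forall n t x, `|f t x - galerkin_field n (U n) i (t, x)| <= rate_u n) ->
  forall t x, `|f t x| <= 40 * A0.
Proof.
move=> h t x; apply: (le_vanishing rate_u_cvg) => n.
have -> : f t x = galerkin_field n (U n) i (t, x) + (f t x - galerkin_field n (U n) i (t, x)) by ring.
apply: (le_trans (ler_normD _ _)); apply: lerD => //.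
apply: (le_trans (trig_le _ _ _)).
apply: le_trans (galerkin_l1_0 Jm A00 (ltW T0) lam0 tauT sol n t).
by apply: ler_sum => k _; exact: nm_le_vnorm.
Qed.

Lemma galerkin_field_bound n i (z : point4) : `|galerkin_field n (U n) i z| <= 40 * A0.
Proof.
apply: (le_trans (trig_le _ _ _)).
apply: le_trans (galerkin_l1_0 Jm A00 (ltW T0) lam0 tauT sol n z.1).
by apply: ler_sum => k _; exact: nm_le_vnorm.
Qed.

Lemma limit_solution : exists (u : R -> vector_field R) (p : R -> scalar_field R),
  [/\ navier_stokes_solution nu T a u p,
      spectral_vector sg J tauw (40 * A0) K u,
      spectral_scalar sg J tauw (pressure_bound A0 J) (pressure_lip A0 K) p,
      forall n t k i, nm (fourier (component (u t) i) k - U n t k i) <= 2 * rate_u n &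
      forall n t q, nm (fourier (p t) q - pressure (box n.+1) (U n t) q) <= 2 * rate_p n].
Proof.
have T0' := ltW T0.
have th0 : 0 < sg^-1 by rewrite invr_gt0 (lt_le_trans ltr01).
have th1 : sg^-1 <= 1 by rewrite invf_le1// (lt_le_trans ltr01).
have [f hf] := choice (velocity_limit Jm J6 A00 T0' lam0 tauT sol Ud d0).
have [p [cp pp pn pc ps]] := pressure_limit Jm J6 A00 th0 th1 T0' lam0 tauT sol Ud d0.
have cf i : continuous (fun z : point4 => f i z.1 z.2) by have [] := hf i.
have fn i n (z : point4) : `|f i z.1 z.2 - galerkin_field n (U n) i z| <= rate_u n.
  by case: z => t x; have [_ _ h _ _] := hf i; exact: h.
have slice (g : R -> scalar_field R) t : continuous (fun z : point4 => g z.1 z.2) -> continuous (g t).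
  move=> cg x; apply: (@continuous_comp _ _ _ (fun x => (t, x)) (fun z : point4 => g z.1 z.2)); last exact: cg.
  by apply: (@continuous_pair _ _ _ (fun=> t) id) => y; [exact: cvg_cst|exact: cvg_id].
have pint (g : R -> scalar_field R) t : continuous (fun z : point4 => g z.1 z.2) ->
    torus_periodic (g t) -> periodic_integrable (g t).
  by move=> cg pg; split => //; apply: continuous_integrable3; exact: slice.
(* Replacing the limit by the datum at time 0 changes no Fourier coefficient, by [initial_limit], so
   the spectral bounds carry over. *)
have fourier_u t i : fourier (component (patched a f t) i) = fourier (f i t).
  apply/funext => k; rewrite component_patched; case: eqP => [->|//].
  by have [_ _ _ h1 h2] := hf i; rewrite (initial_limit h1 h2).
have u_approx n t k i : nm (fourier (component (patched a f t) i) k - U n t k i) <= 2 * rate_u n.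
  by rewrite fourier_u; have [_ _ _ h _] := hf i; exact: h.
have us : spectral_vector sg J tauw (40 * A0) K (patched a f).
  split=> [i|t k].
    split=> [t|].
      rewrite component_patched; case: ifP => _; first exact: a_integrable.
      by have [c1 p1 _ _ _] := hf i; exact: pint.
    rewrite (_ : (fun t => _) = fun t => fourier (f i t)); first by have [] := hf i.
    by apply/funext => t; exact: fourier_u.
  apply: (@Normc.eq0_normc R); apply/eqP; rewrite eq_le nm_ge0 andbT.
  have r0 : (\sum_(i < 3) nm ((k ord0 i)%:~R : C)) * (2 * rate_u n) @[n --> \oo] --> 0.
    rewrite -[X in _ --> X](mulr0 (\sum_(i < 3) nm ((k ord0 i)%:~R : C))).
    by apply: cvgM; [exact: cvg_cst|exact: vanishing_twice rate_u_cvg].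
  apply: (le_vanishing r0) => n; rewrite add0r.
  have [_ /(_ t)[_ dU _ _] _ _] := sol n.
  (* Subtracting the divergence of the truncation, which is 0, leaves only approximation errors. *)
  have -> : \sum_(i < 3) (k ord0 i)%:~R * fourier (component (patched a f t) i) k =
      \sum_(i < 3) (k ord0 i)%:~R * (fourier (component (patched a f t) i) k - U n t k i).
    under [RHS]eq_bigr do rewrite mulrBr.
    by rewrite sumrB -/(fdot k (U n t k)) dU subr0.
  apply: (le_trans (nm_sum _ _ _)); rewrite mulr_suml; apply: ler_sum => i _.
  by rewrite Normc.normcM ler_wpM2l ?nm_ge0.
have pspec : spectral_scalar sg J tauw (pressure_bound A0 J) (pressure_lip A0 K) p.
  by split => // t; exact: pint.
exists (patched a f), p; split => //; split.
- split.
  + move=> i; apply: (@eq_integrable _ _ _ leb4 (cylinder T) (@measurable_cylinder R T)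
      (EFin \o (fun z : point4 => f i z.1 z.2))); last exact: continuous_integrable4.
    by move=> z zT /=; rewrite (uc_patched _ _ _ zT).
  + move=> i j; apply: (@eq_integrable _ _ _ leb4 (cylinder T) (@measurable_cylinder R T)
      (EFin \o (fun z : point4 => f j z.1 z.2 * f i z.1 z.2))).
      by move=> z zT /=; rewrite !(uc_patched _ _ _ zT).
    exact: continuous_integrable4 (continuous4M (cf j) (cf i)).
  + exact: continuous_integrable4.
- move=> i phi tphi.
  rewrite (_ : \int[leb4]_(z in cylinder T) _ = \int[leb4]_(z in cylinder T)
    momentum_integrand nu (fun i z => f i z.1 z.2) (fun z => p z.1 z.2) i phi z); last first.
    (* The patch at time 0 is invisible on the open cylinder. *)
    apply: eq_Rintegral => z zT; rewrite /momentum_integrand !(uc_patched _ _ _ zT).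
    by congr (_ - _ - _); apply: eq_bigr => j _; rewrite (uc_patched _ _ _ zT).
  have [M [M0 hM]] := test_bounded tphi.
  have hE n := galerkin_momentum (sol n) T0 i tphi (leq_trans _ Jm) A00 lam0 tauT
    (fun z zT => let: And4 h _ _ _ := hM z zT in h).
  apply: (@momentum_limit R T nu _ _ (fun n => galerkin_field n (U n)) (fun n => galerkin_pressure n (U n))
    i phi (fun n => rate_u n + rate_p n)
    (fun n => 12 * (27 * (2 * (40 * A0) ^+ 2)) / n.+1%:R * M * (T * (2 * pi) ^+ 3)) (40 * A0)) => //.
  + by move=> n j; exact: (continuous_galerkin_field (sol n)).
  + by move=> n; exact: (continuous_galerkin_pressure (sol n)).
  + by move=> j z; apply: (field_bound (f := f j) (i := j)) => n t x; have [_ _ h _ _] := hf j; exact: h.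
  + by move=> n j z; exact: galerkin_field_bound.
  + move=> n j z; apply: (le_trans (fn j n z)); rewrite lerDl.
    by rewrite /sup_rate mulr_ge0// sqrtr_ge0.
  + move=> n [t x]; apply: (le_trans (pn n t x)); rewrite lerDr.
    by rewrite /sup_rate mulr_ge0// sqrtr_ge0.
  + by rewrite -[X in _ --> X](addr0 0); apply: cvgD; [exact: rate_u_cvg|exact: rate_p_cvg].
  + by move=> n; apply: hE; apply: (@leq_trans (6 + 3)); rewrite ?leq_add2r.
  + rewrite -[X in _ --> X](_ : 12 * (27 * (2 * (40 * A0) ^+ 2)) * 0 * M * (T * (2 * pi) ^+ 3) = 0).
      by do 2?[apply: cvgM; last exact: cvg_cst]; apply: cvgM; [exact: cvg_cst|exact: cvg_harmonic].
    by rewrite mulr0 !mul0r.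
- move=> phi tphi.
  rewrite (_ : \int[leb4]_(z in cylinder T) _ = \int[leb4]_(z in cylinder T)
    (- \sum_(i < 3) f i z.1 z.2 * dx i phi z)); last first.
    apply: eq_Rintegral => z zT; congr (- _); apply: eq_bigr => j _.
    by rewrite (uc_patched _ _ _ zT).
  apply: (@divergence_limit R T (fun i z => f i z.1 z.2) (fun n => galerkin_field n (U n)) phi rate_u) => //.
  + by move=> n j; exact: (continuous_galerkin_field (sol n)).
  + exact: rate_u_cvg.
  + by move=> n; exact: (galerkin_divergence (sol n) T0 tphi).
- have tw t : 0 <= tauw t by exact: (tauw_ge0 T0' lam0 tauT).
  split.
  + exact: (spectral_time_continuous tw us).
  + exact: (spectral_scalar_time_continuous tw pspec).
  + by rewrite /patched eqxx.
Qed.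

End Assembly.

(** * The inviscid limit *)

Section Main.
Context {R : realType}.
Local Notation C := (complex R).
Local Notation nm := (@Normc.normc R).
Local Notation fnorm := (@freq_norm R).
Implicit Types (k l q : freq) (t : R) (x : point3 R).

Lemma sqrt_add_le (x y : R) : 0 <= x -> 0 <= y -> Num.sqrt (x + y) <= Num.sqrt x + Num.sqrt y.
Proof.
move=> x0 y0; rewrite -ler_sqr ?nnegrE ?addr_ge0 ?sqrtr_ge0// sqr_sqrtr ?addr_ge0//.
rewrite sqrrD !sqr_sqrtr// -addrA lerD2l lerDr mulrn_wge0// mulr_ge0 ?sqrtr_ge0//.
Qed.

Lemma nm_sub3 (a b a' b' : C) : nm (a - b) <= nm (a - a') + nm (b - b') + nm (a' - b').
Proof.
have -> : a - b = (a - a') + (- (b - b')) + (a' - b') by ring.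
apply: (le_trans (le_normcD _ _)); rewrite lerD2r; apply: (le_trans (le_normcD _ _)).
by rewrite nm_opp.
Qed.

(** The constant is a parameter and [tau0] does not occur: a constant obtained for one admissible
    radius therefore serves for all of them. *)
Definition inviscid_limit (r s : R) (a : vector_field R) (c : R) : Prop :=
  exists (nu0 T : R) (tau : R -> R),
  [/\ 0 < nu0, 0 < T,
      {in `[0, T] &, {homo tau : t t' / t < t' >-> t' < t}} &
      {in `[0, T], forall t, 0 < tau t}] /\
  exists (unu : R -> R -> vector_field R) (pnu : R -> R -> scalar_field R)
         (u : R -> vector_field R) (p : R -> scalar_field R),
  [/\ forall nu : R, 0 < nu -> nu <= nu0 ->
        [/\ navier_stokes_solution nu T a (unu nu) (pnu nu),
            Linfty_gevrey s r tau T (unu nu) &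
            Linfty_scalar_gevrey s (r + 1) tau T (pnu nu)],
      [/\ euler_solution T a u p,
          Linfty_gevrey s r tau T u &
          Linfty_scalar_gevrey s (r + 1) tau T p] &
      forall nu t : R, 0 < nu -> nu <= nu0 -> 0 < t -> t <= T ->
        (gevrey_norm s (r - 1) (tau t) (unu nu t \- u t)%R <= (c * Num.sqrt nu)%:E)%E /\
        (scalar_gevrey_norm s r (tau t) (pnu nu t \- p t)%R <= (c * Num.sqrt nu)%:E)%E].

Lemma inviscid_limit_exists (r tau0 s : R) (a : vector_field R) :
  9 / 2 < r -> 0 < tau0 -> 1 <= s -> in_gevrey s r tau0 a -> exists c, inviscid_limit r s a c.
Proof.
move=> r92 tau00 s1 ha; have r0 : 0 <= r by lra.
have th0 : 0 < s^-1 by rewrite invr_gt0 (lt_le_trans ltr01).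
have th1 : s^-1 <= 1 by rewrite invf_le1// (lt_le_trans ltr01).
(* The pressure is measured with index r + 1, which the quadratic weight doubles, so J must exceed 2
   (r + 1). The bound J >= 6 is the one that [l1_le_sup] asks for. *)
pose J := (Num.truncn (2 * r + 2)).+1.
have rJ : 2 * r + 2 < J%:R by exact: truncnS_gt.
have J6 : (6 <= J)%N.
  by rewrite -(ler_nat R); apply: ltW; apply: le_lt_trans rJ; lra.
pose m := (J + 5)%N; have Jm : (J + 3 <= m)%N by rewrite leq_add2l.
have m8 : (8 <= m)%N by rewrite /m; move: J6; clear; lia.
(* The bound 1 is for [weight_diff], the bound tau0 / 2 for [initial_energy]. *)
pose taus := Num.min 1 (tau0 / 2).
have taus0 : 0 < taus by rewrite lt_min ltr01 divr_gt0.
have taus1 : taus <= 1 by rewrite ge_min lexx.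
have taus2 : taus <= tau0 / 2 by rewrite ge_min lexx orbT.
have [A0 A00 hA] := initial_energy m r0 tau00 s1 taus2 ha.
pose A k i := fourier (component a i) k : C.
have [[ai am ad _] _] := ha.
have rA : real_field A by move=> k i; apply: fourierN; have [] := ai i.
have dA : div_free A by exact: ad.
pose lam := @transport_const R m * (A0 + 1) + 1.
have tc0 : 0 <= @transport_const R m.
  by rewrite /transport_const !mulr_ge0// addr_ge0// mulr_ge0// exprn_ge0.
have lam0 : 0 < lam by rewrite ltr_wpDl// mulr_ge0// addr_ge0.
have hlam : @transport_const R m * (A0 + 1) <= lam by rewrite lerDl.
(* At time [T] half of the radius [taus] is used up, so the radius stays positive on the closed
   interval. *)
pose T := taus / (2 * lam).
have T0 : 0 < T by rewrite divr_gt0// mulr_gt0.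
have lamT : lam * T = taus / 2 by rewrite /T; field; rewrite lt0r_neq0.
have tauT : 0 <= taus - lam * T by rewrite lamT; lra.
have [U [sol stab]] := galerkin_family A00 m8 th0 th1 taus1 (ltW T0) (ltW lam0) tauT hlam rA dA hA.
pose Kst := stability_const A0 T.
have Kst0 : 0 <= Kst.
  rewrite /Kst /stability_const mulr_ge0 ?expR_ge0// addr_ge0 ?sqr_ge0// mulr_ge0 ?(ltW T0)//.
  rewrite addr_ge0 ?mulr_ge0 ?sqr_ge0// mulr_ge0// mulr_ge0// mulr_ge0//.
pose d n := Num.sqrt (Kst * n.+1%:R^-1).
have d0 : d @ \oo --> 0.
  suff : d n @[n --> \oo] --> Num.sqrt (Kst * 0) by rewrite mulr0 sqrtr0.
  apply: (@cvg_comp _ _ _ (fun n => Kst * n.+1%:R^-1) Num.sqrt _ (nbhs (Kst * 0))).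
    by apply: cvgM; [exact: cvg_cst|exact: cvg_harmonic].
  exact: sqrt_continuous.
pose Bp := pressure_bound A0 J; pose K := time_lip A0.
pose tauw t := taus - lam * proj T t.
have ex nu : exists up : (R -> vector_field R) * (R -> scalar_field R), 0 <= nu <= 1 ->
  [/\ navier_stokes_solution nu T a up.1 up.2,
      spectral_vector s J tauw (40 * A0) K up.1,
      spectral_scalar s J tauw Bp (pressure_lip A0 K) up.2,
      forall n t k i, nm (fourier (component (up.1 t) i) k - U nu n t k i) <=
        2 * sup_rate (40 * A0) (d n) &
      forall n t q, nm (fourier (up.2 t) q - pressure (box n.+1) (U nu n t) q) <=
        2 * sup_rate Bp (18 * (40 * A0) * d n)].
  have [nu01|nu01] := boolP (0 <= nu <= 1); last by exists (fun _ => a, fun _ _ => 0).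
  have Ud n n' t k : (n <= n')%N -> vnorm (fun i => U nu n' t k i - U nu n t k i) <= d n.
    by move=> nn'; have := stab nu nu n n' t k nu01 nu01 nn'; rewrite subrr expr0n add0r.
  have [u [p H]] := limit_solution Jm J6 A00 (proj1 (andP nu01)) s1 T0 (ltW lam0) tauT
    (fun n => sol nu n nu01) Ud d0 ai am.
  by exists (u, p).
have {}[up upP] := choice ex.
(* The linear weights have radius [taus - lam * t]; the Gevrey norm doubles its own radius, hence
   the division by 2. *)
pose tau t := (taus - lam * t) / 2.
have tt t : t \in `[0, T] -> 2 * tau t <= tauw t.
  by rewrite in_itv /= => tT; rewrite /tau /tauw proj_id// mulrC divfK.
have tw0 t : 0 <= tauw t by exact: (tauw_ge0 (ltW T0) (ltW lam0) tauT).
pose D := Num.sqrt Kst.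
have D0 : 0 <= D by exact: sqrtr_ge0.
have z01 : 0 <= (0 : R) <= 1 by rewrite lexx ler01.
have dist nu n t k : 0 <= nu <= 1 ->
    vnorm (fun i => U nu n t k i - U 0 n t k i) <= D * nu + d n.
  move=> nu01; apply: (le_trans (stab 0 nu n n t k z01 nu01 (leqnn n))).
  have [nu0 _] := andP nu01; rewrite subr0 mulrDr.
  have Ni0 : 0 <= n.+1%:R^-1 :> R by [].
  apply: (le_trans (sqrt_add_le (mulr_ge0 Kst0 (sqr_ge0 nu)) (mulr_ge0 Kst0 Ni0))).
  by rewrite sqrtrM// sqrtr_sqr ger0_norm.
(* The truncation error enters as 2 + 2 times the rate, for the two limits, and once through [dist];
   [n] tends to infinity at fixed viscosity. *)
have ru : 4 * sup_rate (40 * A0) (d n) + d n @[n --> \oo] --> 0.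
  rewrite -[X in _ --> X](_ : 4 * 0 + 0 = 0); last by rewrite mulr0 addr0.
  apply: cvgD => //; apply: cvgM; [exact: cvg_cst|exact: (rate_u_cvg A0 d0)].
have udist nu t i k : 0 <= nu <= 1 ->
    nm (fourier (component ((up nu).1 t) i) k - fourier (component ((up 0).1 t) i) k) <= D * nu.
  move=> nu01; apply: (le_vanishing ru) => n.
  have [_ _ _ h1 _] := upP nu nu01; have [_ _ _ h2 _] := upP 0 z01.
  apply: (le_trans (nm_sub3 _ _ (U nu n t k i) (U 0 n t k i))).
  have h3 := le_trans (nm_le_vnorm (fun i => U nu n t k i - U 0 n t k i) i) (dist nu n t k nu01).
  have := lerD (lerD (h1 n t k i) (h2 n t k i)) h3.
  by move: (d n) (sup_rate _ _) => f e h; apply: (le_trans h); lra.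
pose G := 18 * (40 * A0).
have G0 : 0 <= G by rewrite mulr_ge0// mulr_ge0.
have rp : 4 * sup_rate Bp (G * d n) + G * d n @[n --> \oo] --> 0.
  rewrite -[X in _ --> X](_ : 4 * 0 + G * 0 = 0); last by rewrite !mulr0 addr0.
  apply: cvgD; apply: cvgM => //; try exact: cvg_cst.
  exact: (rate_p_cvg A0 J d0).
have pdist nu t q : 0 <= nu <= 1 ->
    nm (fourier ((up nu).2 t) q - fourier ((up 0).2 t) q) <= G * (D * nu).
  move=> nu01; apply: (le_vanishing rp) => n.
  have [_ _ _ _ h1] := upP nu nu01; have [_ _ _ _ h2] := upP 0 z01.
  apply: (le_trans (nm_sub3 _ _ (pressure (box n.+1) (U nu n t) q) (pressure (box n.+1) (U 0 n t) q))).
  have [_ /(_ t)[_ _ sU _] _ _] := sol nu n nu01; have [_ /(_ t)[_ _ sU0 _] _ _] := sol 0 n z01.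
  have [nu0 _] := andP nu01.
  have E0 : 0 <= D * nu + d n by rewrite addr_ge0 ?mulr_ge0 ?sqrtr_ge0.
  have h3 := pressure_diff q (uniq_box n.+1) E0 sU sU0 (fun k => dist nu n t k nu01)
    (galerkin_l1_0 (U := U 0) Jm A00 (ltW T0) (ltW lam0) tauT (fun n => sol 0 n z01) n t)
    (galerkin_l1_0 (U := U nu) Jm A00 (ltW T0) (ltW lam0) tauT (fun n => sol nu n nu01) n t).
  have := lerD (lerD (h1 n t q) (h2 n t q)) h3.
  rewrite -/G mulrDr; move: (G * d n) (G * (D * nu)) (sup_rate _ _) => f g e h.
  by apply: (le_trans h); lra.
(* The constants of [gevrey_diff_le] and [scalar_gevrey_diff_le] for coefficient distances [D * nu]
   and [G * (D * nu)], with the factor [nu] taken out; its root is the rate. *)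
pose c1 := 3 * (1 * (2 * (40 * A0) * D)); pose c2 := 1 * (2 * Bp * (G * D)).
have Bp0 : 0 <= Bp.
  by rewrite /Bp /pressure_bound mulr_ge0// mulr_ge0 ?exprn_ge0// mulr_ge0 ?sqr_ge0.
have c10 : 0 <= c1 by rewrite mulr_ge0// mulr_ge0// mulr_ge0// mulr_ge0// mulr_ge0.
have c20 : 0 <= c2.
  rewrite /c2; apply: mulr_ge0 => //; apply: mulr_ge0; last exact: mulr_ge0.
  exact: mulr_ge0.
(* The threshold 1 is the range of viscosities covered by [galerkin_family]; the sum of the two
   roots serves for velocity and pressure at once. *)
exists (Num.sqrt c1 + Num.sqrt c2); exists 1, T, tau; split.
  split => //.
  - move=> t t' _ _ tt'; rewrite /tau ltr_pM2r ?invr_gt0// ltrD2l ltrN2.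
    by rewrite ltr_pM2l.
  - move=> t; rewrite in_itv/= => /andP[_ tT]; rewrite /tau divr_gt0//.
    have := ler_wpM2l (ltW lam0) tT; rewrite lamT; lra.
have r1J : 2 * (r + 1) <= J%:R by apply: ltW; apply: le_lt_trans rJ; lra.
have rJ' : 2 * r <= J%:R by apply: le_trans r1J; lra.
have r2J : 2 * (r - 1) <= J%:R by apply: le_trans r1J; lra.
have r10 : 0 <= r + 1 by lra.
have good nu : 0 <= nu <= 1 ->
  [/\ navier_stokes_solution nu T a (up nu).1 (up nu).2,
      Linfty_gevrey s r tau T (up nu).1 & Linfty_scalar_gevrey s (r + 1) tau T (up nu).2].
  move=> nu01; have [h1 h2 h3 _ _] := upP nu nu01; split => //.
  - exact: (spectral_Linfty tw0 h2).
  - exact: (spectral_scalar_Linfty tw0 h3).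
(* The Euler solution is the member [nu = 0] of the same family. *)
exists (fun nu => (up nu).1), (fun nu => (up nu).2), (up 0).1, (up 0).2; split.
- by move=> nu nu0 nu1; apply: good; rewrite (ltW nu0).
- exact: good.
move=> nu t nu0 nu1 t0 tT; have nu01 : 0 <= nu <= 1 by rewrite (ltW nu0).
have ttT := tt t; rewrite in_itv/= (ltW t0) tT in ttT; have {}ttT := ttT isT.
have [_ v1 q1 _ _] := upP nu nu01; have [_ v2 q2 _ _] := upP 0 z01.
split.
  have h := gevrey_diff_le v1 v2 r2J ttT (fun i k => udist nu t i k nu01).
  apply: (le_trans h).
  rewrite lee_fin (_ : 3 * _ = c1 * nu); last by rewrite /c1; ring.
  by rewrite sqrtrM// ler_wpM2r ?sqrtr_ge0// lerDl sqrtr_ge0.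
have h := scalar_gevrey_diff_le q1 q2 rJ' ttT (fun k => pdist nu t k nu01).
apply: (le_trans h).
rewrite lee_fin (_ : 1 * _ = c2 * nu); last by rewrite /c2; ring.
by rewrite sqrtrM// ler_wpM2r ?sqrtr_ge0// lerDr sqrtr_ge0.
Qed.

End Main.

Local Close Scope complex_scope.

Theorem theorem1p1 (R : realType) :
  exists C : R -> R -> vector_field R -> R -> R,
  forall (r tau0 s : R) (a : vector_field R),
  9 / 2 < r -> 0 < tau0 -> 1 <= s -> in_gevrey s r tau0 a ->
  exists (nu0 T : R) (tau : R -> R),
  [/\ 0 < nu0, 0 < T,
      {in `[0, T] &, {homo tau : t t' / t < t' >-> t' < t}} &
      {in `[0, T], forall t, 0 < tau t}] /\
  exists (unu : R -> R -> vector_field R) (pnu : R -> R -> scalar_field R)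
         (u : R -> vector_field R) (p : R -> scalar_field R),
  [/\ forall nu : R, 0 < nu -> nu <= nu0 ->
        [/\ navier_stokes_solution nu T a (unu nu) (pnu nu),
            Linfty_gevrey s r tau T (unu nu) &
            Linfty_scalar_gevrey s (r + 1) tau T (pnu nu)],
      [/\ euler_solution T a u p,
          Linfty_gevrey s r tau T u &
          Linfty_scalar_gevrey s (r + 1) tau T p] &
      forall nu t : R, 0 < nu -> nu <= nu0 -> 0 < t -> t <= T ->
        (gevrey_norm s (r - 1) (tau t) (unu nu t \- u t)%R
           <= (C r s a T * Num.sqrt nu)%:E)%E /\
        (scalar_gevrey_norm s r (tau t) (pnu nu t \- p t)%R
           <= (C r s a T * Num.sqrt nu)%:E)%E].
Proof.
(* The constant may not depend on tau0: it is chosen for the triple (r, s, a) alone. *)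
have ex (x : R * R * vector_field R) : exists c, forall tau0, 9 / 2 < x.1.1 -> 0 < tau0 ->
    1 <= x.1.2 -> in_gevrey x.1.2 x.1.1 tau0 x.2 -> inviscid_limit x.1.1 x.1.2 x.2 c.
  have [[tau0 [h1 h2 h3 h4]]|h] := pselect (exists tau0, [/\ 9 / 2 < x.1.1, 0 < tau0,
      1 <= x.1.2 & in_gevrey x.1.2 x.1.1 tau0 x.2]).
    by have [c hc] := inviscid_limit_exists h1 h2 h3 h4; exists c.
  by exists 0 => tau0 h1 h2 h3 h4; case: h; exists tau0.
have [c hc] := choice ex.
exists (fun r s a _ => c (r, s, a)) => r tau0 s a h1 h2 h3 h4.
exact: (hc (r, s, a) tau0 h1 h2 h3 h4).
Qed.
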